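(* Let $X, X_1, X_2,\dots$ be i.i.d. $\mathbb{Z}$-valued random variables, irreducible and aperiodic, such that for some $\sigma,\delta>0$: $E(X)=0$, $E(X^2)=\sigma^2$, $E(e^{\delta|X|})<\infty$. Let $a_*=\inf\{t\in\mathbb{R}: E(e^{tX})<\infty\}$ and $b_*=\sup\{t\in\mathbb{R}: E(e^{tX})<\infty\}$, let $H(t)=\ln E(e^{tX})$ for $t\in(a_*,b_* )$, and let $a_*<a<b<b_*$. Let $h\in C^2([0,1])$ be a non-negative concave function with $h''<0$ on $[0,1]$, $h'([0,1])\subset H'([a,b])$ and $h(0)=0$. Set $h_n(k)=n\,h(k/n)$ for $k=0,\dots,n$, and let $S_0=0$, $S_k=S_{k-1}+X_k$. Then there are $c_+\ge c_->0$ and $n_0\ge 1$ such that for every $n\ge n_0$, $$e^{-c_+ n^{1/3}}\le e^{n\int_0^1 I(h'(s))\,ds}\;P\bigl(S_k\ge h_n(k)\ \text{for all } k=0,\dots,n,\ \ S_n=\lceil h_n(n)\rceil\bigr)\le e^{-c_- n^{1/3}},$$ where $I(x)=\sup_{\lambda}(\lambda x-H(\lambda))$.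
   Context: ''Irreducible and aperiodic'' means that the random walk on $\mathbb{Z}$ with i.i.d. increments distributed as $X$ is an irreducible and aperiodic Markov chain. One has $a_*<0<b_*$, possibly infinite. In the definition of $I$ the supremum is over $\lambda\in(a_*,b_* )$. *)

(* Defs.v *)
From HB Require Import structures.
From mathcomp Require Import all_boot all_order all_algebra finmap.
From mathcomp Require Import all_classical all_reals all_analysis.
Set Implicit Arguments.
Unset Strict Implicit.
Unset Printing Implicit Defensive.
Import Order.TTheory GRing.Theory Num.Theory.
Import numFieldNormedType.Exports.
Local Open Scope classical_set_scope.
Local Open Scope ring_scope.

HB.instance Definition _ := isPointed.Build int 0.
HB.instance Definition _ := @isMeasurable.Build default_measure_display
  int discrete_measurable discrete_measurable0
  discrete_measurableC discrete_measurableU.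

Definition mutually_independent d d' (T : measurableType d)
    (E : measurableType d') (R : realType) (P : probability T R)
    (X : nat -> {RV P >-> E}) : Prop :=
  forall (J : {fset nat}) (A : nat -> set E), (forall i, measurable (A i)) ->
  P (\bigcap_(i in [set` J]) (X i @^-1` A i)) =
    (\prod_(i <- J) P (X i @^-1` A i))%E.

Definition identically_distributed d d' (T : measurableType d)
    (E : measurableType d') (R : realType) (P : probability T R)
    (X : nat -> {RV P >-> E}) : Prop :=
  forall (i j : nat) (A : set E), measurable A ->
  distribution P (X i) A = distribution P (X j) A.

Definition iid d d' (T : measurableType d) (E : measurableType d')
    (R : realType) (P : probability T R) (X : nat -> {RV P >-> E}) : Prop :=
  mutually_independent X /\ identically_distributed X.

Section markov_chain.
Context {R : realType} {S : choiceType}.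
Implicit Types p : S -> S -> \bar R.
Local Open Scope ereal_scope.

Fixpoint nstep p (n : nat) (x y : S) : \bar R :=
  if n is m.+1 then \esum_(z in [set: S]) (p x z * nstep p m z y)
  else ((x == y)%:R)%:E.

Definition irreducible_chain p : Prop :=
  forall x y, exists n, 0 < nstep p n x y.

(* Every state x has period gcd {n >= 1 | nstep p n x x > 0} = 1, that is,
   the only common divisor of these return times is 1. *)
Definition aperiodic_chain p : Prop :=
  forall x (q : nat),
    (forall n, (0 < n)%N -> 0 < nstep p n x x -> (q %| n)%N) -> q = 1%N.

End markov_chain.

Section integer_walk.
Context d (T : measurableType d) (R : realType) (P : probability T R).
Implicit Types X : {RV P >-> int}.

Definition walk_transition X (x y : int) : \bar R :=
  distribution P X [set y - x].

(* The increments are X 1, X 2, ...; X 0 plays the role of the generic copy. *)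
Definition walk (X : nat -> {RV P >-> int}) (k : nat) (w : T) : int :=
  \sum_(1 <= i < k.+1) X i w.

Definition mgf X (t : R) : \bar R := 'M_P (fun w => (X w)%:~R) t.

Definition mgf_dom X : set R := [set t | (mgf X t < +oo)%E].

Definition a_star X : \bar R := ereal_inf (EFin @` mgf_dom X).

Definition b_star X : \bar R := ereal_sup (EFin @` mgf_dom X).

(* Only meaningful on ]a_star X, b_star X[, where mgf X is finite. *)
Definition log_mgf X (t : R) : R := ln (fine (mgf X t)).

Definition rate X (x : R) : \bar R :=
  ereal_sup [set (l * x - log_mgf X l)%:E |
             l in [set l : R | (a_star X < l%:E < b_star X)%E]].

End integer_walk.

Section calculus_on_a_set.
Context {R : realType}.
Implicit Types (A : set R) (f : R -> R).

(* Derivative relative to A (one-sided at the endpoints of an interval);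
   at points of A it depends only on the restriction of f to A. *)
Definition derivable_in A f (x : R) : Prop :=
  cvg ((fun y => (f y - f x) / (y - x)) @ within A x^').

Definition derive_in A f (x : R) : R :=
  lim ((fun y => (f y - f x) / (y - x)) @ within A x^').

Definition C2_on A f : Prop :=
  [/\ forall x, A x -> derivable_in A f x,
      forall x, A x -> derivable_in A (derive_in A f) x
    & {within A, continuous (derive_in A (derive_in A f))}].

Definition concave_function A f : Prop := convex_function A (fun x => - f x).

Definition scaled f (n k : nat) : R := n%:R * f (k%:R / n%:R).

End calculus_on_a_set.

(* Main.v *)
(** Tilt the k-th increment exponentially by lam_k, chosen so that its mean is
    the increment h_n(k) - h_n(k-1) of the curve.  With Y_k = S_k - h_n(k), a
    summation by parts turns the probability into
    exp(- sum_k I(h_n(k) - h_n(k-1))) times the tilted expectation of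
    exp(- sum_k (lam_k - lam_(k+1)) Y_k) on {Y >= 0}.  Since I and h' are
    Lipschitz, the sum of the I's is n times the integral of I(h') up to O(1);
    since h'' is negative and bounded, lam_k - lam_(k+1) is of exact order 1/n.
    The resulting area-penalised positive walk lives at height N = n^(1/3),
    where a step costs a factor 1 - c/N^2, and (1 - c/N^2)^n is about exp(- c N).

    Both bounds come from one-step inequalities for explicit test functions
    exp(lam_k y) F(y/N): a supersolution which is concave below height N and
    constant above it, where the area penalty takes over, and a subsolution
    ((1 - u^2)^+)^2 centred at a height of order N.  The latter only needs O(N)
    prescribed steps at the start and at the end, at a cost exp(- O(N)); the
    end point is met exactly thanks to irreducibility and aperiodicity. *)
Require Import Defs.
From HB Require Import structures.
From mathcomp Require Import all_boot all_order all_algebra finmap.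
From mathcomp Require Import all_classical all_reals all_analysis.
From mathcomp Require Import measurable_realfun ring lra zify.
Set Implicit Arguments.
Unset Strict Implicit.
Unset Printing Implicit Defensive.
Import Order.TTheory GRing.Theory Num.Theory.
Import numFieldNormedType.Exports.
Local Open Scope classical_set_scope.
Local Open Scope ring_scope.

(** No tilted probability is ever constructed. The tilt sits in the weights [expR (B k + lam k * y)]
    of the test functions, and the summation by parts is done one step at a time: each step replaces
    [lam k.+1 * y] by [lam k * y], and the difference is the area penalty of that step. Of the law
    only one-step inequalities are needed, uniformly in the tilt. Uniformity comes from a window
    [[lo, hi]] containing [a], [b] and 0, with exponential moments a further [eta] beyond both ends:
    one envelope dominates all tilted fourth moments. These suffice, as the test functions obey
    second-order inequalities with an error [x ^+ 4], of order N^-4 against gains of order N^-2.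

    The delicate place is the edge of the strip in the lower bound. There the bump vanishes and
    cannot pay for a loss of order N^-2; what compensates is the convexity of the square, felt by
    jumps towards the centre.

    The tilts are taken at mean value points of [h]. Consecutive such points may be arbitrarily
    close, so their order 1/n decay is read off second differences of [h], not off the distances of
    these points. *)

Section law_of_an_integer_variable.
Context d (T : measurableType d) (R : realType) (P : probability T R).
Variable X : {RV P >-> int}.

Lemma measurable_fun_of_rv d' (U : sigmaRingType d') (f : int -> U)
    (A : set T) : measurable_fun A (fun w => f (X w)).
Proof.
move=> mA B _; apply: measurableI => //.
exact: (measurable_funPTI X (Y := f @^-1` B)).
Qed.

Lemma measurable_rv_eq (z : int) : measurable [set w | X w = z].
Proof. exact: (measurable_funPTI X (Y := [set z])). Qed.

Local Open Scope ereal_scope.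

(** Additivity is used for a family indexed by [nat], so [int] is enumerated by [pickle]; codes
    outside its range give empty pieces, and injectivity of [pickle] brings the sum back to
    [int]. *)
Lemma ge0_integral_law (A : set T) (f : int -> \bar R) :
  measurable A -> (forall z, 0 <= f z) ->
  \int[P]_(w in A) f (X w) =
    \esum_(z in [set: int]) (f z * P (A `&` [set w | X w = z])).
Proof.
move=> mA f0.
pose F (n : nat) := A `&` [set w | choice.pickle (X w) = n].
have mF n : measurable (F n).
  apply: measurableI => //.
  exact: (measurable_funPTI X (Y := [set z | choice.pickle z = n])).
have AE : A = \bigcup_k F k.
  apply/seteqP; split=> [w Aw|w [k _ []]//].
  by exists (choice.pickle (X w)).
have FE z : F (choice.pickle z) = A `&` [set w | X w = z].
  apply/seteqP; split=> w [Aw /= e]; split=> //=; last by rewrite e.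
  exact: (pcan_inj (@choice.pickleK _)).
rewrite [X in integral _ X]AE ge0_integral_bigcup//; last 2 first.
- exact: (measurable_fun_of_rv f).
- by move=> i j _ _ [w [[_ <-] [_ <-]]].
rewrite nneseries_esumT; last by move=> i; exact: integral_ge0.
transitivity (\esum_(n in range (@choice.pickle int)) \int[P]_(w in F n) f (X w)).
  rewrite [RHS]esum_mkcond; apply: eq_esum => n _; case: ifPn => //.
  rewrite notin_setE/= => nr; rewrite (_ : F n = set0) ?integral_set0//.
  apply/seteqP; split=> // w [_ /= e]; apply: nr.
  by exists (X w).
rewrite esum_image; last first.
  by move=> x y _ _; exact: (pcan_inj (@choice.pickleK _)).
apply: eq_esum => z _; rewrite FE -integral_cst//; last first.
  by apply: measurableI => //; exact: measurable_rv_eq.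
by apply: eq_integral => w; rewrite inE => -[_ ->].
Qed.

Lemma measure_split_law (A : set T) : measurable A ->
  P A = \esum_(z in [set: int]) P (A `&` [set w | X w = z]).
Proof.
move=> mA; have := @ge0_integral_law A (fun=> 1) mA (fun=> lee01).
rewrite integral_cst// mul1e => ->.
by apply: eq_esum => z _; rewrite mul1e.
Qed.

Lemma ge0_integral_lawT (f : int -> \bar R) : (forall z, 0 <= f z) ->
  \int[P]_w f (X w) =
    \esum_(z in [set: int]) (f z * distribution P X [set z]).
Proof.
move=> f0; rewrite ge0_integral_law//.
by apply: eq_esum => z _; rewrite setTI.
Qed.

Lemma integral_law_ge_atom (f : int -> \bar R) (z : int) :
  (forall z, 0 <= f z) ->
  f z * distribution P X [set z] <= \int[P]_w f (X w).
Proof.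
move=> f0; rewrite ge0_integral_lawT//; apply: esum_ge.
exists [set z]; first by split.
by rewrite fsbig_set1.
Qed.

End law_of_an_integer_variable.

(** * Killed walks: Markov property, supersolutions, subsolutions, single paths *)

Section constrained_walk.
Context d (T : measurableType d) (R : realType) (P : probability T R).
Variables (Y : {RV P >-> int}) (thr : nat -> R).
Local Open Scope ereal_scope.

(* Expected value of [G] at the end of a walk started from [x] at time [k] and
   killed when below [thr] at one of the times k+1, ..., k+j. *)
Fixpoint surv (j k : nat) (G : int -> \bar R) (x : int) : \bar R :=
  if j is i.+1 then
    \int[P]_w (if (thr k.+1 <= (x + Y w)%:~R)%R
               then surv i k.+1 G (x + Y w)%R else 0)
  else G x.

Lemma surv_ge0 j k G x : (forall y, 0 <= G y) -> 0 <= surv j k G x.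
Proof.
move=> G0; elim: j k x => [|j IH] k x //=.
by apply: integral_ge0 => w _; case: ifP.
Qed.

Lemma survS j k G x : surv j.+1 k G x =
  \int[P]_w (if (thr k.+1 <= (x + Y w)%:~R)%R
             then surv j k.+1 G (x + Y w)%R else 0).
Proof. by []. Qed.

(** The Markov property at time [k + i]. *)
Lemma surv_add i j k G x :
  surv (i + j) k G x = surv i k (surv j (k + i) G) x.
Proof.
elim: i k x => [|i IH] k x; first by rewrite add0n addn0.
rewrite addSn !survS; apply: eq_integral => w _; case: ifP => // _.
by rewrite IH addSnnS.
Qed.

Lemma le_integral_rv (f g : int -> \bar R) : (forall z, 0 <= f z) ->
  (forall z, f z <= g z) -> \int[P]_w f (Y w) <= \int[P]_w g (Y w).
Proof.
move=> f0 fg; apply: ge0_le_integral => //.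
- exact: (measurable_fun_of_rv Y f).
- exact: (measurable_fun_of_rv Y g).
Qed.

Lemma le_surv j k G1 G2 x : (forall y, 0 <= G1 y) ->
  (forall y, G1 y <= G2 y) -> surv j k G1 x <= surv j k G2 x.
Proof.
move=> G10 G12; elim: j k x => [|j IH] k x //.
rewrite !survS; apply: (le_integral_rv
  (f := fun z => if (thr k.+1 <= (x + z)%:~R)%R then surv j k.+1 G1 (x + z)%R else 0)
  (g := fun z => if (thr k.+1 <= (x + z)%:~R)%R then surv j k.+1 G2 (x + z)%R else 0)).
- by move=> z; case: ifP => // _; exact: surv_ge0.
- by move=> z; case: ifP.
Qed.

Lemma surv_scale j k G x (c : R) : (0 <= c)%R -> (forall y, 0 <= G y) ->
  surv j k (fun y => c%:E * G y) x = c%:E * surv j k G x.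
Proof.
move=> c0 G0; elim: j k x => [|j IH] k x //.
rewrite !survS -ge0_integralZl//.
- by apply: eq_integral => w _; case: ifP => // _; rewrite mule0.
- exact: (measurable_fun_of_rv Y (fun z => if (thr k.+1 <= (x + z)%:~R)%R
    then surv j k.+1 G (x + z)%R else 0)).
- by move=> w _; case: ifP => // _; exact: surv_ge0.
Qed.

(** The step inequality makes [G] a supermartingale along the killed walk. It is asked only above
    the threshold, since the killed walk visits no other states. *)
Lemma surv_supersolution (G : nat -> int -> \bar R) j k x :
  (forall i y, 0 <= G i y) ->
  (thr k <= x%:~R)%R ->
  (forall i y, (k <= i < k + j)%N -> (thr i <= y%:~R)%R ->
     surv 1 i (G i.+1) y <= G i y) ->
  surv j k (G (k + j)%N) x <= G k x.
Proof.
move=> G0; elim: j k x => [|j IH] k x thrx step; first by rewrite addn0.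
apply: le_trans (step k x _ thrx); last by rewrite leqnn/= -addSnnS leq_addr.
rewrite [leRHS]survS survS -addSnnS; apply: (le_integral_rv
  (f := fun z => if (thr k.+1 <= (x + z)%:~R)%R then surv j k.+1 (G (k.+1 + j)%N) (x + z)%R else 0)
  (g := fun z => if (thr k.+1 <= (x + z)%:~R)%R then G k.+1 (x + z)%R else 0)).
- by move=> z; case: ifP => // _; exact: surv_ge0.
- move=> z; case: ifP => // thrz; apply: IH => // i y /andP[ki ij]; apply: step.
  by rewrite (ltnW ki) -addSnnS.
Qed.

(** The submartingale counterpart, asked at every state: the weights used later vanish below the
    curve, where the inequality is then trivial. *)
Lemma surv_subsolution (G : nat -> int -> \bar R) j k x :
  (forall i y, 0 <= G i y) ->
  (forall i y, (k <= i < k + j)%N -> G i y <= surv 1 i (G i.+1) y) ->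
  G k x <= surv j k (G (k + j)%N) x.
Proof.
move=> G0; elim: j k x => [|j IH] k x step; first by rewrite addn0.
apply: (le_trans (step k x _)); first by rewrite leqnn/= -addSnnS leq_addr.
rewrite [leRHS]survS survS -addSnnS; apply: (le_integral_rv
  (f := fun z => if (thr k.+1 <= (x + z)%:~R)%R then G k.+1 (x + z)%R else 0)
  (g := fun z => if (thr k.+1 <= (x + z)%:~R)%R then surv j k.+1 (G (k.+1 + j)%N) (x + z)%R else 0)).
- by move=> z; case: ifP.
- move=> z; case: ifP => // thrz; apply: IH => // i y /andP[ki ij]; apply: step.
  by rewrite (ltnW ki) -addSnnS.
Qed.

(** Only the trajectory with increments [s] is kept; each of its steps has probability at least
    [rho]. *)
Lemma surv_path (rho : R) (s : seq int) k G x : (0 <= rho)%R ->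
  (forall y, 0 <= G y) ->
  (forall z, z \in s -> rho%:E <= distribution P Y [set z]) ->
  (forall i, (0 < i <= size s)%N ->
     (thr (k + i) <= (x + \sum_(z <- take i s) z)%:~R)%R) ->
  (rho ^+ size s)%:E * G (x + \sum_(z <- s) z)%R <= surv (size s) k G x.
Proof.
move=> rho0 G0; elim: s k x => [|z s IH] k x ps thrs.
  by rewrite big_nil addr0 expr0 mul1e.
rewrite [size _]/= survS.
pose f y := if (thr k.+1 <= (x + y)%:~R)%R then surv (size s) k.+1 G (x + y)%R else 0.
have f0 y : 0 <= f y by rewrite /f; case: ifP => // _; exact: surv_ge0.
apply: le_trans (integral_law_ge_atom Y z f0).
have thr1 := thrs 1%N isT.
rewrite /= big_cons take0 big_nil addr0 addn1 in thr1.
rewrite /f thr1 exprSr EFinM muleAC muleC muleC.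
apply: lee_pmul; rewrite ?lee_fin//.
- by rewrite mule_ge0// lee_fin exprn_ge0.
- rewrite big_cons addrA; apply: IH => [y ys|i /andP[i0 ilt]].
    by apply: ps; rewrite inE ys orbT.
  have := thrs i.+1; rewrite /= ltnS ilt => /(_ isT).
  by rewrite big_cons addrA addnS addSn.
- by apply: ps; rewrite inE eqxx.
Qed.

End constrained_walk.

(** * The probability of the event as a killed expectation *)

Section walk_and_constrained_mass.
Context d (T : measurableType d) (R : realType) (P : probability T R).
Variables (X : nat -> {RV P >-> int}) (thr : nat -> R) (n : nat) (m : int).
Hypothesis iidX : iid X.
Local Open Scope ereal_scope.

Lemma walkS k w : walk X k.+1 w = (walk X k w + X k.+1 w)%R.
Proof. by rewrite /walk big_nat_recr. Qed.

Lemma measurable_walk k (B : set int) : measurable [set w | B (walk X k w)].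
Proof.
elim: k B => [|k IH] B.
  rewrite /walk; have [B0|B0] := pselect (B 0%R).
    by rewrite (_ : [set _ | _] = setT)//; apply/seteqP; split=> w _ //=;
      rewrite big_nil.
  by rewrite (_ : [set _ | _] = set0)//; apply/seteqP; split=> w //=;
    rewrite big_nil.
rewrite (_ : [set _ | _] = \bigcup_z ([set w | B (walk X k w + z)%R] `&`
    [set w | X k.+1 w = z])); last first.
  apply/seteqP; split=> [w /=|w [z _ [/= Bw zE]]]; rewrite walkS ?zE//.
  by exists (X k.+1 w).
apply: countable_bigcupT_measurable => [|z]; first exact: countableP.
apply: measurableI.
  exact: (IH [set y | B (y + z)%R]).
exact: measurable_rv_eq.
Qed.

(** The whole past is prescribed, not only the position: for such events mutual independence gives
    exact products. *)
Definition cylinder k (z : nat -> int) : set T :=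
  [set w | forall i, (0 < i <= k)%N -> X i w = z i].

Definition future k : set T :=
  [set w | (forall i, (k < i <= n)%N -> (thr i <= (walk X i w)%:~R)%R) /\
           walk X n w = m].

Lemma cylinderE k z : cylinder k z =
  \bigcap_(i in [set` [fset i in iota 1 k]%fset]) (X i @^-1` [set z i]).
Proof.
apply/seteqP; split=> w /= cw i /=.
  by rewrite !inE mem_iota add1n ltnS => /cw.
by move=> ik; apply: (cw i); rewrite /= !inE mem_iota add1n ltnS.
Qed.

Lemma measurable_cylinder k z : measurable (cylinder k z).
Proof.
rewrite cylinderE; apply: bigcap_measurableType => i _.
exact: measurable_rv_eq.
Qed.

Lemma measurable_future k : measurable (future k).
Proof.
rewrite (_ : future k = (\bigcap_(i in [set i | (k < i <= n)%N])
   [set w | (thr i <= (walk X i w)%:~R)%R]) `&` [set w | walk X n w = m]).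
apply: measurableI; last exact: (measurable_walk n [set y | y = m]).
apply: bigcap_measurableType => i _.
exact: (measurable_walk i [set y | (thr i <= y%:~R)%R]).
by apply/seteqP; split.
Qed.

Lemma prob_cylinder k z :
  P (cylinder k z) = \prod_(1 <= i < k.+1) distribution P (X 0%N) [set z i].
Proof.
have [ind idn] := iidX.
rewrite cylinderE (ind _ (fun i => [set z i])) //.
rewrite (perm_big (index_iota 1 k.+1))/=; last first.
  apply: uniq_perm; [exact: fset_uniq|exact: iota_uniq|move=> i].
  by rewrite !inE mem_index_iota mem_iota add1n.
apply: eq_bigr => i _.
exact: (idn i 0%N [set z i]).
Qed.

(** Induction on the remaining time. Splitting according to the next increment [y] gives longer
    cylinders, each carrying an extra factor equal to the mass of [y] under the law of [X 0], which
    is the law integrated in [surv]. *)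
Lemma prob_cylinder_future j k (z : nat -> int) (x : int) :
  (k + j = n)%N -> x = (\sum_(1 <= i < k.+1) z i)%R ->
  P (cylinder k z `&` future k) =
  P (cylinder k z) * surv (X 0%N) thr j k (fun y => (y == m)%:R%:E) x.
Proof.
have walk_cyl l u w : cylinder l u w ->
    walk X l w = (\sum_(1 <= i < l.+1) u i)%R.
  by move=> cw; apply: eq_big_nat => i ik; exact: cw.
elim: j k z x => [|j IH] k z x kn xE.
  rewrite addn0 in kn; subst k; rewrite /=; case: eqP => [xm|xm].
    rewrite mule1; congr (P _); apply/seteqP; split=> [w []//|w cw]; split=> //.
    split; last by rewrite (walk_cyl _ _ _ cw) -xE.
    by move=> i /andP[]; rewrite ltnNge => /negbTE ->.
  rewrite mule0 (_ : _ `&` _ = set0) ?measure0//.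
  apply/seteqP; split=> // w [cw [_ wm]]; apply: xm.
  by rewrite xE -(walk_cyl _ _ _ cw).
have mE : measurable (cylinder k z `&` future k).
  by apply: measurableI; [exact: measurable_cylinder|exact: measurable_future].
rewrite (measure_split_law (X k.+1) mE) survS.
pose f (y : int) := if (thr k.+1 <= (x + y)%:~R)%R
  then surv (X 0%N) thr j k.+1 (fun y => (y == m)%:R%:E) (x + y)%R else 0.
have f0 y : 0 <= f y.
  by rewrite /f; case: ifP => // _; apply: surv_ge0 => u; rewrite lee_fin.
rewrite -ge0_integralZl//; last 2 first.
- exact: (measurable_fun_of_rv (X 0%N) f).
- by move=> w _; exact: f0.
rewrite (ge0_integral_lawT (X 0%N) (f := fun y => P (cylinder k z) * f y)); last first.
  by move=> y; rewrite mule_ge0.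
apply: eq_esum => y _.
pose z' i := if i == k.+1 then y else z i.
have z'E i : (i <= k)%N -> z' i = z i.
  by move=> ik; rewrite /z' ltn_eqF.
have cylS : cylinder k z `&` [set w | X k.+1 w = y] = cylinder k.+1 z'.
  apply/seteqP; split=> [w [cw /= Xw] i|w cw].
    rewrite /z'; case: eqP => [->//|/eqP ik1] /andP[i0].
    by rewrite leq_eqVlt (negbTE ik1)/= ltnS => ik; rewrite cw// i0.
  split=> [i /andP[i0 ik]|/=].
    by rewrite -z'E// cw// i0 (leq_trans ik).
  by rewrite cw//= /z' eqxx.
have pcylS : P (cylinder k.+1 z') =
    P (cylinder k z) * distribution P (X 0%N) [set y].
  rewrite !prob_cylinder big_nat_recr//= /z' eqxx; congr (_ * _).
  by apply: eq_big_nat => i /andP[_ ik]; rewrite ltn_eqF.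
have sumS : (x + y = \sum_(1 <= i < k.+2) z' i)%R.
  rewrite big_nat_recr//= /z' eqxx xE; congr (_ + _)%R.
  by apply: eq_big_nat => i /andP[_ ik]; rewrite ltn_eqF.
rewrite -muleA [f y * _]muleC muleA -pcylS /f; case: ifP => [thrx|/negP thrx].
  rewrite -(IH k.+1 z' (x + y)%R)// ?addSnnS//; congr (P _).
  rewrite -cylS setIAC; apply/seteqP; split=> w [[cw Xw] [fw wm]]; do !split=> //.
    by move=> i /andP[ki iN]; apply: fw; rewrite (ltnW ki).
  move=> i /andP[]; rewrite leq_eqVlt => /orP[/eqP <- _|ki iN].
    by rewrite (walk_cyl k.+1 z') -?sumS// -cylS.
  by apply: fw; rewrite ki.
rewrite mule0 (_ : _ `&` _ = set0) ?measure0//.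
apply/seteqP; split=> // w [[cw [fw wm]] Xw]; apply: thrx.
rewrite sumS -(walk_cyl k.+1 z' w) -?cylS//; apply: fw.
by rewrite ltnSn/= -kn -addSnnS leq_addr.
Qed.

Lemma prob_future : P (future 0) =
  surv (X 0%N) thr n 0 (fun y => (y == m)%:R%:E) 0%R.
Proof.
have := @prob_cylinder_future n 0 (fun=> 0%R) 0%R (erefl _).
rewrite big_nil => /(_ erefl).
have -> : cylinder 0 (fun=> 0%R) = setT.
  by apply/seteqP; split=> // w _ i /andP[]; rewrite leqn0 lt0n => /negbTE ->.
by rewrite setTI probability_setT mul1e.
Qed.

End walk_and_constrained_mass.

(** * Expectations of real functions of an integer variable *)

Section exponential_tilting.
Context d (T : measurableType d) (R : realType) (P : probability T R).
Variable X : {RV P >-> int}.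

Definition integ (f : int -> R) : Prop :=
  P.-integrable setT (fun w => (f (X w))%:E).

Definition EX (f : int -> R) : R := \int[P]_w f (X w).

Lemma EX_fin f : integ f -> (EX f)%:E = (\int[P]_w (f (X w))%:E)%E.
Proof. by move=> fi; rewrite /EX /Rintegral fineK//; exact: integrable_fin_num. Qed.

Lemma integ_le f g : (forall z, `|f z| <= g z) -> integ g -> integ f.
Proof.
move=> fg; apply: le_integrable => //.
  exact: (measurable_fun_of_rv X (fun z => (f z)%:E)).
by move=> w _; rewrite /= lee_fin (le_trans (fg _))// ler_norm.
Qed.

Lemma integ_ge0_lty f : (forall z, 0 <= f z) ->
  (\int[P]_w (f (X w))%:E < +oo)%E -> integ f.
Proof.
move=> f0 fy; apply/integrableP; split.
  exact: (measurable_fun_of_rv X (fun z => (f z)%:E)).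
by under eq_integral do rewrite abse_EFin ger0_norm//.
Qed.

Lemma integZ c f : integ f -> integ (fun z => c * f z).
Proof. by move=> fi; exact: (integrableZl measurableT c fi). Qed.

Lemma integD f g : integ f -> integ g -> integ (fun z => f z + g z).
Proof. by move=> fi gi; exact: (integrableD measurableT fi gi). Qed.

Lemma integ_cst c : integ (fun=> c).
Proof. exact: finite_measure_integrable_cst. Qed.

Lemma EXZ c f : integ f -> EX (fun z => c * f z) = c * EX f.
Proof. by move=> fi; exact: (RintegralZl c measurableT fi). Qed.

Lemma EXD f g : integ f -> integ g -> EX (fun z => f z + g z) = EX f + EX g.
Proof. by move=> fi gi; exact: (RintegralD measurableT fi gi). Qed.

Lemma EX_cst c : EX (fun=> c) = c.
Proof. by rewrite /EX Rintegral_cst//= probability_setT mulr1. Qed.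

Lemma le_EX f g : integ f -> integ g -> (forall z, f z <= g z) -> EX f <= EX g.
Proof. by move=> fi gi fg; exact: (le_Rintegral measurableT fi gi). Qed.

Lemma eq_integ f g : f =1 g -> integ f -> integ g.
Proof. by move=> /funext ->. Qed.

Lemma eq_EX f g : f =1 g -> EX f = EX g.
Proof. by move=> fg; congr EX; apply/funext. Qed.

Lemma EX_ge_atom f z : integ f -> (forall z, 0 <= f z) ->
  f z * fine (distribution P X [set z]) <= EX f.
Proof.
move=> fi f0; rewrite -lee_fin EX_fin// EFinM fineK; last first.
  exact: fin_num_measure.
exact: (@integral_law_ge_atom _ _ _ P X (fun z => (f z)%:E)).
Qed.

Lemma EX_eq0 f : (forall z, 0 <= f z) ->
  (forall z, (0 < distribution P X [set z])%E -> f z = 0) -> EX f = 0.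
Proof.
move=> f0 fp; rewrite /EX /Rintegral.
rewrite (@ge0_integral_lawT _ _ _ P X (fun z => (f z)%:E)) ?esum1// => z _.
have := measure_ge0 (distribution P X) [set z].
rewrite le_eqVlt => /orP[/eqP <-|/fp ->]; first by rewrite mule0.
by rewrite mul0e.
Qed.

End exponential_tilting.

(** * Functions of at most quartic growth *)

Section quartic_growth.
Context {R : realType}.
Implicit Types f g : int -> R.

(** Degree four is what the test functions demand: their one-step errors are fourth powers of the
    increment. *)
Definition quartic f : Prop :=
  exists C : R, forall z : int, `|f z| <= C * (1 + z%:~R ^+ 4).

Lemma quartic_le f g : quartic g -> (forall z, `|f z| <= g z) -> quartic f.
Proof.
move=> [C gC] fg; exists C => z; apply: le_trans (gC z).
exact: le_trans (fg z) (ler_norm _).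
Qed.

Lemma quarticD f g : quartic f -> quartic g -> quartic (fun z => f z + g z).
Proof.
move=> [C fC] [D gD]; exists (C + D) => z; rewrite mulrDl.
by rewrite (le_trans (ler_normD _ _))// lerD.
Qed.

Lemma quarticZ c f : quartic f -> quartic (fun z => c * f z).
Proof.
move=> [C fC]; exists (`|c| * C) => z.
by rewrite normrM -mulrA ler_wpM2l.
Qed.

Lemma quartic_bounded f (C : R) : (forall z, `|f z| <= C) -> quartic f.
Proof.
move=> fC; exists C => z; have := fC z; have := normr_ge0 (f z).
by have := exprn_even_ge0 (z%:~R : R) (isT : ~~ odd 4); nra.
Qed.

Lemma normr_subX_le (c x : R) k : (k <= 4)%N ->
  `|(x - c) ^+ k| <= (1 + 8 * (1 + c ^+ 4)) * (1 + x ^+ 4).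
Proof.
move=> k4; rewrite normrX.
have H1 : `|x - c| ^+ k <= 1 + (x - c) ^+ 4.
  have <- : `|x - c| ^+ 4 = (x - c) ^+ 4.
    by rewrite -normrX ger0_norm// exprn_even_ge0.
  have [le1|/ltW ge1] := leP `|x - c| 1.
    by rewrite ler_wpDr ?exprn_ge0// exprn_ile1.
  by rewrite ler_wpDl// ler_weXn2l.
apply: (le_trans H1).
have H2 : (x - c) ^+ 4 <= 8 * (x ^+ 4 + c ^+ 4).
  rewrite -subr_ge0.
  have -> : 8 * (x ^+ 4 + c ^+ 4) - (x - c) ^+ 4 =
    6 * ((x - c) * (x + c)) ^+ 2 + ((x + c) ^+ 2) ^+ 2 by ring.
  by rewrite addr_ge0 ?sqr_ge0// mulr_ge0 ?sqr_ge0.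
have := exprn_even_ge0 x (isT : ~~ odd 4).
have := exprn_even_ge0 c (isT : ~~ odd 4).
nra.
Qed.

Lemma quartic_pow (c : R) k : (k <= 4)%N ->
  quartic (fun z => (z%:~R - c) ^+ k).
Proof.
by move=> k4; exists (1 + 8 * (1 + c ^+ 4)) => z; exact: normr_subX_le.
Qed.

End quartic_growth.

(** * One-step inequalities for the two test functions *)

Section test_functions.
Context {R : realType}.
Implicit Types u x v : R.

(** A parabola rising from 6 to 9 on [0, 1], then constant; its slope drops from 2 to 0 at 1, so it
    is concave on the half-line. The value at 0 has to be positive: if it were 0, an upward step
    from the curve would already violate the supersolution inequality. *)
Definition barrier v : R := if 0 <= v then 10 - (2 - Num.min v 1) ^+ 2 else 0.

Lemma barrier_ge6 v : 0 <= v -> 6 <= barrier v.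
Proof.
move=> v0; rewrite /barrier v0; case: (leP v 1) => v1; nra.
Qed.

Lemma barrier_ge0 v : 0 <= barrier v.
Proof.
have [v0|v0] := boolP (0 <= v); first by apply: le_trans (barrier_ge6 v0).
by rewrite /barrier (negbTE v0).
Qed.

Lemma barrier_le9 v : barrier v <= 9.
Proof.
rewrite /barrier; case: ifP => // v0; case: (leP v 1) => v1; nra.
Qed.

Lemma barrier_eq9 v : 1 <= v -> barrier v = 9.
Proof.
by move=> v1; rewrite /barrier (le_trans ler01 v1) (min_idPr v1); ring.
Qed.

(** Without [x ^+ 4] the right-hand side is the parabola itself, continued to all arguments. The
    quartic term pays where this continuation falls below [barrier]: far below 0, and beyond 3,
    where [x >= 2]. *)
Lemma barrier_step u x : 0 <= u <= 1 ->
  barrier (u + x) <= barrier u + 2 * (2 - u) * x - x ^+ 2 + x ^+ 4.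
Proof.
move=> /andP[u0 u1]; rewrite [X in _ <= X + _ - _ + _]/barrier u0 (min_idPl u1).
have -> : 10 - (2 - u) ^+ 2 + 2 * (2 - u) * x - x ^+ 2 =
  10 - (2 - (u + x)) ^+ 2 by ring.
have x40 : 0 <= x ^+ 4 by exact: exprn_even_ge0.
rewrite /barrier; case: ifP => [v0|/negbT]; last first.
  rewrite -ltNge => v0; set t := - (u + x).
  have t0 : 0 <= t by rewrite /t; lra.
  have tx : t ^+ 4 <= x ^+ 4.
    have -> : x ^+ 4 = (- x) ^+ 4 by ring.
    by rewrite lerXn2r ?nnegrE// /t; lra.
  (* Needed is [0 <= 10 - (2 + t) ^+ 2 + t ^+ 4]; as [t ^+ 4 >= 2 * t ^+ 2 - 1], this is at least
     [(t - 2) ^+ 2 + 1]. *)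
  have := sqr_ge0 (t ^+ 2 - 1); have := sqr_ge0 (t - 2); nra.
case: (leP (u + x) 1) => v1; first by lra.
have [v3|v3] := leP (u + x) 3; first by nra.
have x2 : 2 <= x by lra.
have : x ^+ 2 <= x ^+ 4 by rewrite ler_weXn2l//; lra.
nra.
Qed.

Definition bump u : R := Num.max (1 - u ^+ 2) 0 ^+ 2.

Lemma bump_ge0 u : 0 <= bump u. Proof. exact: sqr_ge0. Qed.

Lemma bump_le1 u : bump u <= 1.
Proof.
rewrite /bump expr_le1// ?le_max ?lexx ?orbT// ge_max ler01 andbT.
by rewrite gerBl sqr_ge0.
Qed.

Lemma bump_eq0 u : 1 <= `|u| -> bump u = 0.
Proof.
move=> u1; rewrite /bump (max_idPr _) ?expr0n//.
by rewrite subr_le0 -(real_normK (num_real u)) expr_ge1.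
Qed.

Lemma bump0 : bump 0 = 1.
Proof. by rewrite /bump expr0n/= subr0 (max_idPl _)// expr1n. Qed.

Lemma bumpN u : bump (- u) = bump u.
Proof. by rewrite /bump sqrrN. Qed.

(* [Num.max v 0 ^+ 2 >= 2 g v - g ^+ 2] for every [g >= 0], here [g = 1 - u ^+ 2]. *)
Lemma bump_step u x : `|u| <= 1 ->
  bump u - 4 * u * (1 - u ^+ 2) * x - 2 * (1 - u ^+ 2) * x ^+ 2 <= bump (u + x).
Proof.
move=> u1; have g0 : 0 <= 1 - u ^+ 2.
  by rewrite subr_ge0 -(real_normK (num_real u)) expr_le1.
rewrite /bump (max_idPl g0); set g := 1 - u ^+ 2 in g0 *.
have hE : 1 - (u + x) ^+ 2 = g - 2 * u * x - x ^+ 2 by rewrite /g; ring.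
rewrite hE; set h := g - _ - _.
have -> : g ^+ 2 - 4 * u * g * x - 2 * g * x ^+ 2 = 2 * g * h - g ^+ 2.
  by rewrite /h; ring.
case: (leP h 0) => h0; last by have := sqr_ge0 (h - g); lra.
by rewrite expr0n/=; have := sqr_ge0 g; nra.
Qed.

(** The loss in [bump_step] is of order [1 - u ^+ 2], which near the edge is not controlled by its
    square [bump u]. The slack of the tangent inequality there is [x ^+ 2 * (2 * u + x) ^+ 2], at
    least [x ^+ 2 / 4] for a step towards the centre that does not cross it; a step crossing it is
    longer than 1/2 and is paid by [x ^+ 4]. *)
Lemma bump_step_edge u x s : `|s| = 1 -> 2^-1 <= s * u <= 1 ->
  bump u - 4 * u * (1 - u ^+ 2) * x - 2 * (1 - u ^+ 2) * x ^+ 2 +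
    4^-1 * Num.max (- s * x) 0 ^+ 2 - x ^+ 4 <= bump (u + x).
Proof.
move=> s1.
wlog -> : s u x s1 / s = 1.
  move=> H; have := s1 => /eqP; rewrite eqr_norml ler01 andbT => /orP[] /eqP sE.
    by apply: H; rewrite sE ?normr1.
  rewrite sE mulN1r => su.
  have {}su : 2^-1 <= 1 * - u <= 1 by rewrite mul1r.
  have := H 1 (- u) (- x) (normr1 _) erefl su.
  rewrite -opprD !bumpN mulN1r !opprK mul1r; apply: le_trans.
  by rewrite le_eqVlt; apply/orP; left; apply/eqP; ring.
rewrite mul1r mulN1r => /andP[u2 u1].
have u1' : `|u| <= 1 by rewrite ler_norml; apply/andP; split; lra.
have st := bump_step x u1'.
have x40 : 0 <= x ^+ 4 by exact: exprn_even_ge0.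
case: (leP (- x) 0) => x0; first by rewrite expr0n/= mulr0; lra.
have [xu|xu] := leP (- u) x; last first.
  have y4 : 4^-1 <= x ^+ 2 by nra.
  have : 0 <= x ^+ 2 * (x ^+ 2 - 4^-1) by rewrite mulr_ge0 ?sqr_ge0// subr_ge0.
  lra.
have g0 : 0 <= 1 - u ^+ 2 by nra.
have h0 : 0 <= 1 - (u + x) ^+ 2 by nra.
rewrite /bump (max_idPl g0) (max_idPl h0).
have : x ^+ 2 / 4 <= x ^+ 2 * (2 * u + x) ^+ 2.
  by rewrite ler_wpM2l ?sqr_ge0//; nra.
nra.
Qed.

End test_functions.

(** Not normalised: statements about the tilted law carry a factor [tilt_mass] instead of a
    division. *)
Definition tilt d (T : measurableType d) (R : realType) (P : probability T R)
  (X : {RV P >-> int}) (l : R) (f : int -> R) : R :=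
  EX X (fun z => expR (l * z%:~R) * f z).

(* The following three are locked so that the unifier never unfolds the
   integrals behind them when comparing two tilts. *)
HB.lock Definition tilt_mass d (T : measurableType d) (R : realType)
  (P : probability T R) (X : {RV P >-> int}) (l : R) : R := tilt X l (fun=> 1).

HB.lock Definition tilt_mean d (T : measurableType d) (R : realType)
  (P : probability T R) (X : {RV P >-> int}) (l : R) : R :=
  tilt X l (fun z => z%:~R) / tilt_mass X l.

HB.lock Definition log_mass d (T : measurableType d) (R : realType)
  (P : probability T R) (X : {RV P >-> int}) (l : R) : R := ln (tilt_mass X l).

(** * Tilted laws: estimates uniform over the window [[lo, hi]] *)

Section tilted_law.
Context d (T : measurableType d) (R : realType) (P : probability T R).
Variable X : {RV P >-> int}.
Variables lo hi eta : R.
Hypothesis eta0 : 0 < eta.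
Hypotheses (lo0 : lo <= 0) (hi0 : 0 <= hi).
Hypothesis integ_lo : integ X (fun z => expR ((lo - eta) * z%:~R)).
Hypothesis integ_hi : integ X (fun z => expR ((hi + eta) * z%:~R)).
Hypothesis mean0 : EX X (fun z => z%:~R) = 0.
Hypothesis var_neq0 : EX X (fun z => z%:~R ^+ 2) != 0.

Notation tilt := (tilt X).
Notation tilt_mass := (tilt_mass X).
Notation tilt_mean := (tilt_mean X).
Notation log_mass := (log_mass X).

Lemma le_norm_quartic (x : R) : `|x| <= 1 + x ^+ 4.
Proof.
rewrite -subr_ge0 (_ : _ - _ = (x ^+ 2 - 2^-1) ^+ 2 + (`|x| - 2^-1) ^+ 2 + 2^-1).
  by rewrite !addr_ge0 ?sqr_ge0.
by rewrite (sqrrB `|x|) real_normK ?num_real//; field.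
Qed.

Let cst_env : R := 1 + (4 / eta) ^+ 4.

(** One integrable envelope for all tilts in the window: the margin [eta] at both ends absorbs the
    polynomial factor. *)
Let env (z : int) : R :=
  cst_env * (expR ((lo - eta) * z%:~R) + expR ((hi + eta) * z%:~R)).

Let integ_env : integ X env.
Proof. exact/integZ/integD. Qed.

Let expR_env (l : R) (z : int) : lo <= l <= hi ->
  expR (l * z%:~R) * (1 + z%:~R ^+ 4) <= env z.
Proof.
move=> /andP[lol lhi]; set x : R := z%:~R.
have x4 : 1 + x ^+ 4 <= cst_env * expR (eta * `|x|).
  (* [expR (4 * y) >= (1 + y) ^+ 4 >= 1 + y ^+ 4] with [y = eta / 4 * |x|]; hence the factor
     [4 / eta] in [cst_env]. *)
  have e1 : 1 + (eta / 4) ^+ 4 * `|x| ^+ 4 <= expR (eta * `|x|).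
    have -> : eta * `|x| = 4%:R * (eta / 4 * `|x|) by field.
    rewrite expRM_natl -exprMn.
    have y0 : 0 <= eta / 4 * `|x| by rewrite mulr_ge0// divr_ge0 ?ltW.
    move: (eta / 4 * _) y0 => y y0.
    apply: (@le_trans _ _ ((1 + y) ^+ 4)); last first.
      by rewrite lerXn2r// ?nnegrE ?expR_ge0 ?expR_ge1Dx// addr_ge0.
    have -> : (1 + y) ^+ 4 = 1 + y ^+ 4 + y * (4 + 6 * y + 4 * y ^+ 2) by ring.
    by rewrite ler_wpDr// mulr_ge0// !addr_ge0// ?mulr_ge0 ?exprn_ge0.
  have -> : x ^+ 4 = `|x| ^+ 4 by rewrite -normrX ger0_norm// exprn_even_ge0.
  have e0 : 1 <= expR (eta * `|x|).
    by rewrite -expR0 ler_expR mulr_ge0// ltW.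
  have q0 : 0 <= (eta / 4) ^+ 4 * `|x| ^+ 4.
    by rewrite mulr_ge0 ?exprn_ge0// divr_ge0 ?ltW.
  have -> : `|x| ^+ 4 = (4 / eta) ^+ 4 * ((eta / 4) ^+ 4 * `|x| ^+ 4).
    by field; rewrite gt_eqF.
  have c0 : 0 <= (4 / eta) ^+ 4 by rewrite exprn_ge0// divr_ge0 ?ltW.
  have qe : (eta / 4) ^+ 4 * `|x| ^+ 4 <= expR (eta * `|x|) by lra.
  by have := ler_wpM2l c0 qe; rewrite /cst_env; lra.
have c0 : 0 <= cst_env by rewrite addr_ge0// exprn_ge0// divr_ge0 ?ltW.
apply: (le_trans (ler_wpM2l (expR_ge0 _) x4)).
rewrite mulrCA /env ler_wpM2l// -expRD.
have [x0|x0] := leP 0 x.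
  rewrite ler_wpDl ?expR_ge0// ler_expR ger0_norm//; nra.
by rewrite ler_wpDr ?expR_ge0// ler_expR ltr0_norm//; nra.
Qed.

Lemma integ_tilt l f : lo <= l <= hi -> quartic f ->
  integ X (fun z => expR (l * z%:~R) * f z).
Proof.
move=> lJ [C fC]; apply: (integ_le (g := fun z => C * env z)); last exact: integZ.
move=> z; rewrite normrM ger0_norm ?expR_ge0//.
apply: le_trans (ler_wpM2l (expR_ge0 _) (fC z)) _.
rewrite mulrCA ler_wpM2l ?expR_env//.
have := le_trans (normr_ge0 _) (fC 0); rewrite expr0n/= addr0 mulr1; exact.
Qed.

Lemma tiltZ l c f : lo <= l <= hi -> quartic f ->
  tilt l (fun z => c * f z) = c * tilt l f.
Proof.
move=> lJ fq; rewrite /tilt -EXZ; last exact: integ_tilt.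
by apply: eq_EX => z; rewrite mulrCA.
Qed.

Lemma tiltD l f g : lo <= l <= hi -> quartic f -> quartic g ->
  tilt l (fun z => f z + g z) = tilt l f + tilt l g.
Proof.
move=> lJ fq gq; rewrite /tilt -EXD; [|exact: integ_tilt..].
by apply: eq_EX => z; rewrite mulrDr.
Qed.

Lemma le_tilt l f g : lo <= l <= hi -> quartic f -> quartic g ->
  (forall z, f z <= g z) -> tilt l f <= tilt l g.
Proof.
move=> lJ fq gq fg; apply: le_EX; [exact: integ_tilt..|move=> z].
by rewrite ler_wpM2l ?expR_ge0.
Qed.

Lemma eq_tilt l f g : f =1 g -> tilt l f = tilt l g.
Proof. by move=> fg; apply: eq_EX => z; rewrite fg. Qed.

Lemma quartic_cst (c : R) : quartic (fun=> c).
Proof. exact: (quartic_bounded (C := `|c|)). Qed.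

Lemma quartic_id : quartic (fun z : int => z%:~R : R).
Proof.
have [C H] := @quartic_pow R 0 1 isT; exists C => z.
by have := H z; rewrite subr0 expr1.
Qed.

Lemma tilt_massE l : tilt_mass l = EX X (fun z => expR (l * z%:~R)).
Proof. by rewrite tilt_mass.unlock; apply: eq_EX => z; rewrite mulr1. Qed.

Lemma in0J : lo <= 0 <= hi. Proof. by rewrite lo0 hi0. Qed.

Lemma integ_quartic f : quartic f -> integ X f.
Proof.
move=> /(integ_tilt in0J); apply: eq_integ => z.
by rewrite /= mul0r expR0 mul1r.
Qed.

(** Jensen's inequality for a centred variable. *)
Lemma tilt_mass_ge1 l : lo <= l <= hi -> 1 <= tilt_mass l.
Proof.
move=> lJ; rewrite tilt_massE.
have e1 : EX X (fun z => 1 + l * z%:~R) = 1.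
  rewrite EXD; [|exact: integ_cst|exact/integZ/integ_quartic/quartic_id].
  by rewrite EX_cst EXZ ?mean0 ?mulr0 ?addr0//; exact/integ_quartic/quartic_id.
rewrite -[leLHS]e1; apply: le_EX.
- apply: integD; first exact: integ_cst.
  exact/integZ/integ_quartic/quartic_id.
- have := integ_tilt lJ (quartic_cst 1); apply: eq_integ => z.
  by rewrite /= mulr1.
- by move=> z; exact: expR_ge1Dx.
Qed.

Lemma tilt_mass_gt0 l : lo <= l <= hi -> 0 < tilt_mass l.
Proof. by move=> lJ; exact: lt_le_trans (tilt_mass_ge1 lJ). Qed.

Lemma tilt_cst l c : lo <= l <= hi -> tilt l (fun=> c) = c * tilt_mass l.
Proof.
move=> lJ; rewrite tilt_mass.unlock -tiltZ//; last exact: quartic_cst.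
by apply: eq_tilt => z; rewrite mulr1.
Qed.

Lemma quartic_center c : quartic (fun z : int => z%:~R - c : R).
Proof. exact: (@quartic_pow R c 1). Qed.

Lemma tilt_center l c : lo <= l <= hi ->
  tilt l (fun z => z%:~R - c) = (tilt_mean l - c) * tilt_mass l.
Proof.
move=> lJ; rewrite tiltD ?tilt_cst//; [|exact: quartic_id|exact: quartic_cst].
by rewrite mulrBl mulNr tilt_mean.unlock mulfVK ?gt_eqF ?tilt_mass_gt0.
Qed.

Lemma tilt_ge_atom l f z : lo <= l <= hi -> quartic f -> (forall z, 0 <= f z) ->
  expR (l * z%:~R) * f z * fine (distribution P X [set z]) <= tilt l f.
Proof.
move=> lJ fq f0; rewrite /tilt.
apply: (EX_ge_atom (f := fun z => expR (l * z%:~R) * f z)).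
  exact: integ_tilt.
by move=> y; rewrite mulr_ge0 ?expR_ge0.
Qed.

(** [B] comes from the expectation of the envelope, so it is the same for every tilt. *)
Lemma tilt_bounded : exists2 B, 1 <= B & forall l f C, lo <= l <= hi ->
  (forall z, `|f z| <= C * (1 + z%:~R ^+ 4)) -> `|tilt l f| <= C * B.
Proof.
exists (Num.max 1 (EX X env)); first by rewrite le_max lexx.
move=> l f C lJ fC.
have C0 : 0 <= C.
  have := le_trans (normr_ge0 _) (fC 0); rewrite expr0n/= addr0 mulr1; exact.
have fq : quartic f by exists C.
have H g : quartic g -> (forall z, g z <= C * (1 + z%:~R ^+ 4)) ->
    tilt l g <= C * Num.max 1 (EX X env).
  move=> gq gC; apply: (@le_trans _ _ (EX X (fun z => C * env z))).
    apply: le_EX; [exact: integ_tilt|exact: integZ|move=> z].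
    apply: le_trans (ler_wpM2l (expR_ge0 _) (gC z)) _.
    by rewrite mulrCA ler_wpM2l ?expR_env.
  by rewrite EXZ// ler_wpM2l// le_max lexx orbT.
rewrite ler_norml H//; last by move=> z; exact: le_trans (ler_norm _) (fC z).
rewrite andbT lerNl -mulN1r -tiltZ//; apply: H; first exact: quarticZ.
by move=> z; rewrite mulN1r (le_trans (ler_norm _))// normrN.
Qed.

Lemma tilt_mean_bounded : exists B, forall l, lo <= l <= hi ->
  `|tilt_mean l| <= B /\ tilt_mass l <= B.
Proof.
have [B B1 HB] := tilt_bounded; exists B => l lJ; split.
  rewrite tilt_mean.unlock normrM normfV (ger0_norm (ltW (tilt_mass_gt0 lJ))).
  rewrite ler_pdivrMr ?tilt_mass_gt0//.
  apply: (@le_trans _ _ (1 * B)).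
    apply: HB => // z; rewrite mul1r.
    exact: le_norm_quartic.
  by rewrite mul1r ler_peMr ?tilt_mass_ge1// (le_trans _ B1).
rewrite tilt_mass.unlock; apply: le_trans (ler_norm _) _.
rewrite -[leRHS]mul1r; apply: HB => // z.
by rewrite normr1 mul1r ler_wpDr// exprn_even_ge0.
Qed.

Lemma tilt_center_pow_bounded k : (k <= 4)%N -> exists2 C, 0 < C &
  forall l, lo <= l <= hi ->
  tilt l (fun z => (z%:~R - tilt_mean l) ^+ k) <= C * tilt_mass l.
Proof.
move=> k4; have [B mB] := tilt_mean_bounded; have [D D1 HD] := tilt_bounded.
have D0 : 0 < D by exact: lt_le_trans D1.
exists ((1 + 8 * (1 + B ^+ 4)) * D) => [|l lJ].
  by rewrite mulr_gt0// ltr_wpDr// mulr_ge0// addr_ge0// exprn_even_ge0.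
have mJ := tilt_mass_ge1 lJ.
apply: le_trans (ler_norm _) _.
apply: (@le_trans _ _ ((1 + 8 * (1 + B ^+ 4)) * D)); last first.
  by rewrite ler_peMr// mulr_ge0 ?(ltW D0)// addr_ge0// mulr_ge0// addr_ge0//
    exprn_even_ge0.
apply: HD => // z; apply: le_trans (normr_subX_le _ _ k4) _.
rewrite ler_wpM2r//; first by rewrite addr_ge0// exprn_even_ge0.
rewrite lerD2l ler_wpM2l// lerD2l.
rewrite -[leLHS]ger0_norm ?exprn_even_ge0// normrX lerXn2r// ?nnegrE//.
  exact: le_trans (normr_ge0 _) (mB l lJ).1.
exact: (mB l lJ).1.
Qed.

(** Jensen's inequality under the tilted law. The exponent [mu] may leave the window, because the
    supremum defining [rate] does. *)
Lemma tilt_tangent l (mu : R) : lo <= l <= hi ->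
  integ X (fun z => expR (mu * z%:~R)) ->
  expR ((mu - l) * tilt_mean l) * tilt_mass l <= EX X (fun z => expR (mu * z%:~R)).
Proof.
move=> lJ imu; set m := tilt_mean l; pose s := mu - l.
have fq : quartic (fun z : int => 1 + s * (z%:~R - m)).
  by apply: quarticD; [exact: quartic_cst|exact/quarticZ/quartic_center].
have -> : expR (s * m) * tilt_mass l =
    tilt l (fun z => expR (s * m) * (1 + s * (z%:~R - m))).
  rewrite tiltZ// tiltD//; [|exact: quartic_cst|exact/quarticZ/quartic_center].
  by rewrite tilt_cst// tiltZ ?tilt_center ?subrr ?mul0r ?mulr0 ?addr0 ?mul1r//;
    exact: quartic_center.
apply: le_EX => //; first exact/integ_tilt/quarticZ.
move=> z; rewrite mulrA -expRD.
have -> : mu * z%:~R = l * z%:~R + s * m + s * (z%:~R - m) by rewrite /s; ring.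
by rewrite [leRHS]expRD ler_wpM2l ?expR_ge0// expR_ge1Dx.
Qed.

(** The sign of [s] selects a side of the tilted mean [m]. If that side carried no mass, centring
    would empty the other side too and all mass would sit at [m]; but [X] is centred, so E((X -
    m)^2) = E(X^2) + m^2, which is not 0. *)
Lemma exists_tilt_atom l (s : R) : s != 0 -> lo <= l <= hi -> exists2 z : int,
  (0 < distribution P X [set z])%E & 0 < s * (z%:~R - tilt_mean l).
Proof.
move=> s_neq0 lJ; set m := tilt_mean l; apply: contrapT => nz.
have le_m z : (0 < distribution P X [set z])%E -> s * (z%:~R - m) <= 0.
  by move=> pz; rewrite leNgt; apply/negP => zm; apply: nz; exists z.
have cq := quarticZ s (quartic_center m).
have pq : quartic (fun z : int => Num.max (s * (z%:~R - m)) 0).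
  apply: (quartic_le (g := fun z => 1 + (s * (z%:~R - m)) ^+ 4)).
    apply: quarticD; first exact: quartic_cst.
    have [C H] := quarticZ (s ^+ 4) (@quartic_pow R m 4 isT).
    by exists C => z; rewrite exprMn.
  move=> z; rewrite ger0_norm ?le_max ?lexx ?orbT//.
  by rewrite ge_max addr_ge0 ?exprn_even_ge0// andbT
    (le_trans (ler_norm _))// le_norm_quartic.
have pos0 : tilt l (fun z => Num.max (s * (z%:~R - m)) 0) = 0.
  apply: EX_eq0 => [z|z /le_m zm].
    by rewrite mulr_ge0 ?expR_ge0// le_max lexx orbT.
  by rewrite (max_idPr _) ?mulr0.
have nq : quartic (fun z : int => -1 * (s * (z%:~R - m))) by exact: quarticZ.
pose f (z : int) := Num.max (s * (z%:~R - m)) 0 + -1 * (s * (z%:~R - m)).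
have f0 z : 0 <= f z.
  by rewrite /f; case: (leP (s * (z%:~R - m)) 0); lra.
have fq : quartic f by exact: quarticD.
have tf : tilt l f = 0.
  rewrite tiltD// tiltZ// pos0 tiltZ//; last exact: quartic_center.
  by rewrite tilt_center// subrr mul0r !mulr0 addr0.
have eq_m z : (0 < distribution P X [set z])%E -> z%:~R = m :> R.
  move=> pz; have := tilt_ge_atom z lJ fq f0; rewrite tf => fz.
  have p0 : 0 < fine (distribution P X [set z]).
    by rewrite fine_gt0// pz ltey_eq fin_num_measure.
  have fz0 : f z <= 0.
    rewrite leNgt; apply/negP => fz0.
    by have := le_lt_trans fz (mulr_gt0 (mulr_gt0 (expR_gt0 (l * z%:~R)) fz0) p0); rewrite ltxx.
  move: fz0; rewrite /f (max_idPr _) ?le_m// => h.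
  have /eqP : s * (z%:~R - m) = 0 by have := le_m _ pz; lra.
  by rewrite mulf_eq0 (negbTE s_neq0)/= subr_eq0 => /eqP.
have dev0 : EX X (fun z => (z%:~R - m) ^+ 2) = 0.
  apply: EX_eq0 => [z|z /eq_m ->]; first exact: sqr_ge0.
  by rewrite subrr expr0n.
have q2 : quartic (fun z : int => z%:~R ^+ 2 : R).
  have [C H] := @quartic_pow R 0 2 isT; exists C => z.
  by have := H z; rewrite subr0.
have : EX X (fun z => (z%:~R - m) ^+ 2) = EX X (fun z => z%:~R ^+ 2) + m ^+ 2.
  rewrite (@eq_EX _ _ _ _ _ _ (fun z => z%:~R ^+ 2 + (-2 * m * z%:~R + m ^+ 2))).
    rewrite EXD; [|exact: integ_quartic|]; last first.
      by apply: integD; [exact/integZ/integ_quartic/quartic_id|exact: integ_cst].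
    rewrite EXD; [|exact/integZ/integ_quartic/quartic_id|exact: integ_cst].
    by rewrite EXZ ?mean0 ?mulr0 ?add0r ?EX_cst//; exact/integ_quartic/quartic_id.
  by move=> z; ring.
rewrite dev0 => /esym/eqP; rewrite paddr_eq0 ?sqr_ge0//; last first.
  rewrite /EX; apply: Rintegral_ge0 => w _; exact: sqr_ge0.
by rewrite (negbTE var_neq0).
Qed.

(** With [x = z - m] and [s = mu - l], one has [x * expR (s * x) >= x + s * Num.max x 0 ^+ 2] for
    both signs of [x]; under the tilt by [l] the linear term integrates to 0. *)
Lemma tilt_mean_increment l mu : lo <= l <= hi -> lo <= mu <= hi -> l <= mu ->
  (mu - l) * expR ((mu - l) * tilt_mean l) *
    tilt l (fun z => Num.max (z%:~R - tilt_mean l) 0 ^+ 2) <=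
  (tilt_mean mu - tilt_mean l) * tilt_mass mu.
Proof.
move=> lJ muJ lmu; set m := tilt_mean l; set s := mu - l.
have s0 : 0 <= s by rewrite subr_ge0.
have cq := quartic_center m.
have pq : quartic (fun z : int => Num.max (z%:~R - m) 0 ^+ 2).
  apply: (quartic_le (g := fun z => (z%:~R - m) ^+ 2)); first exact: quartic_pow.
  move=> z; rewrite ger0_norm ?sqr_ge0//.
  by case: (leP (z%:~R - m) 0) => // _; rewrite expr0n sqr_ge0.
rewrite -tilt_center//.
have -> : s * expR (s * m) * tilt l (fun z => Num.max (z%:~R - m) 0 ^+ 2) =
    tilt l (fun z => expR (s * m) *
      ((z%:~R - m) + s * Num.max (z%:~R - m) 0 ^+ 2)).
  have zq := quarticZ s pq.
  rewrite (tiltZ _ lJ); last exact: quarticD.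
  rewrite (tiltD lJ cq zq) (tiltZ _ lJ pq) tilt_center// subrr; ring.
apply: le_EX.
- apply: integ_tilt => //; apply: quarticZ; apply: quarticD => //.
  exact: quarticZ.
- exact: integ_tilt.
move=> z; set x : R := z%:~R - m.
have -> : expR (mu * z%:~R) = expR (l * z%:~R) * expR (s * m) * expR (s * x).
  by rewrite -!expRD; congr expR; rewrite /s /x; ring.
rewrite -!mulrA !ler_wpM2l ?expR_ge0//.
have e1 := expR_ge1Dx (s * x).
case: (leP x 0) => x0.
  rewrite expr0n mulr0 addr0.
  have : expR (s * x) <= 1 by rewrite -expR0 ler_expR mulr_ge0_le0.
  by nra.
by nra.
Qed.

Lemma tilt_mean_nondecreasing l mu : lo <= l <= hi -> lo <= mu <= hi ->
  l <= mu -> tilt_mean l <= tilt_mean mu.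
Proof.
move=> lJ muJ lmu; rewrite -subr_ge0 -(pmulr_lge0 _ (tilt_mass_gt0 muJ)).
apply: le_trans (tilt_mean_increment lJ muJ lmu).
rewrite !mulr_ge0 ?expR_ge0 ?subr_ge0// /tilt /EX.
by apply: Rintegral_ge0 => w _; rewrite mulr_ge0 ?expR_ge0 ?sqr_ge0.
Qed.

Lemma quartic_side (s c : R) :
  quartic (fun z : int => Num.max (s * (z%:~R - c)) 0 ^+ 2).
Proof.
apply: (quartic_le (g := fun z => s ^+ 2 * (z%:~R - c) ^+ 2)).
  exact/quarticZ/quartic_pow.
move=> z; rewrite ger0_norm ?sqr_ge0// -exprMn.
by case: (leP (s * (z%:~R - c)) 0) => // _; rewrite expr0n sqr_ge0.
Qed.

(** A single atom at distance at least [g] from all tilted means suffices, since [expR (l * z)] is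
    bounded below over the window. *)
Lemma tilt_side_ge (s g : R) (z : int) : 0 < g ->
  (0 < distribution P X [set z])%E ->
  (forall l, lo <= l <= hi -> g <= s * (z%:~R - tilt_mean l)) ->
  exists2 v : R, 0 < v & forall l, lo <= l <= hi ->
    v * tilt_mass l <=
      tilt l (fun z => Num.max (s * (z%:~R - tilt_mean l)) 0 ^+ 2).
Proof.
move=> g0 pz gz; have [B mB] := tilt_mean_bounded.
have p0 : 0 < fine (distribution P X [set z]).
  by rewrite fine_gt0// pz ltey_eq fin_num_measure.
have B0 : 0 < B.
  by apply: lt_le_trans (mB 0 in0J).2; exact/tilt_mass_gt0/in0J.
pose e := expR (- ((hi - lo) * `|z%:~R|)).
exists (e * g ^+ 2 * fine (distribution P X [set z]) / B).
  by rewrite divr_gt0// !mulr_gt0 ?expR_gt0 ?exprn_gt0.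
move=> l lJ.
have := tilt_ge_atom z lJ (quartic_side s (tilt_mean l)) (fun z => sqr_ge0 _).
apply: le_trans; apply: (@le_trans _ _
    (e * g ^+ 2 * fine (distribution P X [set z]))).
  rewrite mulrAC ler_pdivrMr// ler_wpM2l ?(mB l lJ).2//.
  by apply: mulr_ge0; [exact/mulr_ge0/sqr_ge0/expR_ge0|exact: ltW].
rewrite ler_wpM2r ?(ltW p0)// ler_pM ?sqr_ge0//; first exact: expR_ge0.
  rewrite ler_expR; case/andP: lJ => lol lhi; set x : R := z%:~R.
  have [x0|x0] := leP 0 x.
    rewrite ger0_norm//; have := ler_wpM2r x0 lol; have := mulr_ge0 hi0 x0; lra.
  rewrite ltr0_norm//; have := ler_wnM2r (ltW x0) lhi.
  by have := mulr_le0 lo0 (ltW x0); lra.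
rewrite lerXn2r ?nnegrE ?(ltW g0)// ?le_max ?lexx ?orbT//.
by rewrite gz.
Qed.

(** The two exponentials differ by at most [(mu - l) * |z|] times their sum, which leaves tilted
    moments of [|z| * |z - m|]. *)
Lemma tilt_mean_lipschitz : exists2 C : R, 0 < C & forall l mu,
  lo <= l <= hi -> lo <= mu <= hi -> l <= mu ->
  tilt_mean mu - tilt_mean l <= C * (mu - l).
Proof.
have [B mB] := tilt_mean_bounded; have [D D1 HD] := tilt_bounded.
have B0 : 0 <= B by exact: le_trans (normr_ge0 _) (mB 0 in0J).1.
exists (2 * (2 + B) * D).
  by rewrite mulr_gt0 ?(lt_le_trans _ D1)//; lra.
move=> l mu lJ muJ lmu; set m := tilt_mean l.
have s0 : 0 <= mu - l by rewrite subr_ge0.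
rewrite -(ler_pM2r (tilt_mass_gt0 muJ)) -tilt_center//.
apply: (@le_trans _ _ (2 * (2 + B) * D * (mu - l))); last first.
  by rewrite ler_peMr ?tilt_mass_ge1// !mulr_ge0 ?(le_trans _ D1)//; lra.
pose f (z : int) : R := `|z%:~R| * `|z%:~R - m|.
have fle z : `|f z| <= (2 + B) * (1 + z%:~R ^+ 4).
  set x : R := z%:~R; rewrite /f ger0_norm ?mulr_ge0// -normrM mulrBr.
  apply: (le_trans (ler_normB _ _)); rewrite mulrDl lerD//.
    rewrite -expr2 ger0_norm ?sqr_ge0//.
    by have := sqr_ge0 (x ^+ 2 - 1); have := sqr_ge0 (x ^+ 2); nra.
  rewrite normrM mulrC ler_pM//; first exact: (mB l lJ).1.
  exact: le_norm_quartic.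
have fq : quartic f by eexists; exact: fle.
have cq := quartic_center m.
have fl nu : lo <= nu <= hi -> tilt nu f <= (2 + B) * D.
  by move=> nuJ; apply: le_trans (ler_norm _) _; exact: HD.
have -> : tilt mu (fun z => z%:~R - m) =
    tilt mu (fun z => z%:~R - m) - tilt l (fun z => z%:~R - m).
  by rewrite [X in _ - X]tilt_center// subrr mul0r subr0.
rewrite lerBlDr.
have imf nu : lo <= nu <= hi -> integ X (fun z => (mu - l) * (expR (nu * z%:~R) * f z)).
  by move=> nuJ; exact/integZ/integ_tilt.
apply: (@le_trans _ _ (EX X (fun z => (mu - l) * (expR (mu * z%:~R) * f z) +
    (mu - l) * (expR (l * z%:~R) * f z) + expR (l * z%:~R) * (z%:~R - m)))).
  apply: le_EX; first exact: integ_tilt.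
    apply: integD; last exact: integ_tilt.
    by apply: integD; exact: imf.
  move=> z; rewrite /f; set x : R := z%:~R.
  have e1 (u v : R) : u <= v -> `|expR v - expR u| <= (expR v + expR u) * (v - u).
    move=> uv; rewrite ger0_norm; last by rewrite subr_ge0 ler_expR.
    have -> : expR u = expR v * expR (u - v) by rewrite -expRD; congr expR; ring.
    have vu0 : 0 <= v - u by rewrite subr_ge0.
    have := mulr_ge0 (mulr_ge0 (expR_ge0 v) (expR_ge0 (u - v))) vu0.
    by have := ler_wpM2l (expR_ge0 v) (expR_ge1Dx (u - v)); lra.
  have key : `|expR (mu * x) - expR (l * x)| <=
      (mu - l) * `|x| * (expR (mu * x) + expR (l * x)).
    have [x0|x0] := leP 0 x.
      apply: le_trans (e1 _ _ _) _; first exact: ler_wpM2r.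
      by rewrite ger0_norm// le_eqVlt; apply/orP; left; apply/eqP; ring.
    rewrite distrC; apply: le_trans (e1 _ _ _) _; first exact: ler_wnM2r (ltW x0) _ _ lmu.
    by rewrite ltr0_norm// le_eqVlt; apply/orP; left; apply/eqP; ring.
  have := ler_norm ((expR (mu * x) - expR (l * x)) * (x - m)); rewrite normrM => h.
  by have := ler_wpM2r (normr_ge0 (x - m)) key; lra.
rewrite EXD; [|by apply: integD; exact: imf|exact: integ_tilt].
rewrite lerD2r EXD; [|exact: imf..].
rewrite !EXZ; [|exact: integ_tilt..].
have := fl mu muJ; have := fl l lJ; rewrite /tilt; nra.
Qed.

Lemma log_mgfE l : log_mgf X l = log_mass l.
Proof.
rewrite log_mass.unlock /log_mgf /mgf /mmt_gen_fun unlock tilt_massE /EX /Rintegral.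
congr (ln (fine _)); by apply: eq_integral => w _ /=; rewrite mulrC.
Qed.

Lemma integ_exp l : lo <= l <= hi -> integ X (fun z => expR (l * z%:~R)).
Proof.
move=> lJ; have := integ_tilt lJ (quartic_cst 1).
by apply: eq_integ => z; rewrite /= mulr1.
Qed.

Lemma log_mass_tangent l mu : lo <= l <= hi ->
  integ X (fun z => expR (mu * z%:~R)) ->
  log_mass l + tilt_mean l * (mu - l) <= log_mass mu.
Proof.
move=> lJ imu; have H := tilt_tangent lJ imu; have m0 := tilt_mass_gt0 lJ.
rewrite -tilt_massE in H.
have H0 : 0 < tilt_mass mu by apply: lt_le_trans H; rewrite mulr_gt0 ?expR_gt0.
rewrite log_mass.unlock addrC mulrC -(expRK (_ * _)) -lnM ?posrE ?expR_gt0//.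
by rewrite ler_ln ?posrE ?mulr_gt0 ?expR_gt0.
Qed.

Lemma log_mass0 : log_mass 0 = 0.
Proof.
rewrite log_mass.unlock tilt_massE (@eq_EX _ _ _ _ _ _ (fun=> 1)) ?EX_cst ?ln1//.
by move=> z; rewrite mul0r expR0.
Qed.

(** Means are monotone in the tilt, so an atom left of the mean at [lo] and one right of the mean at
    [hi] serve the whole window. They are the steps of the explicit paths, falling and rising
    relative to the curve. *)
Lemma exists_atoms : exists zm zp : int, exists2 g : R, 0 < g &
  [/\ (0 < distribution P X [set zm])%E, (0 < distribution P X [set zp])%E &
    forall l, lo <= l <= hi -> zm%:~R + g <= tilt_mean l <= zp%:~R - g].
Proof.
have loJ : lo <= lo <= hi by rewrite lexx (le_trans lo0).
have hiJ : lo <= hi <= hi by rewrite lexx (le_trans lo0).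
have s1 : -1 != 0 :> R by rewrite oppr_eq0 oner_neq0.
have [zm pm gm] := exists_tilt_atom s1 loJ.
have [zp pp gp] := exists_tilt_atom (oner_neq0 _) hiJ.
exists zm, zp, (Num.min (-1 * (zm%:~R - tilt_mean lo)) (1 * (zp%:~R - tilt_mean hi))).
  by rewrite lt_min gm gp.
split=> // l lJ; have /andP[lol lhi] := lJ.
have := tilt_mean_nondecreasing loJ lJ lol.
have := tilt_mean_nondecreasing lJ hiJ lhi.
set g := Num.min _ _ => h1 h2.
have g1 : g <= -1 * (zm%:~R - tilt_mean lo) by rewrite ge_min lexx.
have g2 : g <= 1 * (zp%:~R - tilt_mean hi) by rewrite ge_min lexx orbT.
by apply/andP; split; lra.
Qed.

(** Uniform ellipticity, stated on each side of the mean because the edge of the strip calls for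
    jumps in a given direction. *)
Lemma tilt_sides_ge : exists2 v : R, 0 < v & forall l, lo <= l <= hi ->
  forall s : R, `|s| = 1 ->
  v * tilt_mass l <=
    tilt l (fun z => Num.max (s * (z%:~R - tilt_mean l)) 0 ^+ 2).
Proof.
have [zm [zp [g g0 [pm pp gap]]]] := exists_atoms.
have [vm vm0 Hm] : exists2 v : R, 0 < v & forall l, lo <= l <= hi ->
    v * tilt_mass l <=
      tilt l (fun z => Num.max (-1 * (z%:~R - tilt_mean l)) 0 ^+ 2).
  by apply: (tilt_side_ge g0 pm) => l /gap; lra.
have [vp vp0 Hp] : exists2 v : R, 0 < v & forall l, lo <= l <= hi ->
    v * tilt_mass l <=
      tilt l (fun z => Num.max (1 * (z%:~R - tilt_mean l)) 0 ^+ 2).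
  by apply: (tilt_side_ge g0 pp) => l /gap; lra.
exists (Num.min vm vp); first by rewrite lt_min vm0.
move=> l lJ s /eqP; rewrite eqr_norml ler01 andbT => /orP[] /eqP ->.
  apply: le_trans (Hp l lJ); rewrite ler_wpM2r ?(ltW (tilt_mass_gt0 lJ))//.
  by rewrite ge_min lexx orbT.
apply: le_trans (Hm l lJ); rewrite ler_wpM2r ?(ltW (tilt_mass_gt0 lJ))//.
by rewrite ge_min lexx.
Qed.

(** Together with [tilt_mean_lipschitz] it transfers the order 1/n from differences of slopes to
    differences of tilts. *)
Lemma tilt_mean_increasing : exists2 c : R, 0 < c & forall l mu,
  lo <= l <= hi -> lo <= mu <= hi -> l <= mu ->
  c * (mu - l) <= tilt_mean mu - tilt_mean l.
Proof.
have [v v0 Hv] := tilt_sides_ge; have [B mB] := tilt_mean_bounded.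
have B0 : 0 < B by apply: lt_le_trans (mB 0 in0J).2; exact/tilt_mass_gt0/in0J.
exists (expR (- ((hi - lo) * B)) * v / B).
  by rewrite !mulr_gt0 ?expR_gt0 ?invr_gt0.
move=> l mu lJ muJ lmu.
have s0 : 0 <= mu - l by rewrite subr_ge0.
have Hl := Hv l lJ 1 (normr1 _).
have inc := tilt_mean_increment lJ muJ lmu.
set m := tilt_mean l in inc Hl *; set D := tilt_mean mu - m in inc *.
have D0 : 0 <= D by rewrite subr_ge0 tilt_mean_nondecreasing.
have eqt : tilt l (fun z => Num.max (1 * (z%:~R - m)) 0 ^+ 2) =
    tilt l (fun z => Num.max (z%:~R - m) 0 ^+ 2).
  by apply: eq_tilt => z; rewrite mul1r.
rewrite eqt in Hl; rewrite mulrAC ler_pdivrMr//.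
apply: (@le_trans _ _ (D * tilt_mass mu)); last first.
  by rewrite ler_wpM2l//; exact: (mB mu muJ).2.
have v1 : v <= tilt l (fun z => Num.max (z%:~R - m) 0 ^+ 2).
  by apply: le_trans Hl; rewrite ler_peMr ?(ltW v0)// tilt_mass_ge1.
apply: le_trans inc; rewrite mulrC -[leRHS]mulrA ler_wpM2l//.
rewrite ler_pM ?expR_ge0 ?(ltW v0)// ler_expR.
have mlB : `|m| <= B := (mB l lJ).1.
have : `|m| >= - m by rewrite -normrN ler_norm.
by case/andP: lJ => ? ?; case/andP: muJ => ? ?; nra.
Qed.

(* The graph is squeezed between its tangents at [l] and at [l + h], so that no
   differentiation under the expectation is needed. *)
Lemma derive1_log_mgf l : lo < l < hi -> derive1 (log_mgf X) l = tilt_mean l.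
Proof.
move=> /andP[lol lhi]; have lJ : lo <= l <= hi by rewrite !ltW.
have [C C0 HC] := tilt_mean_lipschitz.
have H h : lo <= h + l <= hi ->
    `|log_mass (h + l) - log_mass l - tilt_mean l * h| <= C * h ^+ 2.
  move=> hJ; have := log_mass_tangent lJ (integ_exp hJ).
  have := log_mass_tangent hJ (integ_exp lJ).
  rewrite (_ : h + l - l = h); last by ring.
  rewrite (_ : l - (h + l) = - h); last by ring.
  move=> h1 h2; rewrite ger0_norm; last by lra.
  suff : (tilt_mean (h + l) - tilt_mean l) * h <= C * h ^+ 2 by lra.
  have [h0|h0] := leP 0 h.
    rewrite expr2 mulrA ler_wpM2r//.
    apply: le_trans (HC _ _ lJ hJ _) _; first by lra.
    by rewrite le_eqVlt; apply/orP; left; apply/eqP; ring.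
  have : tilt_mean l - tilt_mean (h + l) <= C * (l - (h + l)).
    by apply: HC => //; lra.
  rewrite (_ : l - (h + l) = - h); last by ring.
  by move=> h3; have := ler_wnM2r (ltW h0) h3; lra.
rewrite (_ : log_mgf X = log_mass); last by apply/funext => ?; exact: log_mgfE.
rewrite /derive1; apply: cvg_lim => //; apply/cvgrPdist_le => e e0.
near=> h.
have h_neq0 : h != 0 by near: h; exact: nbhs_dnbhs_neq.
have hsmall : `|h| < Num.min (Num.min (l - lo) (hi - l)) (e / C).
  near: h; apply: dnbhs0_lt.
  by rewrite !lt_min !subr_gt0 lol lhi divr_gt0.
move: hsmall; rewrite !lt_min => /andP[/andP[h1 h2] h3].
have hJ : lo <= h + l <= hi.
  move: h1 h2; rewrite !ltr_norml => /andP[? ?] /andP[? ?].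
  by apply/andP; split; lra.
have := H h hJ; rewrite /GRing.scale/=.
have -> : tilt_mean l - h^-1 * (log_mass (h + l) - log_mass l) =
    - (h^-1 * (log_mass (h + l) - log_mass l - tilt_mean l * h)).
  by field.
rewrite normrN normrM normfV => Hh.
rewrite mulrC ler_pdivrMr ?normr_gt0//.
apply: le_trans Hh _; rewrite -(real_normK (num_real h)) expr2 mulrA.
rewrite ler_wpM2r//; move: h3; rewrite ltr_pdivlMr// => h3.
by rewrite mulrC ltW.
Unshelve. all: by end_near.
Qed.

(** The Legendre transform of [log_mass] at [tilt_mean l], parametrised by its maximiser. *)
Definition tilt_rate l := l * tilt_mean l - log_mass l.

Lemma tilt_rate_ge0 l : lo <= l <= hi -> 0 <= tilt_rate l.
Proof.
move=> lJ; have := log_mass_tangent lJ (integ_exp in0J).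
by rewrite log_mass0 /tilt_rate; lra.
Qed.

(** [l] is a subgradient of the rate function at [tilt_mean l]; this is the tangent of [log_mass] at
    [mu], evaluated at [l]. *)
Lemma tilt_rate_sub l mu : lo <= l <= hi -> lo <= mu <= hi ->
  tilt_rate l - tilt_rate mu <= l * (tilt_mean l - tilt_mean mu).
Proof.
move=> lJ muJ; have := log_mass_tangent muJ (integ_exp lJ).
by rewrite /tilt_rate; lra.
Qed.

Lemma rate_tilt_mean l : lo <= l <= hi ->
  (a_star X < l%:E < b_star X)%E ->
  (forall mu : R, (a_star X < mu%:E < b_star X)%E ->
     integ X (fun z => expR (mu * z%:~R))) ->
  rate X (tilt_mean l) = (tilt_rate l)%:E.
Proof.
move=> lJ lab iab; apply/eqP; rewrite eq_le; apply/andP; split.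
  apply: ge_ereal_sup => _ [mu /= /iab imu <-]; rewrite lee_fin log_mgfE.
  by have := log_mass_tangent lJ imu; rewrite /tilt_rate; lra.
by apply: ereal_sup_ubound; exists l => //; rewrite log_mgfE.
Qed.

(** Integrates the bounds of [barrier_step], [bump_step] and [bump_step_edge]; the linear term drops
    out because it is centred. *)
Lemma tilt_comb l s c0 c1 c2 c3 c4 : lo <= l <= hi ->
  quartic (fun z : int => c0 + c1 * (z%:~R - tilt_mean l) +
    c2 * (z%:~R - tilt_mean l) ^+ 2 +
    c3 * Num.max (s * (z%:~R - tilt_mean l)) 0 ^+ 2 +
    c4 * (z%:~R - tilt_mean l) ^+ 4) /\
  tilt l (fun z => c0 + c1 * (z%:~R - tilt_mean l) +
    c2 * (z%:~R - tilt_mean l) ^+ 2 +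
    c3 * Num.max (s * (z%:~R - tilt_mean l)) 0 ^+ 2 +
    c4 * (z%:~R - tilt_mean l) ^+ 4) =
  c0 * tilt_mass l + c2 * tilt l (fun z => (z%:~R - tilt_mean l) ^+ 2) +
  c3 * tilt l (fun z => Num.max (s * (z%:~R - tilt_mean l)) 0 ^+ 2) +
  c4 * tilt l (fun z => (z%:~R - tilt_mean l) ^+ 4).
Proof.
move=> lJ; set m := tilt_mean l.
have q0 := quartic_cst c0.
have q1 := quarticZ c1 (quartic_center m).
have q2 := quarticZ c2 (@quartic_pow R m 2 isT).
have q3 := quarticZ c3 (quartic_side s m).
have q4 := quarticZ c4 (@quartic_pow R m 4 isT).
have q01 := quarticD q0 q1; have q012 := quarticD q01 q2.
have q0123 := quarticD q012 q3.
split; first exact: quarticD.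
rewrite (tiltD lJ q0123 q4) (tiltD lJ q012 q3) (tiltD lJ q01 q2) (tiltD lJ q0 q1).
rewrite tilt_cst// !tiltZ//; [|exact: quartic_pow|exact: quartic_side
  |exact: quartic_pow|exact: quartic_center].
by rewrite tilt_center// subrr mul0r mulr0 addr0.
Qed.

Lemma quartic_barrier (g : int -> R) : quartic (fun z => barrier (g z)).
Proof.
apply: (quartic_bounded (C := 9)) => z.
by rewrite ger0_norm ?barrier_ge0 ?barrier_le9.
Qed.

Lemma quartic_bump (g : int -> R) : quartic (fun z => bump (g z)).
Proof.
apply: (quartic_bounded (C := 1)) => z.
by rewrite ger0_norm ?bump_ge0 ?bump_le1.
Qed.

Lemma tilt_barrier_le9 l (g : int -> R) : lo <= l <= hi ->
  tilt l (fun z => barrier (g z)) <= 9 * tilt_mass l.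
Proof.
move=> lJ; rewrite -tilt_cst//; apply: le_tilt => //.
- exact: quartic_barrier.
- exact: quartic_cst.
- by move=> z; exact: barrier_le9.
Qed.

(** The concavity gains at least [v / N ^+ 2], and for large [N] the quartic error [K / N ^+ 4]
    takes at most half of it. Dividing the remaining [v / 2] by the maximum 9 of [barrier] gives
    [v / 18]. *)
Lemma tilt_barrier_le : exists2 q : R, 0 < q & exists2 N0 : R, 0 < N0 &
  forall l N y, lo <= l <= hi -> N0 <= N -> 0 <= y <= N ->
  tilt l (fun z => barrier ((y + (z%:~R - tilt_mean l)) / N)) <=
  (1 - q / N ^+ 2) * barrier (y / N) * tilt_mass l.
Proof.
have [v v0 Hv] := tilt_sides_ge.
have [K K0 HK] := tilt_center_pow_bounded (isT : (4 <= 4)%N).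
exists (v / 18); first by rewrite divr_gt0.
exists (1 + 2 * K / v); first by rewrite addr_gt0// divr_gt0// mulr_gt0.
move=> l N y lJ NN /andP[y0 yN].
have Kv : 0 < 2 * K / v by rewrite divr_gt0// mulr_gt0.
have N1 : 1 <= N by lra.
have N0 : 0 < N by lra.
set m := tilt_mean l; set u := y / N; set A := tilt_mass l.
have A0 : 0 < A by exact: tilt_mass_gt0.
have u01 : 0 <= u <= 1 by rewrite /u divr_ge0 ?(ltW N0)//= ler_pdivrMr// mul1r.
pose r := N^-1; have r0 : 0 < r by rewrite invr_gt0.
have [cq cE] := tilt_comb 1 (barrier u) (2 * (2 - u) * r) (- r ^+ 2) 0 (r ^+ 4) lJ.
have Hm : tilt l (fun z => barrier ((y + (z%:~R - m)) / N)) <=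
    barrier u * A + - r ^+ 2 * tilt l (fun z => (z%:~R - m) ^+ 2) +
      0 * tilt l (fun z => Num.max (1 * (z%:~R - m)) 0 ^+ 2) +
      r ^+ 4 * tilt l (fun z => (z%:~R - m) ^+ 4).
  rewrite -cE.
  apply: le_tilt => //; first exact: quartic_barrier.
  move=> z; rewrite mulrDl -/u -/r -/m; set x := z%:~R - m.
  have := barrier_step (x * r) u01; rewrite !exprMn; lra.
have T2 : v * A <= tilt l (fun z => (z%:~R - m) ^+ 2).
  apply: le_trans (Hv l lJ 1 (normr1 _)) _; apply: le_tilt => //.
  - exact: quartic_side.
  - exact: quartic_pow.
  - move=> z; rewrite mul1r.
    by case: (leP (z%:~R - m) 0) => // _; rewrite expr0n sqr_ge0.
have T4 : tilt l (fun z => (z%:~R - m) ^+ 4) <= K * A by exact: HK.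
apply: (le_trans Hm).
have rE : N ^- 2 = r ^+ 2 by rewrite exprVn.
rewrite rE; set p := r ^+ 2 in rE *.
have p0 : 0 < p by rewrite exprn_gt0.
have -> : r ^+ 4 = p ^+ 2 by rewrite /p -exprM.
have pK : p * K <= v / 2.
  rewrite /p /r exprVn mulrC ler_pdivrMr ?exprn_gt0// -ler_pdivrMl ?divr_gt0//.
  have -> : (v / 2)^-1 * K = 2 * K / v by field; rewrite gt_eqF.
  by apply: (@le_trans _ _ N); [lra|rewrite expr2 ler_peMr// ltW].
have b9 := barrier_le9 u.
have h1 := ler_wpM2l (ltW p0) T2.
have h2 := ler_wpM2l (sqr_ge0 p) T4.
have h3 : p ^+ 2 * (K * A) <= p * (v / 2) * A.
  by rewrite expr2 mulrA -[p * p * K]mulrA ler_wpM2r ?(ltW A0)// ler_wpM2l ?(ltW p0).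
have h4 : v / 18 * p * barrier u * A <= v / 18 * p * 9 * A.
  by rewrite ler_wpM2r ?(ltW A0)// ler_wpM2l// mulr_ge0 ?(ltW p0)// divr_ge0// ltW.
lra.
Qed.

(** Let [g = 1 - u ^+ 2]. Away from the edge the loss [2 * K2 * g / w ^+ 2] is at most
    [2 * K2 / g1 / w ^+ 2] times [bump u = g ^+ 2]. Near the edge the inward jumps outweigh it
    altogether. *)
Lemma tilt_bump_ge : exists2 C : R, 0 < C & exists2 w0 : R, 0 < w0 &
  forall l w y, lo <= l <= hi -> w0 <= w ->
  (1 - C / w ^+ 2) * bump (y / w) * tilt_mass l <=
  tilt l (fun z => bump ((y + (z%:~R - tilt_mean l)) / w)).
Proof.
have [v v0 Hv] := tilt_sides_ge.
have [K4 K40 HK4] := tilt_center_pow_bounded (isT : (4 <= 4)%N).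
have [K2 K20 HK2] := tilt_center_pow_bounded (isT : (2 <= 4)%N).
(* [g < 3 / 4] forces [|u| >= 1/2]; [g < v / (16 * K2)] makes the loss [2 * g * K2] at most [v / 8].
   With the quartic error, also at most [v / 8], it stays within the gain [v / 4]. *)
pose g1 := Num.min (3 / 4) (v / (16 * K2)).
have g10 : 0 < g1 by rewrite lt_min divr_gt0//= divr_gt0// mulr_gt0.
have C0 : 0 < 2 * K2 / g1 by rewrite divr_gt0// mulr_gt0.
exists (2 * K2 / g1) => //.
exists (1 + 8 * K4 / v + 2 * K2 / g1).
  by rewrite !addr_gt0// divr_gt0// mulr_gt0.
move=> l w y lJ ww.
have Kv : 0 < 8 * K4 / v by rewrite divr_gt0// mulr_gt0.
have w1 : 1 <= w by lra.
have w0 : 0 < w by lra.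
set m := tilt_mean l; set u := y / w; set A := tilt_mass l.
have A0 : 0 < A by exact: tilt_mass_gt0.
have t0 : 0 <= tilt l (fun z => bump ((y + (z%:~R - m)) / w)).
  have := tilt_cst 0 lJ; rewrite mul0r => <-; apply: le_tilt => //.
  - exact: quartic_cst.
  - exact: quartic_bump.
  - by move=> z; exact: bump_ge0.
have [u1|u1] := leP 1 `|u|; first by rewrite bump_eq0// mulr0 mul0r.
pose r := w^-1; have r0 : 0 < r by rewrite invr_gt0.
have rE : w ^- 2 = r ^+ 2 by rewrite exprVn.
rewrite rE; set p := r ^+ 2 in rE *.
have p0 : 0 < p by rewrite exprn_gt0.
have r4E : r ^+ 4 = p ^+ 2 by rewrite /p -exprM.
set g := 1 - u ^+ 2.
have g0 : 0 < g.
  by rewrite subr_gt0 -(real_normK (num_real u)) expr_lt1.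
have bu : bump u = g ^+ 2 by rewrite /bump (max_idPl (ltW g0)).
have T2 : tilt l (fun z => (z%:~R - m) ^+ 2) <= K2 * A by exact: HK2.
have T4 : tilt l (fun z => (z%:~R - m) ^+ 4) <= K4 * A by exact: HK4.
have shift z : (y + (z%:~R - m)) / w = u + (z%:~R - m) * r by rewrite mulrDl.
have h2 := ler_wpM2l (mulr_ge0 (ltW g0) (ltW p0)) T2.
have [gg|gg] := leP g1 g.
  have [cq cE] := tilt_comb 1 (bump u) (- (4 * u * g) * r) (- (2 * g) * p) 0 0 lJ.
  apply: (@le_trans _ _ (bump u * A + - (2 * g) * p * tilt l (fun z => (z%:~R - m) ^+ 2) +
      0 * tilt l (fun z => Num.max (1 * (z%:~R - m)) 0 ^+ 2) +
      0 * tilt l (fun z => (z%:~R - m) ^+ 4))).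
    have h3 : 2 * K2 * g * p * A <= 2 * K2 / g1 * p * bump u * A.
      have -> : 2 * K2 * g * p * A = 2 * K2 * p * A * g by ring.
      have -> : 2 * K2 / g1 * p * bump u * A = 2 * K2 * p * A * (bump u / g1) by ring.
      rewrite ler_wpM2l//; first by rewrite !mulr_ge0 ?ltW.
      by rewrite bu ler_pdivlMr// expr2 ler_wpM2l// ltW.
    by rewrite mulrBl mul1r mulrBl; lra.
  rewrite -cE.
  apply: le_tilt => //; first exact: quartic_bump.
  move=> z; rewrite shift -/m; set x := z%:~R - m.
  have := bump_step (x * r) (ltW u1); rewrite -/g !mul0r.
  have -> : (x * r) ^+ 2 = x ^+ 2 * p by exact: exprMn.
  by lra.
have u2 : 2^-1 <= `|u|.
  rewrite leNgt; apply/negP => u2.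
  have : g < 3 / 4 by apply: lt_le_trans gg _; rewrite ge_min lexx.
  rewrite /g -(real_normK (num_real u)).
  have := normr_ge0 u; nra.
pose s : R := Num.sg u.
have u_neq0 : u != 0 by rewrite -normr_gt0; lra.
have s1 : `|s| = 1 by rewrite normr_sg u_neq0.
have su : 2^-1 <= s * u <= 1 by rewrite -normrEsg u2 ltW.
have [cq cE] := tilt_comb (- s) (bump u) (- (4 * u * g) * r) (- (2 * g) * p)
  (4^-1 * p) (- r ^+ 4) lJ.
have Ts : v * A <= tilt l (fun z => Num.max (- s * (z%:~R - m)) 0 ^+ 2).
  by apply: Hv => //; rewrite normrN.
apply: (@le_trans _ _ (bump u * A + - (2 * g) * p * tilt l (fun z => (z%:~R - m) ^+ 2) +
    4^-1 * p * tilt l (fun z => Num.max (- s * (z%:~R - m)) 0 ^+ 2) +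
    - r ^+ 4 * tilt l (fun z => (z%:~R - m) ^+ 4))).
  rewrite r4E.
  have h4 := ler_wpM2l (ltW p0) Ts.
  have h5 := ler_wpM2l (sqr_ge0 p) T4.
  have h6 : g * K2 <= v / 16.
    rewrite -ler_pdivlMr//; apply: (le_trans (ltW gg)).
    by rewrite ge_min; apply/orP; right; rewrite invfM mulrA.
  have h7 : g * p * (K2 * A) <= v / 16 * p * A.
    have -> : g * p * (K2 * A) = g * K2 * (p * A) by ring.
    by rewrite -[leRHS]mulrA ler_wpM2r// mulr_ge0 ?ltW.
  have h8 : p * K4 <= v / 8.
    rewrite /p /r exprVn mulrC ler_pdivrMr ?exprn_gt0// -ler_pdivrMl ?divr_gt0//.
    have -> : (v / 8)^-1 * K4 = 8 * K4 / v by field; rewrite gt_eqF.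
    by apply: (@le_trans _ _ w); [lra|rewrite expr2 ler_peMr// ltW].
  have h9 : p ^+ 2 * (K4 * A) <= v / 8 * p * A.
    have -> : p ^+ 2 * (K4 * A) = p * K4 * (p * A) by ring.
    by rewrite -[leRHS]mulrA ler_wpM2r// mulr_ge0 ?ltW.
  have h10 : 0 <= 2 * K2 / g1 * p * bump u * A.
    apply: mulr_ge0 _ (ltW A0); apply: mulr_ge0 _ (bump_ge0 _).
    by apply: mulr_ge0; exact: ltW.
  by rewrite mulrBl mul1r mulrBl; lra.
rewrite -cE.
apply: le_tilt => //; first exact: quartic_bump.
move=> z; rewrite shift -/m; set x := z%:~R - m.
have := bump_step_edge (x * r) s1 su.
have -> : Num.max (- s * (x * r)) 0 ^+ 2 = p * Num.max (- s * x) 0 ^+ 2.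
  by rewrite mulrA -{1}(mul0r r) -maxr_pMl ?(ltW r0)// exprMn mulrC.
have -> : (x * r) ^+ 2 = x ^+ 2 * p by exact: exprMn.
have -> : (x * r) ^+ 4 = x ^+ 4 * r ^+ 4 by exact: exprMn.
by rewrite -/g; lra.
Qed.

End tilted_law.

(** * Relative derivatives on [0, 1] and the mean value theorem *)

Section calculus_relative_to_a_set.
Context {R : realType}.
Implicit Types (A : set R) (f : R -> R).

Lemma derivable_in_eps A f (x e : R) : derivable_in A f x -> 0 < e ->
  exists2 r : R, 0 < r & forall y, A y -> y != x -> `|y - x| < r ->
    `|(f y - f x) / (y - x) - derive_in A f x| <= e.
Proof.
move=> df e0.
have /cvgrPdist_le/(_ e e0) : (fun y => (f y - f x) / (y - x)) @ within A x^' -->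
  derive_in A f x by exact: df.
rewrite near_withinE => /nbhs_ballP[r /= r0 Hr]; exists r => // y Ay yx yr.
rewrite distrC; apply: Hr => //.
by rewrite /ball/= distrC.
Qed.

Lemma derivable_in_lipschitz A f (x : R) : derivable_in A f x ->
  exists2 r : R, 0 < r & forall y, A y -> `|y - x| < r ->
    `|f y - f x| <= (`|derive_in A f x| + 1) * `|y - x|.
Proof.
move=> df; have [r r0 Hr] := derivable_in_eps df ltr01.
exists r => // y Ay yr; have [->|yx] := eqVneq y x.
  by rewrite !subrr normr0 mulr0.
have := Hr y Ay yx yr => H.
have yx0 : 0 < `|y - x| by rewrite normr_gt0 subr_eq0.
rewrite -ler_pdivrMr// -normfV -normrM.
by have := ler_normD ((f y - f x) / (y - x) - derive_in A f x) (derive_in A f x);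
  rewrite subrK; lra.
Qed.

Lemma locally_lipschitz_continuous A f :
  (forall x, A x -> exists2 r : R, 0 < r & exists2 L : R, 0 < L &
     forall y, A y -> `|y - x| < r -> `|f y - f x| <= L * `|y - x|) ->
  {within A, continuous f}.
Proof.
move=> lf; apply/subspace_continuousP => x Ax.
have [r r0 [L L0 Hr]] := lf x Ax.
apply/cvgrPdist_lt => e e0; rewrite near_withinE; apply/nbhs_ballP.
exists (Num.min r (e / L)) => /=; first by rewrite lt_min r0 divr_gt0.
move=> y; rewrite /ball/= lt_min distrC => /andP[yr ye] Ay.
rewrite distrC; apply: le_lt_trans (Hr y Ay yr) _.
by rewrite mulrC -ltr_pdivlMr.
Qed.

Lemma derivable_in_continuous A f : (forall x, A x -> derivable_in A f x) ->
  {within A, continuous f}.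
Proof.
move=> df; apply: locally_lipschitz_continuous => x Ax.
have [r r0 Hr] := derivable_in_lipschitz (df x Ax).
by exists r => //; exists (`|derive_in A f x| + 1) => //; rewrite ltr_wpDl.
Qed.

Lemma is_derive_in A f (x r : R) : 0 < r -> (forall y, `|y - x| < r -> A y) ->
  derivable_in A f x -> is_derive x 1 f (derive_in A f x).
Proof.
move=> r0 rA df; set L := derive_in A f x.
have H : (fun h => h^-1 *: (f (h *: 1 + x) - f x)) @ (0 : R)^' --> L.
  apply/cvgrPdist_le => e e0.
  have [q q0 Hq] := derivable_in_eps df e0.
  near=> h.
  have h0 : h != 0 by near: h; exact: nbhs_dnbhs_neq.
  have : `|h| < Num.min q r by near: h; apply: dnbhs0_lt; rewrite lt_min q0.
  rewrite lt_min => /andP[hq hr].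
  have hE : h *: 1 + x - x = h by rewrite addrK /GRing.scale/= mulr1.
  have := Hq (h *: 1 + x); rewrite hE distrC mulrC; apply => //.
    by apply: rA; rewrite hE.
  by rewrite -subr_eq0 hE.
split; first by apply/cvg_ex; exists L.
by apply: cvg_lim.
Unshelve. all: by end_near.
Qed.

Lemma in01P (x : R) : `[0, 1]%classic x <-> 0 <= x <= 1.
Proof. by rewrite /= in_itv. Qed.

Lemma is_derive_in01 f (x : R) : 0 < x < 1 -> derivable_in `[0, 1] f x ->
  is_derive x 1 f (derive_in `[0, 1] f x).
Proof.
move=> /andP[x0 x1]; apply: (@is_derive_in _ _ _ (Num.min x (1 - x))).
  by rewrite lt_min x0 subr_gt0.
move=> y; rewrite lt_min !ltr_norml => /andP[/andP[? ?] /andP[? ?]].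
by apply/in01P; apply/andP; split; lra.
Qed.

Lemma MVT_in01 f (s t : R) : 0 <= s -> s < t -> t <= 1 ->
  (forall x, `[0, 1]%classic x -> derivable_in `[0, 1] f x) ->
  exists2 c, s < c < t & f t - f s = derive_in `[0, 1] f c * (t - s).
Proof.
move=> s0 st t1 df.
have [||c] := @MVT R f (derive_in `[0, 1] f) s t st.
- move=> x; rewrite in_itv/= => /andP[sx xt]; apply: is_derive_in01.
    by apply/andP; split; lra.
  by apply: df; apply/in01P; apply/andP; split; lra.
- apply: continuous_subspaceW (derivable_in_continuous df).
  by move=> x /=; rewrite !in_itv/= => /andP[? ?]; apply/andP; split; lra.
by rewrite in_itv/=; exists c.
Qed.

End calculus_relative_to_a_set.

(** * Slopes and second differences of the profile *)

Section strictly_concave_profile.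
Context {R : realType} (h : R -> R).
Hypothesis h_C2 : C2_on `[0, 1] h.
Hypothesis h2_lt0 : forall x : R, x \in `[0, 1] ->
  derive_in `[0, 1] (derive_in `[0, 1] h) x < 0.
Notation slope := (derive_in `[0, 1] h).

(** [c] and [C] are the minimum and the maximum of [- h''], attained by continuity on a compact
    interval. *)
Lemma slope_decreasing : exists c C : R, [/\ 0 < c, 0 < C &
  forall s t, 0 <= s -> s <= t -> t <= 1 ->
    c * (t - s) <= slope s - slope t <= C * (t - s)].
Proof.
case: h_C2 => dh ddh cddh.
have [x1 x1in Hx1] := EVT_max ler01 cddh.
have [x2 x2in Hx2] := EVT_min ler01 cddh.
set D := derive_in `[0, 1] slope in cddh Hx1 Hx2.
exists (- D x1), (- D x2).
have d1 : 0 < - D x1 by rewrite oppr_gt0; apply: h2_lt0; rewrite inE.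
have d2 : 0 < - D x2 by rewrite oppr_gt0; apply: h2_lt0; rewrite inE.
split=> // s t s0; rewrite le_eqVlt => /orP[/eqP -> t1|st t1].
  by rewrite !subrr !mulr0 lexx.
have [c /andP[sc ct] E] := MVT_in01 s0 st t1 ddh.
rewrite -[slope s - _]opprB E -/D -!mulNr.
have cin : c \in `[0, 1]%R by rewrite in_itv/=; apply/andP; split; lra.
by rewrite !ler_pM2r ?subr_gt0// !lerN2 Hx1// Hx2.
Qed.

Lemma slope_chord (s t : R) : 0 <= s -> s < t -> t <= 1 ->
  exists2 c, s < c < t & h t - h s = slope c * (t - s).
Proof. by move=> s0 st t1; apply: MVT_in01 => //; case: h_C2. Qed.

(* Mean value theorem for [x |-> h x - h (x + e)]. *)
Lemma second_difference (e s c C : R) :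
  (forall s t, 0 <= s -> s <= t -> t <= 1 ->
    c * (t - s) <= slope s - slope t <= C * (t - s)) ->
  0 < e -> 0 <= s -> s + 2 * e <= 1 ->
  c * e ^+ 2 <= 2 * h (s + e) - h s - h (s + 2 * e) <= C * e ^+ 2.
Proof.
move=> Hc e0 s0 se1; case: h_C2 => dh _ _.
pose g x := h x - h (x + e).
have [|||x] := @MVT R g (fun x => slope x - slope (x + e)) s (s + e).
- by rewrite ltrDl.
- move=> x; rewrite in_itv/= => /andP[sx xe].
  have d1 : is_derive x 1 h (slope x).
    by apply: is_derive_in01; [|apply: dh; apply/in01P]; apply/andP; split; lra.
  have d2 : is_derive (x + e) 1 h (slope (x + e)).
    by apply: is_derive_in01; [|apply: dh; apply/in01P]; apply/andP; split; lra.
  have d3 : is_derive x (1 : R) (fun y => y + e) (1 : R).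
    by apply: is_derive_eq; rewrite addr0.
  have d4 : is_derive x 1 (fun y => h (y + e)) (slope (x + e)).
    have := @is_derive1_comp _ h (fun y => y + e) x _ _ d2 d3.
    by rewrite mulr1.
  exact: is_deriveB.
- apply: locally_lipschitz_continuous => x /=; rewrite in_itv/= => /andP[sx xe].
  have x01 : `[0, 1]%classic x by apply/in01P/andP; split; lra.
  have xe01 : `[0, 1]%classic (x + e) by apply/in01P/andP; split; lra.
  have [r1 r10 H1] := derivable_in_lipschitz (dh _ x01).
  have [r2 r20 H2] := derivable_in_lipschitz (dh _ xe01).
  exists (Num.min r1 r2); first by rewrite lt_min r10.
  exists ((`|slope x| + 1) + (`|slope (x + e)| + 1)).
    by rewrite addr_gt0// ltr_wpDl.
  move=> y; rewrite in_itv/= lt_min => /andP[sy ye] /andP[yr1 yr2].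
  have yE : y + e - (x + e) = y - x by ring.
  have := H2 (y + e); rewrite yE => /(_ _ yr2) H2'.
  have := H1 y _ yr1 => H1'.
  rewrite /g (_ : _ - _ = (h y - h x) - (h (y + e) - h (x + e))); last by ring.
  apply: le_trans (ler_normB _ _) _; rewrite mulrDl lerD//.
    by apply: H1'; apply/in01P/andP; split; lra.
  by apply: H2'; apply/in01P/andP; split; lra.
rewrite in_itv/= => /andP[sx xe] E.
have xs : s + e - s = e by ring.
have := Hc x (x + e); rewrite xs in E.
have -> : 2 * h (s + e) - h s - h (s + 2 * e) = g (s + e) - g s.
  by rewrite /g (_ : s + e + e = s + 2 * e); ring.
rewrite E (_ : x + e - x = e); last by ring.
move=> /(_ _ _ _) H; have {H} /andP[] := H (ltac:(lra)) (ltac:(lra)) (ltac:(lra)).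
by rewrite !expr2 !mulrA => ? ?; rewrite !ler_pM2r//; apply/andP.
Qed.

End strictly_concave_profile.

(** * Riemann sums of a Lipschitz function *)

Section riemann_sums.
Context {R : realType} (f : R -> R) (L : R).
Hypothesis f_lip : forall s t, 0 <= s <= 1 -> 0 <= t <= 1 ->
  `|f s - f t| <= L * `|s - t|.
Notation mu := (@lebesgue_measure R).

Let L0 : 0 <= L.
Proof.
have := f_lip (s := 0) (t := 1); rewrite !lexx ler01 => /(_ isT isT).
by rewrite sub0r normrN normr1 mulr1; apply: le_trans.
Qed.

Lemma lipschitz_integrable : mu.-integrable `[0, 1] (EFin \o f).
Proof.
apply: continuous_compact_integrable; first exact: segment_compact.
apply: locally_lipschitz_continuous => x; rewrite /= in_itv/= => x01.
exists 1 => //; exists (L + 1); first by rewrite ltr_wpDl.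
move=> y; rewrite /= in_itv/= => y01 _.
by apply: le_trans (f_lip y01 x01) _; rewrite ler_wpM2r// lerDl.
Qed.

(** Each of the [n] cells contributes an error of at most [L / n]. The sampling points are arbitrary
    in their cells, since they will be mean value points of [h]. *)
Lemma riemann_sum_close (n : nat) (t : nat -> R) : (0 < n)%N ->
  (forall k, (k < n)%N -> k%:R / n%:R <= t k <= k.+1%:R / n%:R) ->
  `|n%:R * \int[mu]_(s in `[0, 1]) f s - \sum_(0 <= k < n) f (t k)| <= L.
Proof.
move=> n0 Ht; have nR : 0 < n%:R :> R by rewrite ltr0n.
have inv0 : 0 < n%:R^-1 :> R by rewrite invr_gt0.
pose F (j : nat) := \int[mu]_(s in `[0, j%:R / n%:R]) f s.
have itf (j : nat) (b : itv_bound R) : (BLeft 0 <= b)%O -> (j <= n)%N ->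
    mu.-integrable [set` Interval b (BRight (j%:R / n%:R))] (EFin \o f).
  move=> b0 jn; apply: integrableS lipschitz_integrable => //.
  apply: subset_itv => //; rewrite bnd_simp ler_pdivrMr// mul1r ler_nat//.
have H j : (j <= n)%N ->
    `|n%:R * F j - \sum_(0 <= k < j) f (t k)| <= L * (j%:R / n%:R).
  elim: j => [|j IH] jn.
    rewrite big_nil subr0 mul0r mulr0 /F mul0r set_itv1 Rintegral_set1 mulr0.
    by rewrite normr0.
  have jle : j%:R / n%:R <= j.+1%:R / n%:R :> R by rewrite ler_pM2r// ler_nat.
  have FS : F j.+1 = F j + \int[mu]_(s in `]j%:R / n%:R, j.+1%:R / n%:R]) f s.
    rewrite /F -(@Rintegral_itvB _ f (BLeft 0) (BRight (j.+1%:R / n%:R)) (j%:R / n%:R)).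
    - by rewrite addrC subrK.
    - exact: itf.
    - by rewrite bnd_simp mulr_ge0// ltW.
    - by rewrite bnd_simp.
  rewrite big_nat_recr//= FS; set D := \int[mu]_(s in _) _.
  have cst_int c : \int[mu]_(s in `]j%:R / n%:R, j.+1%:R / n%:R]) c = c / n%:R.
    rewrite Rintegral_cst//= lebesgue_measure_itv/= lte_fin.
    have -> : j%:R / n%:R < j.+1%:R / n%:R :> R by rewrite ltr_pM2r// ltr_nat.
    by rewrite -EFinB/= -mulrBl -natrB// subSnn mul1r.
  have cst_i c : mu.-integrable `]j%:R / n%:R, j.+1%:R / n%:R] (EFin \o cst c).
    apply: integrableS (_ : mu.-integrable `[0, 1] (EFin \o cst c)) => //.
      apply: subset_itv; rewrite bnd_simp ?mulr_ge0 ?(ltW inv0)//.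
      by rewrite ler_pdivrMr// mul1r ler_nat.
    by apply: continuous_compact_integrable; [exact: segment_compact|
      exact/continuous_subspaceT/cst_continuous].
  have fi : mu.-integrable `]j%:R / n%:R, j.+1%:R / n%:R] (EFin \o f).
    by apply: itf => //; rewrite bnd_simp mulr_ge0// ltW.
  have fb s : `]j%:R / n%:R, j.+1%:R / n%:R]%classic s ->
      `|f s - f (t j)| <= L / n%:R.
    rewrite /= in_itv/= => /andP[js sj]; have /andP[jt tj] := Ht j jn.
    have j0 : 0 <= j%:R / n%:R :> R by rewrite mulr_ge0// ltW.
    have j1 : j.+1%:R / n%:R <= 1 :> R by rewrite ler_pdivrMr// mul1r ler_nat.
    apply: le_trans (f_lip _ _) _; [by apply/andP; split; lra..|].
    rewrite ler_wpM2l//.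
    have -> : n%:R^-1 = j.+1%:R / n%:R - j%:R / n%:R :> R.
      by rewrite -mulrBl -natrB// subSnn mul1r.
    by rewrite ler_norml; apply/andP; split; lra.
  have Dle : D <= (f (t j) + L / n%:R) / n%:R.
    rewrite -cst_int; apply: le_Rintegral => //; first exact: cst_i.
    move=> s /fb.
    by rewrite ler_norml => /andP[? ?]; lra.
  have Dge : (f (t j) - L / n%:R) / n%:R <= D.
    rewrite -cst_int; apply: le_Rintegral => //; first exact: cst_i.
    move=> s /fb.
    by rewrite ler_norml => /andP[? ?]; lra.
  have {Dle} : n%:R * D <= f (t j) + L / n%:R.
    by rewrite mulrC -ler_pdivlMr.
  have {Dge} : f (t j) - L / n%:R <= n%:R * D.
    by rewrite [leRHS]mulrC -ler_pdivrMr.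
  have := IH (ltnW jn); rewrite !ler_norml => /andP[? ?] ? ?.
  have -> : L * (j.+1%:R / n%:R) = L * (j%:R / n%:R) + L / n%:R.
    by rewrite -natr1; ring.
  by rewrite mulrDr; apply/andP; split; lra.
have := H n (leqnn n).
by rewrite /F mulfV ?gt_eqF// mulr1.
Qed.

End riemann_sums.

(** * Exact displacements from irreducibility and aperiodicity *)

Section exact_displacements.
Context d (T : measurableType d) (R : realType) (P : probability T R).
Variable Y : {RV P >-> int}.

Definition charged (s : seq int) : Prop :=
  forall z, z \in s -> (0 < distribution P Y [set z])%E.

Definition attains (n : nat) (z : int) : Prop :=
  exists s : seq int, [/\ size s = n, \sum_(y <- s) y = z & charged s].

Lemma attains0 : attains 0 0.
Proof. by exists [::]; rewrite big_nil. Qed.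

Lemma attainsD n m y z : attains n y -> attains m z -> attains (n + m) (y + z).
Proof.
move=> [s [<- <- sp]] [t [<- <- tp]]; exists (s ++ t).
rewrite size_cat big_cat; split=> // u.
by rewrite mem_cat => /orP[/sp|/tp].
Qed.

Lemma attainsM k n z : attains n z -> attains (k * n) (z *+ k).
Proof.
move=> nz; elim: k => [|k IH]; first exact: attains0.
by rewrite mulSn mulrS; exact: attainsD.
Qed.

Lemma attains_nstep n x y : (0 < nstep (walk_transition Y) n x y)%E ->
  attains n (y - x).
Proof.
elim: n x => [|n IH] x /=.
  rewrite lte_fin ltr0n lt0b => /eqP ->; rewrite subrr; exact: attains0.
move=> pos; apply: contrapT => nat_; move: pos; rewrite esum1 ?ltxx// => z _.
have [->|z0] := eqVneq (walk_transition Y x z) 0%E; first by rewrite mul0e.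
have [->|n0] := eqVneq (nstep (walk_transition Y) n z y) 0%E.
  by rewrite mule0.
have nstep_ge0 k u v : (0 <= nstep (walk_transition Y) k u v)%E.
  elim: k u => [|k IHk] u /=; first by rewrite lee_fin.
  by apply: esum_ge0 => w _; rewrite mule_ge0.
exfalso; apply: nat_.
have -> : y - x = (z - x) + (y - z) by ring.
rewrite -add1n; apply: attainsD.
  exists [:: z - x]; split=> //; first by rewrite big_seq1.
  by move=> u; rewrite inE => /eqP ->; rewrite lt0e z0/=.
by apply: IH; rewrite lt0e n0 nstep_ge0.
Qed.

Hypothesis irr : irreducible_chain (walk_transition Y).
Hypothesis aper : aperiodic_chain (walk_transition Y).

(* The smallest difference of two return times divides every return time. *)
Lemma consecutive_returns : exists k, attains k 0 /\ attains k.+1 0.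
Proof.
pose D e := (0 < e)%N /\ exists k, attains k 0 /\ attains (k + e) 0.
have exD : exists e, `[<D e>].
  (* The loop from 0 to 1 and back has length [n1 + n2], with [n1] positive because its endpoints
     differ; its difference with the return time 0 is a first candidate. *)
  have [n1 /attains_nstep] := irr 0 1; rewrite subr0 => a1.
  have [n2 /attains_nstep] := irr 1 0; rewrite sub0r => a2.
  exists (n1 + n2)%N; apply/asboolP; split.
    case: n1 a1 => // -[[|z s] [//= _]]; by rewrite big_nil.
  exists 0%N; split; first exact: attains0.
  by have := attainsD a1 a2; rewrite subrr.
have [q /asboolP[q0 [k [ak akq]]] qmin] := ex_minnP exD.
suff q1 : q = 1%N by exists k; split=> //; rewrite -addn1 -q1.
apply: (aper (x := 0)) => n n0 /attains_nstep; rewrite subr0 => an.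
rewrite /dvdn; case: posnP => // r0.
(* [n %/ q * (k + q)] and [n %/ q * k + n] are return times that differ by [n %% q], against the
   minimality of [q]. *)
have /(qmin _)/leq_trans : `[<D (n %% q)%N>].
  apply/asboolP; split=> //; exists (n %/ q * (k + q))%N; split.
    by have := attainsM (n %/ q) akq; rewrite mul0rn.
  rewrite mulnDr -addnA -divn_eq; rewrite -[0]addr0; apply: attainsD => //.
  by have := attainsM (n %/ q) ak; rewrite mul0rn.
move=> /(_ _ (leqnn _)) => /leq_ltn_trans/(_ (ltn_pmod n q0)).
by rewrite ltnn.
Qed.

(** Coin problem for [k] and [k.+1]: from [k * k] on, the quotient by [k] is at least the remainder,
    which counts the loops of length [k.+1]. *)
Lemma returns_eventually : exists k, forall n, (k <= n)%N -> attains n 0.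
Proof.
have [k [ak ak1]] := consecutive_returns; exists (k * k)%N => n kn.
have [k0|k0] := posnP k.
  by have := attainsM n ak1; rewrite k0 mul0rn muln1.
have rk : (n %% k <= n %/ k)%N.
  apply: (@leq_trans k); first by rewrite ltnW// ltn_pmod.
  by rewrite leq_divRL.
have -> : n = ((n %/ k - n %% k) * k + (n %% k) * k.+1)%N.
  by rewrite mulnS addnCA -mulnDl subnK// addnC -divn_eq.
rewrite -[0]addr0; apply: attainsD.
  by have := attainsM (n %/ k - n %% k) ak; rewrite mul0rn.
by have := attainsM (n %% k) ak1; rewrite mul0rn.
Qed.

(** The length must not depend on [e], so [e] unit displacements are padded by a return to 0. *)
Lemma attains_small (g : nat) :
  exists r, forall e, (e <= g)%N -> attains r e%:Z.
Proof.
have [k Hk] := returns_eventually.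
have [n1 /attains_nstep] := irr 0 1; rewrite subr0 => a1.
exists (g * n1 + k)%N => e eg.
have -> : (g * n1 + k = e * n1 + ((g - e) * n1 + k))%N.
  by rewrite addnA -mulnDl subnKC.
rewrite -(addr0 e%:Z) -natz; apply: attainsD; first exact: attainsM.
by apply: Hk; rewrite leq_addl.
Qed.

Lemma charged_bounds (s : seq int) : charged s ->
  exists rho B : R, [/\ 0 < rho, rho <= 1, 0 < B & forall z, z \in s ->
    (rho%:E <= distribution P Y [set z])%E /\ `|z%:~R| <= B].
Proof.
elim: s => [_|z s IH sp]; first by exists 1, 1.
have [rho [B [rho0 rho1 B0 HB]]] : exists rho B : R, [/\ 0 < rho, rho <= 1, 0 < B &
    forall z, z \in s -> (rho%:E <= distribution P Y [set z])%E /\ `|z%:~R| <= B].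
  by apply: IH => y ys; apply: sp; rewrite inE ys orbT.
have pz : (0 < distribution P Y [set z])%E by apply: sp; rewrite inE eqxx.
have fz : distribution P Y [set z] \is a fin_num by exact: fin_num_measure.
exists (Num.min rho (fine (distribution P Y [set z]))), (B + `|z%:~R|); split.
- by rewrite lt_min rho0 fine_gt0// pz ltey_eq fz.
- by rewrite ge_min rho1.
- by rewrite ltr_wpDr.
- move=> y; rewrite inE => /orP[/eqP ->|/HB[yr yB]].
    by rewrite lerDr (ltW B0) -[leRHS]fineK// lee_fin ge_min lexx orbT.
  by rewrite ler_wpDr// (le_trans _ yr)// lee_fin ge_min lexx.
Qed.

(** Finitely many increments are involved, so one [rho] and one [B] serve all these paths. *)
Lemma exact_displacements (g : nat) (zs : seq int) : charged zs ->
  exists (r : nat) (rho B : R), [/\ 0 < rho, rho <= 1, 0 < B,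
    forall z, z \in zs ->
      (rho%:E <= distribution P Y [set z])%E /\ `|z%:~R| <= B &
    forall e, (e <= g)%N -> exists s : seq int,
      [/\ size s = r, \sum_(z <- s) z = e%:Z & forall z, z \in s ->
        (rho%:E <= distribution P Y [set z])%E /\ `|z%:~R| <= B]].
Proof.
move=> zsp; have [r Hr] := attains_small g.
have [f Hf] : exists f : nat -> seq int, forall e, (e <= g)%N ->
    [/\ size (f e) = r, \sum_(z <- f e) z = e%:Z & charged (f e)].
  have /choice[f Hf] : forall e, exists s : seq int, (e <= g)%N ->
      [/\ size s = r, \sum_(z <- s) z = e%:Z & charged s].
    move=> e; case: (leqP e g) => eg; last by exists [::].
    by have [s Hs] := Hr e eg; exists s.
  by exists f.
have [|rho [B [rho0 rho1 B0 HB]]] :=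
    @charged_bounds (zs ++ flatten [seq f e | e <- iota 0 g.+1]).
  move=> z; rewrite mem_cat => /orP[/zsp//|/flatten_mapP[e]].
  by rewrite mem_iota ltnS => /Hf[_ _]; apply.
exists r, rho, B; split=> // [z zzs|e eg].
  by apply: HB; rewrite mem_cat zzs.
have [sr se _] := Hf e eg; exists (f e); split=> // z zf.
apply: HB; rewrite mem_cat; apply/orP; right; apply/flatten_mapP.
by exists e => //; rewrite mem_iota ltnS.
Qed.

End exact_displacements.

(** * Explicit paths above the curve and the choice of constants *)

Lemma curve_between (R : realFieldType) (thr dd : nat -> R) (n : nat) (l u : R) :
  (forall k, (k < n)%N -> thr k.+1 = thr k + dd k) ->
  (forall k, (k < n)%N -> l <= dd k <= u) ->
  forall i j, (i + j <= n)%N ->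
  thr i + j%:R * l <= thr (i + j)%N <= thr i + j%:R * u.
Proof.
move=> thrS ddb i; elim=> [|j IH] ijn; first by rewrite addn0 !mul0r !addr0 lexx.
have ij : (i + j < n)%N by rewrite -addnS.
have /andP[h1 h2] := IH (ltnW ij); have /andP[h3 h4] := ddb _ ij.
by rewrite addnS thrS// -natr1; apply/andP; split; lra.
Qed.

Lemma sum_bounded (R : realDomainType) (s : seq int) (B : R) :
  (forall z, z \in s -> `|z%:~R| <= B) ->
  `|(\sum_(z <- s) z)%:~R| <= (size s)%:R * B.
Proof.
elim: s => [|z s IH] sB; first by rewrite big_nil normr0 mul0r.
rewrite big_cons intrD /= -natr1 mulrDl mul1r addrC.
apply: le_trans (ler_normD _ _) _; rewrite lerD//; last by apply: sB; rewrite inE eqxx.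
by apply: IH => y ys; apply: sB; rewrite inE ys orbT.
Qed.

Lemma sum_nseq_int (n : nat) (z : int) : \sum_(y <- nseq n z) y = z *+ n.
Proof. by elim: n => [|n IH]; rewrite ?big_nil// /= big_cons IH mulrS. Qed.

(* The way down from the strip: a short adjusting path [s0] fixing the residue
   modulo [zp - zm], then steps [zp], then steps [zm]. *)
Lemma final_path (R : realType) (thr dd : nat -> R) (n r r0 : nat) (zm zp x m : int)
    (g B : R) :
  (r <= n)%N -> (r0 <= r)%N -> 0 < g ->
  (forall k, (k < n)%N -> thr k.+1 = thr k + dd k) ->
  (forall k, (k < n)%N -> zm%:~R + g <= dd k <= zp%:~R - g) ->
  `|zm%:~R| <= B -> `|zp%:~R| <= B ->
  0 <= m%:~R - thr n <= 1 ->
  2 * (r0%:R * B) <= x%:~R - thr (n - r)%N ->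
  x%:~R - thr (n - r)%N + r0%:R * B + 1 <= r%:R * g ->
  exists e : nat, (e < absz (zp - zm)%R)%N /\
    forall s0 : seq int, size s0 = r0 -> \sum_(z <- s0) z = e%:Z ->
      (forall z, z \in s0 -> `|z%:~R| <= B) ->
    exists s : seq int, [/\ size s = r, x + \sum_(z <- s) z = m,
      {subset s <= [:: zm, zp & s0]} &
      forall i, (0 < i <= size s)%N ->
        thr (n - r + i)%N <= (x + \sum_(z <- take i s) z)%:~R].
Proof.
move=> rn r0r g0 thrS ddb Bm Bp /andP[mE0 mE1] yB yg.
set k0 := (n - r)%N in yB yg *.
have cb := curve_between thrS ddb.
have k0r : (k0 + r = n)%N by rewrite subnK.
have n0 : (0 < n)%N.
  rewrite lt0n; apply/negP => /eqP n0; have r_0 : r = 0%N by lia.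
  have r0_0 : r0 = 0%N by lia.
  by rewrite r_0 r0_0 !mul0r mulr0 in yB yg; lra.
have gap : zm < zp.
  rewrite -(ltr_int R); have /andP[? ?] := ddb 0%N n0; lra.
have /andP[lo_n hi_n] : thr k0 + r%:R * (zm%:~R + g) <= thr n <=
    thr k0 + r%:R * (zp%:~R - g).
  by rewrite -k0r; apply: cb; rewrite k0r.
have r0B : `|r0%:R * zm%:~R| <= r0%:R * B :> R by rewrite normrM ger0_norm// ler_wpM2l.
have r0Bp : `|r0%:R * zp%:~R| <= r0%:R * B :> R by rewrite normrM ger0_norm// ler_wpM2l.
move: (r0B) (r0Bp); rewrite !ler_norml => /andP[r0B1 r0B2] /andP[r0B3 r0B4].
set M := (r - r0)%N.
have ME : M%:R = r%:R - r0%:R :> R by rewrite natrB.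
have zR (z : int) k : (z *+ k)%:~R = k%:R * z%:~R :> R.
  by rewrite rmorphMn/= mulr_natl.
have D0 : 0 <= m - x - zm *+ M.
  by rewrite -(ler_int R) !rmorphB/= zR ME; lra.
have DM : m - x - zm *+ M <= (zp - zm) *+ M.
  rewrite -(ler_int R) !rmorphB/= !zR rmorphB/= ME.
  have := mulr_ge0 (ler0n R r0) (le_trans (normr_ge0 _) Bm); lra.
(* [m - x] lies between [M] steps [zm] and [M] steps [zp]. Dividing the excess [D] by [G] gives the
   number [al] of steps [zp] and the displacement [e] left to [s0]. *)
pose D := absz (m - x - zm *+ M)%R; pose G := absz (zp - zm)%R.
have DE : D%:Z = m - x - zm *+ M by rewrite /D gez0_abs.
have GE : G%:Z = zp - zm by rewrite /G gez0_abs// subr_ge0 ltW.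
have G0 : (0 < G)%N by rewrite absz_gt0 subr_eq0 gt_eqF.
pose al := (D %/ G)%N; pose e := (D %% G)%N.
have alM : (al <= M)%N.
  rewrite /al -(mulnK M G0) leq_div2r// -lez_nat PoszM DE GE.
  by rewrite -natz mulr_natl in DM *.
exists e; split; first exact: ltn_pmod.
move=> s0 sz0 sum0 B0.
exists (s0 ++ nseq al zp ++ nseq (M - al) zm).
have szE : size (s0 ++ nseq al zp ++ nseq (M - al) zm) = r.
  by rewrite !size_cat !size_nseq sz0 subnKC// subnKC.
have totE : x + \sum_(z <- s0 ++ nseq al zp ++ nseq (M - al) zm) z = m.
  rewrite !big_cat/= !sum_nseq_int sum0 mulrnBr// addrCA.
  have : D%:Z = (al * G + e)%N by rewrite -divn_eq.
  rewrite DE PoszD PoszM GE -natz mulr_natl mulrnBl => H.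
  have -> : m = x + zm *+ M + (m - x - zm *+ M) by ring.
  by rewrite H; ring.
split=> //.
  move=> z; rewrite !mem_cat !mem_nseq !inE.
  by case/or3P => [->|/andP[_ /eqP ->]|/andP[_ /eqP ->]]; rewrite ?eqxx ?orbT.
move=> i; rewrite szE => /andP[i0 ir].
(* Along [s0] the walk loses and the curve gains at most [B] per step, which the initial height
   [2 * (r0 * B)] covers. *)
have [ir0|ir0] := leqP i r0.
  rewrite takel_cat ?sz0//.
  have := @sum_bounded R (take i s0) B (fun z zi => B0 z (mem_take zi)).
  rewrite size_takel ?sz0// rmorphD/= ler_norml => /andP[t1 _].
  have iB : i%:R * B <= r0%:R * B by rewrite ler_wpM2r ?ler_nat// (le_trans _ Bm).
  have zpB : i%:R * (zp%:~R - g) <= i%:R * B :> R.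
    by rewrite ler_wpM2l//; have := ler_norm (zp%:~R : R); lra.
  have /andP[_ c1] : thr k0 + i%:R * (zm%:~R + g) <= thr (k0 + i)%N <=
    thr k0 + i%:R * (zp%:~R - g) by apply: cb; rewrite -k0r leq_add2l.
  lra.
have e0 : 0 <= e%:~R :> R by rewrite ler0z.
have [ial|ial] := leqP i (r0 + al).
  rewrite take_cat sz0 ltnNge (ltnW ir0)/= takel_cat; last first.
    by rewrite size_nseq leq_subLR.
  have -> : take (i - r0) (nseq al zp) = nseq (i - r0) zp.
    by rewrite take_nseq// leq_subLR.
  rewrite big_cat/= sum0 sum_nseq_int !rmorphD/= zR.
  have /andP[_ c1] : thr k0 + i%:R * (zm%:~R + g) <= thr (k0 + i)%N <=
    thr k0 + i%:R * (zp%:~R - g) by apply: cb; rewrite -k0r leq_add2l.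
  rewrite natrB 1?ltnW//; have := mulr_ge0 (ler0n R i) (ltW g0); lra.
(* The last stretch is read backwards from [m]: steps [zm] fall relative to the curve, whose end
   lies below [m]. *)
have dropE : drop i (s0 ++ nseq al zp ++ nseq (M - al) zm) = nseq (r - i) zm.
  rewrite drop_cat sz0 ltnNge (ltnW ir0)/= drop_cat size_nseq ltnNge.
  rewrite leq_subRL ?(ltnW ir0)// (ltnW ial)/= drop_nseq; congr (nseq _ _).
  by rewrite /M; move: (al) ial ir0 ir r0r => a; clear; lia.
have tk : x + \sum_(z <- take i (s0 ++ nseq al zp ++ nseq (M - al) zm)) z =
    m - zm *+ (r - i).
  rewrite -[in RHS]totE -[in RHS](cat_take_drop i (s0 ++ _)) big_cat/= dropE.
  by rewrite sum_nseq_int; ring.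
rewrite tk rmorphB/= zR.
have /andP[c1 _] : thr (k0 + i)%N + (r - i)%:R * (zm%:~R + g) <= thr (k0 + i + (r - i))%N <=
    thr (k0 + i)%N + (r - i)%:R * (zp%:~R - g).
  by apply: cb; rewrite -addnA subnKC// k0r.
move: c1; rewrite -addnA subnKC// k0r => c1.
have := mulr_ge0 (ler0n R (r - i)) (ltW g0); lra.
Qed.

Lemma affine_ge0 (R : realFieldType) (l u x v : R) :
  l <= 0 -> 0 <= u -> l <= x -> 0 <= v <= 1 -> 0 <= u - l + x * v.
Proof.
move=> l0 u0 lx /andP[v0 v1].
have h1 := ler_wpM2r v0 lx.
have h2 : l * (1 - v) <= 0 by apply: mulr_le0_ge0 => //; rewrite subr_ge0.
lra.
Qed.

Lemma expRN2_le (R : realType) (t : R) : 0 <= t <= 2^-1 -> expR (- (2 * t)) <= 1 - t.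
Proof.
move=> /andP[t0 t1]; rewrite expRN -[leRHS]invrK lef_pV2 ?posrE ?expR_gt0 ?invr_gt0//; last by lra.
apply: le_trans (expR_ge1Dx _).
rewrite -[leLHS]mul1r ler_pdivrMr; last by lra.
have : 0 <= t * (1 - 2 * t) by rewrite mulr_ge0//; lra.
lra.
Qed.

(** For a strip of half-width [y0 / 2] around height [y0], with heights at most [6 * B * N]. The
    loss per step, diffusion plus area penalty, is of order N^-2 because [n = N ^+ 3]. *)
Lemma strip_constants (R : realFieldType) (g B C k2 w0 b : R) :
  0 < g -> 0 < B -> 0 < C -> 0 <= k2 -> 0 < w0 -> 0 <= b ->
  exists2 N0 : R, 1 <= N0 & forall N y0, N0 <= N -> g * N <= y0 ->
  [/\ 0 < y0 / 2, w0 <= y0 / 2, 2 * b <= y0 / 2,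
      0 <= C / (y0 / 2) ^+ 2 <= 2^-1 &
      2 * (C / (y0 / 2) ^+ 2) + k2 / N ^+ 3 * (6 * B * N) <=
        (8 * C / g ^+ 2 + 6 * B * k2) / N ^+ 2].
Proof.
move=> g0 B0 C0 k20 w00 b0; pose c := 2 * b + w0 + 1 + 2 * C.
have c0 : 0 < c by rewrite /c; lra.
have cg0 : 0 < c / (g / 2) by rewrite !divr_gt0.
exists (1 + c / (g / 2)) => [|N y0 NN gy]; first by lra.
have N0 : 0 < N by lra.
have : c / (g / 2) <= N by lra.
rewrite ler_pdivrMr; last by rewrite divr_gt0.
move=> cN.
set w := y0 / 2; have wg : g * N / 2 <= w by rewrite /w; lra.
have wc : c <= w by lra.
have w0' : 0 < w by lra.
have w1 : 1 + 2 * C <= w by apply: le_trans wc; rewrite /c; lra.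
have w2 : 0 < w ^+ 2 by rewrite exprn_gt0.
have w0w : w0 <= w by apply: le_trans wc; rewrite /c; lra.
have bw : 2 * b <= w by apply: le_trans wc; rewrite /c; lra.
split; [exact: w0'|exact: w0w|exact: bw| |].
  rewrite divr_ge0 ?(ltW w2) ?(ltW C0)//= ler_pdivrMr//.
  have : w <= w ^+ 2 by rewrite expr2 ler_peMr//; lra.
  lra.
have gN : 0 < g * N / 2 by rewrite divr_gt0// mulr_gt0.
have h1 : 2 * (C / w ^+ 2) <= 8 * C / g ^+ 2 / N ^+ 2.
  have -> : 8 * C / g ^+ 2 / N ^+ 2 = 2 * (C / (g * N / 2) ^+ 2).
    by field; rewrite !gt_eqF.
  rewrite !ler_pM2l// lef_pV2 ?posrE ?exprn_gt0//.
  by rewrite lerXn2r// nnegrE ltW.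
have -> : k2 / N ^+ 3 * (6 * B * N) = 6 * B * k2 / N ^+ 2.
  by field; rewrite gt_eqF.
by rewrite [leRHS]mulrDl lerD2r.
Qed.

(** Each step [zp] gains between [g] and [2 * B] on the curve. *)
Lemma climb_height (R : realFieldType) (thr dd : nat -> R) (n r : nat)
    (N zm zp g B : R) :
  0 < g -> thr 0%N = 0 -> (r <= n)%N ->
  (forall k, (k < n)%N -> thr k.+1 = thr k + dd k) ->
  (forall k, (k < n)%N -> zm + g <= dd k <= zp - g) ->
  `|zm| <= B -> `|zp| <= B -> N <= r%:R <= 2 * N ->
  g * N <= r%:R * zp - thr r <= 4 * B * N.
Proof.
move=> g0 thr0 rn thrS ddb zmB zpB /andP[rl ru].
have := curve_between thrS ddb (i := 0%N) (j := r).
rewrite add0n thr0 !add0r => /(_ rn) /andP[c1 c2].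
have B0 : 0 <= B by exact: le_trans zmB.
have g1 : g * N <= g * r%:R by rewrite ler_pM2l.
have B1 : r%:R * B <= 2 * N * B by rewrite ler_wpM2r.
move: zmB zpB; rewrite !ler_norml => /andP[zm1 zm2] /andP[zp1 zp2].
have h1 : r%:R * zp <= r%:R * B by rewrite ler_wpM2l.
have h2 : r%:R * - B <= r%:R * zm by rewrite ler_wpM2l.
have h3 : 0 <= r%:R * g by rewrite mulr_ge0// ltW.
by apply/andP; split; lra.
Qed.

(** Provides the length required by [final_path] from heights up to [6 * B * N]: each step [zm]
    loses at least [g] on the curve. *)
Lemma descent_length (R : realFieldType) (g B N : R) (r0 r : nat) :
  0 < g -> 0 <= B -> 1 <= N ->
  ((6 * B + r0%:R * B + 2) / g + r0%:R) * N <= r%:R ->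
  (r0 <= r)%N /\ 6 * B * N + r0%:R * B + 1 <= r%:R * g.
Proof.
move=> g0 B0 N1; set K := _ + r0%:R => rl.
have r0B : 0 <= r0%:R * B by rewrite mulr_ge0.
have Kr0 : r0%:R <= K by rewrite /K lerDr divr_ge0 ?(ltW g0)//; lra.
have K0 : 0 <= K by exact: le_trans Kr0.
split.
  rewrite -(ler_nat R) (le_trans Kr0)// (le_trans _ rl)//.
  by rewrite -[leLHS]mulr1 ler_wpM2l.
have h1 : K * N * g <= r%:R * g by rewrite ler_pM2r.
apply: le_trans h1.
have -> : K * N * g = (6 * B + r0%:R * B + 2) * N + r0%:R * N * g.
  by rewrite /K; field; rewrite gt_eqF.
have h2 : r0%:R * B * 1 <= r0%:R * B * N by rewrite ler_wpM2l.
have h3 : 0 <= r0%:R * N * g by rewrite !mulr_ge0 ?(ltW g0)//; lra.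
lra.
Qed.

(** * Both bounds for the killed expectation along a profile *)

Section profiles.
Context d (T : measurableType d) (R : realType) (P : probability T R).
Variable Y : {RV P >-> int}.
Variables lo hi eta : R.
Hypothesis eta0 : 0 < eta.
Hypotheses (lo0 : lo <= 0) (hi0 : 0 <= hi).
Hypothesis integ_lo : integ Y (fun z => expR ((lo - eta) * z%:~R)).
Hypothesis integ_hi : integ Y (fun z => expR ((hi + eta) * z%:~R)).
Hypothesis mean0 : EX Y (fun z => z%:~R) = 0.
Hypothesis var_neq0 : EX Y (fun z => z%:~R ^+ 2) != 0.
Hypothesis irr : irreducible_chain (walk_transition Y).
Hypothesis aper : aperiodic_chain (walk_transition Y).

(* [thr] is the scaled curve and [lam] the sequence of tilts whose means are
   its increments; [lam 0] is a dummy extending the almost linear decay. *)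
Record profile (k1 k2 : R) (n : nat) (thr lam : nat -> R) (m : int) : Prop :=
  Profile {
    profile_start : thr 0%N = 0;
    profile_tilt : forall k, (k < n)%N -> lo <= lam k.+1 <= hi;
    profile_step : forall k, (k < n)%N ->
      thr k.+1 = thr k + tilt_mean Y (lam k.+1);
    profile_decay : forall k, (k < n)%N ->
      k1 / n%:R <= lam k - lam k.+1 <= k2 / n%:R;
    profile_end : 0 <= m%:~R - thr n <= 1 }.

Definition profile_cost (n : nat) (lam : nat -> R) : R :=
  \sum_(0 <= k < n) tilt_rate Y (lam k.+1).

Lemma exp_tilt_rate l : lo <= l <= hi ->
  expR (- (l * tilt_mean Y l)) * tilt_mass Y l = expR (- tilt_rate Y l).
Proof.
move=> lJ; have A0 := tilt_mass_gt0 eta0 lo0 hi0 integ_lo integ_hi mean0 lJ.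
rewrite -[X in _ * X]lnK ?posrE// -expRD /tilt_rate log_mass.unlock.
by congr expR; ring.
Qed.

Lemma surv_one_step (thr : nat -> R) k (x : int) (l B : R) (F : R -> R) (C : R) :
  lo <= l <= hi -> thr k.+1 = thr k + tilt_mean Y l ->
  (forall v, 0 <= F v <= C) -> (forall v, v < 0 -> F v = 0) ->
  surv Y thr 1 k (fun x' => (expR (B + l * (x'%:~R - thr k.+1)) *
                             F (x'%:~R - thr k.+1))%:E) x =
  (expR (B + l * (x%:~R - thr k) - l * tilt_mean Y l) *
     tilt Y l (fun z => F (x%:~R - thr k + (z%:~R - tilt_mean Y l))))%:E.
Proof.
move=> lJ thrS F0 Fneg; rewrite survS.
set y := x%:~R - thr k; set m := tilt_mean Y l.
set c := expR (B + l * y - l * m).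
pose G (z : int) := F (y + (z%:~R - m)).
have Gq : quartic G.
  apply: (quartic_bounded (C := C)) => z.
  by have /andP[? ?] := F0 (y + (z%:~R - m)); rewrite ger0_norm.
have iG := integ_tilt eta0 integ_lo integ_hi lJ Gq.
rewrite /tilt -EXZ// EX_fin; last exact: integZ.
apply: eq_integral => w _; move: (Y w) => z.
have E : (x + z)%:~R - thr k.+1 = y + (z%:~R - m).
  by rewrite thrS intrD /y -/m; ring.
rewrite /= -subr_ge0 E; case: ifPn => [_|]; last first.
  by rewrite -ltNge => /Fneg Fz; rewrite /G Fz !mulr0.
congr EFin; rewrite mulrA /c -expRD; congr (expR _ * _).
by ring.
Qed.

(** The supersolution is [expR (B k + lam k * y) * barrier (y / N)], where [B k] collects the rates
    and a gain [q / N ^+ 2] per step, [q * N] in total. *)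
Lemma surv_profile_le (k1 k2 : R) : 0 < k1 -> exists2 q : R, 0 < q &
  exists2 N0 : R, 0 < N0 & forall (n : nat) (N : R) thr lam m,
  N0 <= N -> n%:R = N ^+ 3 -> profile k1 k2 n thr lam m ->
  (surv Y thr n 0 (fun y => (y == m)%:R%:E) 0 <=
   (expR ((hi - lo) - profile_cost n lam - q * N))%:E)%E.
Proof.
move=> k10.
have [q0 q00 [N0 N00 Hb]] :=
  tilt_barrier_le eta0 lo0 hi0 integ_lo integ_hi mean0 var_neq0.
(* [q0] is the gain available below height [N], [k1] the one above it. *)
pose q := Num.min q0 k1; exists q; first by rewrite lt_min q00.
exists N0 => // n N thr lam m NN nE [thr0 lamJ thrS lamS mE].
have N_gt0 : 0 < N by exact: lt_le_trans NN.
have n_gt0 : 0 < n%:R :> R by rewrite nE exprn_gt0.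
pose B k := \sum_(0 <= i < k) (tilt_rate Y (lam i.+1) + q / N ^+ 2).
pose G k (x : int) := (expR (B k + lam k * (x%:~R - thr k)) *
  barrier ((x%:~R - thr k) / N))%:E.
have G0 k x : (0 <= G k x)%E.
  by rewrite lee_fin mulr_ge0 ?expR_ge0 ?barrier_ge0.
have step k x : (0 <= k < 0 + n)%N -> thr k <= x%:~R ->
    (surv Y thr 1 k (G k.+1) x <= G k x)%E.
  rewrite add0n => /andP[_ kn]; rewrite -subr_ge0; set y := x%:~R - thr k => y0.
  have lJ := lamJ k kn; set l := lam k.+1 in lJ *.
  have A0 := tilt_mass_gt0 eta0 lo0 hi0 integ_lo integ_hi mean0 lJ.
  have Fb v : 0 <= barrier (v / N) <= 9 by rewrite barrier_ge0 barrier_le9.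
  have Fneg v : v < 0 -> barrier (v / N) = 0.
    move=> v0; rewrite /barrier ifF//; apply/negbTE.
    by rewrite -ltNge pmulr_llt0// invr_gt0.
  have E : surv Y thr 1 k (G k.+1) x = _ :=
    surv_one_step x (B k.+1) lJ (thrS k kn) Fb Fneg.
  rewrite {}E lee_fin -/y; set t := tilt _ _ _.
  have BS : B k.+1 = B k + tilt_rate Y l + q / N ^+ 2.
    by rewrite /B big_nat_recr//= addrA.
  have -> : expR (B k.+1 + l * y - l * tilt_mean Y l) =
      expR (B k + q / N ^+ 2 + l * y) / tilt_mass Y l.
    apply: (@mulIf _ (tilt_mass Y l)); first by rewrite gt_eqF.
    rewrite mulfVK ?gt_eqF// expRD -mulrA exp_tilt_rate// -expRD BS.
    by congr expR; ring.
  have /andP[dec _] := lamS k kn; rewrite -/l in dec.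
  rewrite mulrAC ler_pdivrMr//.
  have [yN|Ny] := leP y N.
    have H := Hb l N y lJ NN (introT andP (conj y0 yN)).
    apply: (le_trans (ler_wpM2l (expR_ge0 _) H)).
    rewrite mulrA ler_wpM2r ?(ltW A0)// mulrA ler_wpM2r ?barrier_ge0//.
    apply: (@le_trans _ _ (expR (B k + q / N ^+ 2 + l * y) * expR (- (q0 / N ^+ 2)))).
      by rewrite ler_wpM2l ?expR_ge0// expR_ge1Dx.
    rewrite -expRD ler_expR.
    have qq : q / N ^+ 2 <= q0 / N ^+ 2.
      by rewrite ler_pM2r ?invr_gt0 ?exprn_gt0// ge_min lexx.
    have ly : l * y <= lam k * y.
      rewrite ler_wpM2r// -subr_ge0; apply: le_trans dec.
      by rewrite divr_ge0 ?ltW.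
    by lra.
  (* Above height [N] the barrier is already maximal, and the gain is the area penalty: [(lam k -
     lam k.+1) * y >= k1 / n * N = k1 / N ^+ 2]. *)
  have H := tilt_barrier_le9 eta0 integ_lo integ_hi
    (fun z => (y + (z%:~R - tilt_mean Y l)) / N) lJ.
  apply: (le_trans (ler_wpM2l (expR_ge0 _) H)).
  rewrite mulrA ler_wpM2r ?(ltW A0)// (barrier_eq9 (v := y / N)); last first.
    by rewrite ler_pdivlMr// mul1r ltW.
  rewrite ler_wpM2r// ler_expR.
  have qq : q / N ^+ 2 <= k1 / n%:R * y.
    apply: (@le_trans _ _ (k1 / n%:R * N)); last first.
      by rewrite ler_wpM2l ?(ltW Ny)// divr_ge0 ?ltW.
    have -> : k1 / n%:R * N = k1 / N ^+ 2 by rewrite nE; field; rewrite gt_eqF.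
    by rewrite ler_pM2r ?invr_gt0 ?exprn_gt0// ge_min lexx orbT.
  have := ler_wpM2r y0 dec; lra.
have sup := surv_supersolution G0 (_ : thr 0%N <= 0%:~R) step.
have {}sup : (surv Y thr n 0 (G n) 0 <= (6%:R)%:E)%E.
  apply: le_trans (sup _) _; first by rewrite thr0.
  rewrite /G /B thr0 big_nil subrr mulr0 addr0 expR0 mul0r mul1r lee_fin.
  by rewrite /barrier lexx (min_idPl _)//; lra.
have nk : (0 < n)%N by rewrite -(ltr0n R).
have lnJ : lo <= lam n <= hi by case: (n) nk lamJ => // k _ H; exact: H.
have lnv (v : R) : 0 <= v <= 1 -> 0 <= hi - lo + lam n * v.
  by have /andP[ln0 _] := lnJ; exact: affine_ge0.
(* At the end point [barrier >= 6] and [lam n * v >= lo - hi]. The 6 cancels against [barrier 0],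
   the starting value of the supersolution. *)
set c := expR (hi - lo - B n) / 6.
have c0 : 0 <= c by rewrite divr_ge0 ?expR_ge0.
have le_c y : ((y == m)%:R%:E <= c%:E * G n y)%E.
  case: eqP => [->|_]; last by rewrite mule_ge0.
  rewrite /G -EFinM lee_fin; set v := m%:~R - thr n in mE *.
  have /andP[v0 v1] := mE.
  have b6 : 6 <= barrier (v / N) by apply: barrier_ge6; rewrite divr_ge0// ltW.
  have -> : c * (expR (B n + lam n * v) * barrier (v / N)) =
     expR (hi - lo + lam n * v) * (barrier (v / N) / 6).
    have -> : expR (hi - lo + lam n * v) = expR (hi - lo - B n) * expR (B n + lam n * v).
      by rewrite -expRD; congr expR; ring.
    by rewrite /c; ring.
  have e1 : 1 <= expR (hi - lo + lam n * v).
    by rewrite -expR0 ler_expR lnv// v0.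
  have b1 : 1 <= barrier (v / N) / 6 by rewrite ler_pdivlMr// mul1r.
  by apply: le_trans e1 _; rewrite ler_peMr ?expR_ge0.
apply: (@le_trans _ _ (surv Y thr n 0 (fun y => c%:E * G n y)%E 0)).
  by apply: le_surv => // y; rewrite lee_fin.
rewrite surv_scale//; apply: (@le_trans _ _ (c%:E * (6%:R)%:E)%E).
  by rewrite lee_wpmul2l// lee_fin.
rewrite -EFinM lee_fin /c mulfVK// ler_expR /B big_split/= -/(profile_cost n lam).
rewrite sumr_const_nat subn0 -mulr_natr nE.
have -> : q / N ^+ 2 * N ^+ 3 = q * N by field; rewrite gt_eqF.
by lra.
Qed.

(** As [w <= y0], the bump vanishes at negative heights, so [surv_one_step] applies;
    [1 - t >= expR (- (2 * t))] moves the loss into the exponent. *)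
Lemma surv_bump_step (thr : nat -> R) k (x : int) (l B C w y0 : R) :
  lo <= l <= hi -> thr k.+1 = thr k + tilt_mean Y l ->
  0 < w -> w <= y0 -> 0 <= C / w ^+ 2 <= 2^-1 ->
  (1 - C / w ^+ 2) * bump ((x%:~R - thr k - y0) / w) * tilt_mass Y l <=
    tilt Y l (fun z => bump ((x%:~R - thr k - y0 + (z%:~R - tilt_mean Y l)) / w)) ->
  ((expR (B - tilt_rate Y l - 2 * (C / w ^+ 2) + l * (x%:~R - thr k)) *
     bump ((x%:~R - thr k - y0) / w))%:E <=
  surv Y thr 1 k (fun x' => (expR (B + l * (x'%:~R - thr k.+1)) *
                             bump ((x'%:~R - thr k.+1 - y0) / w))%:E) x)%E.
Proof.
move=> lJ thrS w0 wy0 Cw Hb; set y := x%:~R - thr k in Hb *.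
have Fb v : 0 <= bump ((v - y0) / w) <= 1 by rewrite bump_ge0 bump_le1.
have Fneg v : v < 0 -> bump ((v - y0) / w) = 0.
  move=> v0; apply: bump_eq0; rewrite ler_normr; apply/orP; right.
  by rewrite -mulNr ler_pdivlMr//; lra.
have E := surv_one_step x B lJ thrS Fb Fneg.
rewrite /= in E *; rewrite {}E lee_fin -/y.
rewrite (@eq_tilt _ _ _ _ _ _ _ (fun z => bump ((y - y0 + (z%:~R - tilt_mean Y l)) / w))); last first.
  by move=> z; congr (bump (_ / _)); ring.
apply: le_trans (ler_wpM2l (expR_ge0 _) Hb).
set b := bump _; have b0 : 0 <= b by exact: bump_ge0.
have -> : expR (B + l * y - l * tilt_mean Y l) * ((1 - C / w ^+ 2) * b * tilt_mass Y l) =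
    expR (B + l * y) * (expR (- (l * tilt_mean Y l)) * tilt_mass Y l) *
    (1 - C / w ^+ 2) * b by rewrite expRD; ring.
rewrite (exp_tilt_rate lJ) -expRD ler_wpM2r//.
apply: le_trans (ler_wpM2l (expR_ge0 _) (expRN2_le Cw)).
by rewrite -expRD ler_expR; lra.
Qed.

(** Shaped like the supersolution, with a bump of half-width [w] at height [y0]; [e] is the loss per
    step. *)
Definition strip_weight (thr lam : nat -> R) (e w y0 : R) (k : nat) (x : int) : R :=
  expR (\sum_(0 <= i < k) (tilt_rate Y (lam i.+1) + e) + lam k * (x%:~R - thr k)) *
  bump ((x%:~R - thr k - y0) / w).

Lemma strip_weight_ge0 thr lam e w y0 k x : 0 <= strip_weight thr lam e w y0 k x.
Proof. by rewrite mulr_ge0 ?expR_ge0 ?bump_ge0. Qed.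

Lemma strip_weight_neq0 thr lam e w y0 k x : 0 < w ->
  strip_weight thr lam e w y0 k x != 0 -> y0 - w < x%:~R - thr k < y0 + w.
Proof.
move=> w0 sw; have : `|(x%:~R - thr k - y0) / w| < 1.
  rewrite ltNge; apply/negP => /bump_eq0 b0; move/eqP: sw; apply.
  by rewrite /strip_weight b0 mulr0.
rewrite normrM normfV (gtr0_norm w0) ltr_pdivrMr// mul1r ltr_norml.
by move=> /andP[? ?]; apply/andP; split; lra.
Qed.

(** Inside the strip the area penalty of a step is at most [k2 / n * (y0 + w)]; outside it the
    weight is 0 and the step inequality is trivial. *)
Lemma surv_strip_ge (k1 k2 : R) n thr lam m (e C w y0 : R) r1 mid x :
  profile k1 k2 n thr lam m -> 0 <= k2 ->
  0 < w -> w <= y0 -> 0 <= C / w ^+ 2 <= 2^-1 ->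
  (forall l y, lo <= l <= hi ->
    (1 - C / w ^+ 2) * bump (y / w) * tilt_mass Y l <=
    tilt Y l (fun z => bump ((y + (z%:~R - tilt_mean Y l)) / w))) ->
  2 * (C / w ^+ 2) + k2 / n%:R * (y0 + w) <= e ->
  (r1 + mid <= n)%N ->
  ((strip_weight thr lam e w y0 r1 x)%:E <=
   surv Y thr mid r1 (fun y => (strip_weight thr lam e w y0 (r1 + mid) y)%:E) x)%E.
Proof.
move=> [thr0 lamJ thrS lamS mE] k20 w_gt0 wy0 Cw Hb He rmn.
have H := @surv_subsolution _ _ _ P Y thr
  (fun k x => (strip_weight thr lam e w y0 k x)%:E) mid r1 x; apply: H.
  by move=> i y; rewrite lee_fin strip_weight_ge0.
move=> k {}x /andP[_ kr]; have kn : (k < n)%N by exact: leq_trans rmn.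
have lJ := lamJ k kn.
have := surv_bump_step (\sum_(0 <= i < k.+1) (tilt_rate Y (lam i.+1) + e)) lJ
  (thrS k kn) w_gt0 wy0 Cw (Hb _ (x%:~R - thr k - y0) lJ).
apply: le_trans; rewrite lee_fin.
have [sw0|sw0] := eqVneq (strip_weight thr lam e w y0 k x) 0.
  by rewrite sw0 mulr_ge0 ?expR_ge0 ?bump_ge0.
have /andP[y1 y2] := strip_weight_neq0 w_gt0 sw0.
rewrite /strip_weight ler_wpM2r ?bump_ge0// ler_expR big_nat_recr//=.
set y := x%:~R - thr k in y1 y2 *; set l := lam k.+1; set t := C / w ^+ 2 in He *.
have /andP[_ dec] := lamS k kn; rewrite -/l in dec.
have yy0 : 0 <= y by lra.
have k2n : 0 <= k2 / n%:R by rewrite divr_ge0.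
have h1 := ler_wpM2r yy0 dec; have h2 := ler_wpM2l k2n (ltW y2).
move: (tilt_rate Y l) (\sum_(0 <= i < k) _) => A S; lra.
Qed.

Lemma surv_climb_ge (thr : nat -> R) (dd : nat -> R) (n r : nat) (l rho g : R)
    (zp : int) (G : int -> \bar R) :
  thr 0%N = 0 -> (r <= n)%N -> 0 <= rho -> 0 <= g ->
  (forall k, (k < n)%N -> thr k.+1 = thr k + dd k) ->
  (forall k, (k < n)%N -> l <= dd k <= zp%:~R - g) ->
  (rho%:E <= distribution P Y [set zp])%E -> (forall y, 0 <= G y)%E ->
  ((rho ^+ r)%:E * G (zp *+ r)%R <= surv Y thr r 0 G 0)%E.
Proof.
move=> thr0 rn rho0 g0 thrS ddb pzp G0.
have := @surv_path _ _ _ P Y thr rho (nseq r zp) 0 G 0 rho0 G0.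
rewrite size_nseq add0r sum_nseq_int; apply.
  by move=> z; rewrite mem_nseq => /andP[_ /eqP ->].
move=> i /andP[_ ir]; rewrite take_nseq// sum_nseq_int add0r add0n rmorphMn/= -mulr_natl.
have := curve_between thrS ddb (i := 0%N) (j := i).
rewrite add0n (leq_trans ir rn) thr0 !add0r => /(_ isT) /andP[_].
by have := mulr_ge0 (ler0n R i) g0; lra.
Qed.

Lemma surv_descent_ge (thr dd : nat -> R) (n r r0 : nat) (zm zp x m : int)
    (g B rho : R) :
  (r <= n)%N -> (r0 <= r)%N -> 0 < g -> 0 <= rho ->
  (forall k, (k < n)%N -> thr k.+1 = thr k + dd k) ->
  (forall k, (k < n)%N -> zm%:~R + g <= dd k <= zp%:~R - g) ->
  (forall z, z \in [:: zm; zp] ->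
    (rho%:E <= distribution P Y [set z])%E /\ `|z%:~R| <= B) ->
  (forall e, (e <= absz (zp - zm)%R)%N -> exists s : seq int,
    [/\ size s = r0, \sum_(z <- s) z = e%:Z & forall z, z \in s ->
      (rho%:E <= distribution P Y [set z])%E /\ `|z%:~R| <= B]) ->
  0 <= m%:~R - thr n <= 1 ->
  2 * (r0%:R * B) <= x%:~R - thr (n - r)%N ->
  x%:~R - thr (n - r)%N + r0%:R * B + 1 <= r%:R * g ->
  ((rho ^+ r)%:E <= surv Y thr r (n - r) (fun y => (y == m)%:R%:E) x)%E.
Proof.
move=> rn r0r g0 rho0 thrS ddb HB Hs mE yB yg.
have [_ Bm] := HB zm (mem_head _ _).
have [_ Bp] : (rho%:E <= distribution P Y [set zp])%E /\ `|zp%:~R| <= B.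
  by apply: HB; rewrite !inE eqxx orbT.
have [e [eg He]] := final_path rn r0r g0 thrS ddb Bm Bp mE yB yg.
have [s0 [sz0 sum0 p0]] := Hs e (ltnW eg).
have [s [szs tot sub above]] := He s0 sz0 sum0 (fun z zs => (p0 z zs).2).
have := @surv_path _ _ _ P Y thr rho s (n - r)%N (fun y => (y == m)%:R%:E) x rho0.
rewrite szs tot eqxx mule1; apply.
- by move=> y; rewrite lee_fin.
- move=> z /sub; rewrite inE => /orP[/eqP ->|]; first by case: (HB zm (mem_head _ _)).
  rewrite inE => /orP[/eqP ->|/p0[]//].
  by have [] : (rho%:E <= distribution P Y [set zp])%E /\ `|zp%:~R| <= B
    by apply: HB; rewrite !inE eqxx orbT.
- by move=> i ir; apply: above; rewrite szs.
Qed.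

(** Climb for [r1] steps, strip for [mid], descent for [r]. [U] bounds the heights at both
    junctions, where [lam k * y] costs at most [(hi - lo) * U]. *)
Lemma surv_three_stages (k1 k2 : R) n thr lam m (e C w U rho g B : R)
    (zm zp : int) r0 r1 mid r :
  profile k1 k2 n thr lam m -> 0 <= k2 -> 0 <= e ->
  n = (r1 + (mid + r))%N -> (0 < r1)%N -> (r0 <= r)%N ->
  0 < g -> 0 <= rho ->
  (forall l, lo <= l <= hi -> zm%:~R + g <= tilt_mean Y l <= zp%:~R - g) ->
  (forall z, z \in [:: zm; zp] ->
    (rho%:E <= distribution P Y [set z])%E /\ `|z%:~R| <= B) ->
  (forall i, (i <= absz (zp - zm)%R)%N -> exists s : seq int,
    [/\ size s = r0, \sum_(z <- s) z = i%:Z & forall z, z \in s ->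
      (rho%:E <= distribution P Y [set z])%E /\ `|z%:~R| <= B]) ->
  0 < w -> 0 <= C / w ^+ 2 <= 2^-1 ->
  (forall l y, lo <= l <= hi ->
    (1 - C / w ^+ 2) * bump (y / w) * tilt_mass Y l <=
    tilt Y l (fun z => bump ((y + (z%:~R - tilt_mean Y l)) / w))) ->
  w + 2 * (r0%:R * B) <= r1%:R * zp%:~R - thr r1 ->
  r1%:R * zp%:~R - thr r1 + w <= U -> U + r0%:R * B + 1 <= r%:R * g ->
  2 * (C / w ^+ 2) + k2 / n%:R * U <= e ->
  ((rho ^+ (r1 + r) *
      expR (- (profile_cost n lam + e * n%:R + 2 * (hi - lo) * U)))%:E <=
   surv Y thr n 0 (fun y => (y == m)%:R%:E) 0)%E.
Proof.
move=> prof k20 e0 nE r10 r0r g0 rho0 gap HB Hs w_gt0 Cw Hb; set y0 := _ - thr r1.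
move=> wy0 y0U Ug He.
have [thr0 lamJ thrS lamS mE] := prof.
have rn : (r <= n)%N by rewrite nE !addnA leq_addl.
have r1n : (r1 <= n)%N by rewrite nE leq_addr.
have midE : (r1 + mid = n - r)%N by rewrite nE addnA addnK.
pose dd k := tilt_mean Y (lam k.+1).
have ddb k : (k < n)%N -> zm%:~R + g <= dd k <= zp%:~R - g.
  by move=> kn; exact: gap (lamJ k kn).
have B0 : 0 <= B by have [_] := HB zm (mem_head _ _); apply: le_trans.
have r0B : 0 <= r0%:R * B by rewrite mulr_ge0.
have wy : w <= y0 by lra.
have k2n : 0 <= k2 / n%:R by rewrite divr_ge0.
have Hstep : 2 * (C / w ^+ 2) + k2 / n%:R * (y0 + w) <= e.
  by apply: le_trans He; rewrite lerD2l ler_wpM2l.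
have strip x := surv_strip_ge x prof k20 w_gt0 wy Cw Hb Hstep
  (leq_trans (eq_leq midE) (leq_subr r n)).
set L := hi - lo.
have L0 : 0 <= L by rewrite /L subr_ge0 (le_trans lo0).
have lamL k : (0 < k <= n)%N -> `|lam k| <= L.
  case: k => // k /lamJ /andP[h1 h2]; rewrite ler_norml opprB /L.
  by have := lo0; have := hi0; move=> ? ?; apply/andP; split; lra.
pose S k := \sum_(0 <= i < k) (tilt_rate Y (lam i.+1) + e).
have rate0 k : (k < n)%N -> 0 <= tilt_rate Y (lam k.+1).
  move=> kn; exact: (tilt_rate_ge0 eta0 lo0 hi0 integ_lo integ_hi mean0 (lamJ k kn)).
have pos i j : (j <= n)%N ->
    0 <= \sum_(i <= k < j) (tilt_rate Y (lam k.+1) + e).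
  move=> jn; rewrite big_nat_cond; apply: sumr_ge0 => k /andP[/andP[_ kj] _].
  by rewrite addr_ge0// rate0//; exact: leq_trans kj jn.
have S_mono k : (k <= n)%N -> 0 <= S k <= S n.
  by move=> kn; rewrite /S (@big_cat_nat _ _ _ k 0 n)//= lerDl !pos.
have SE : S n = profile_cost n lam + e * n%:R.
  by rewrite /S big_split/= sumr_const_nat subn0 mulr_natr.
pose W := strip_weight thr lam e w y0.
have nr0 : (0 < n - r <= n)%N by rewrite leq_subr -midE addn_gt0 r10.
(* [expR (S n + L * U)] bounds the weight at time [n - r], and [rho ^+ r] is the price of the
   descent. *)
pose c := expR (- (S n + L * U)) * rho ^+ r.
have c0 : 0 <= c by rewrite mulr_ge0 ?expR_ge0// exprn_ge0.
have tail x : (c%:E * (W (n - r)%N x)%:E <=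
    surv Y thr r (n - r) (fun y => (y == m)%:R%:E) x)%E.
  have [W0|W0] := eqVneq (W (n - r)%N x) 0.
    by rewrite W0 mule0; apply: surv_ge0 => y; rewrite lee_fin.
  have /andP[y1 y2] := strip_weight_neq0 w_gt0 W0.
  have yy : 2 * (r0%:R * B) <= x%:~R - thr (n - r)%N by lra.
  have yg : x%:~R - thr (n - r)%N + r0%:R * B + 1 <= r%:R * g by lra.
  have := surv_descent_ge rn r0r g0 rho0 thrS ddb HB Hs mE yy yg.
  apply: le_trans; rewrite -EFinM lee_fin /c mulrAC ler_piMl ?exprn_ge0//.
  rewrite /W /strip_weight -/(S (n - r)%N) mulrA -expRD.
  apply: mulr_ile1; rewrite ?expR_ge0 ?bump_ge0 ?bump_le1//.
  rewrite -[leRHS]expR0 ler_expR.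
  have /andP[_ Sn] := S_mono _ (leq_subr r n).
  have yy0 : 0 <= x%:~R - thr (n - r)%N by lra.
  have := lamL _ nr0; rewrite ler_norml => /andP[_ lL].
  have h1 := ler_wpM2r yy0 lL.
  have yU : x%:~R - thr (n - r)%N <= U by lra.
  have h2 := ler_wpM2l L0 yU.
  by lra.
have start : expR (- (L * U)) <= W r1 (zp *+ r1).
  rewrite /W /strip_weight -/(S r1) rmorphMn/= -mulr_natl -/y0.
  rewrite subrr mul0r bump0 mulr1 ler_expR.
  have /andP[Sr _] := S_mono r1 r1n.
  have := lamL r1; rewrite r1n r10 => /(_ isT); rewrite ler_norml => /andP[lL _].
  have yy0 : 0 <= y0 by lra.
  have yU : y0 <= U by lra.
  have h1 := ler_wpM2r yy0 lL; have h2 := ler_wpM2l L0 yU.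
  by lra.
have W0 k x : (0 <= (W k x)%:E)%E by rewrite lee_fin strip_weight_ge0.
pose Gr x := surv Y thr r (n - r) (fun y => (y == m)%:R%:E) x.
have Gr0 x : (0 <= Gr x)%E by apply: surv_ge0 => y; rewrite lee_fin.
rewrite [n in surv _ _ n _ _ _]nE surv_add add0n.
rewrite (_ : surv Y thr (mid + r) r1 _ = surv Y thr mid r1 Gr); last first.
  by apply/funext => x; rewrite surv_add midE.
apply: (@le_trans _ _ (surv Y thr r1 0 (fun x => c%:E * (W r1 x)%:E)%E 0)); last first.
  apply: le_surv => [y|y]; first by rewrite mule_ge0.
  apply: le_trans (lee_wpmul2l _ (strip y)) _; first by rewrite lee_fin.
  rewrite midE -surv_scale//; apply: le_surv => x; first by rewrite mule_ge0.
  exact: tail.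
rewrite surv_scale//.
have := surv_climb_ge (l := zm%:~R + g) thr0 r1n rho0 (ltW g0) thrS ddb
  (HB zp _).1 (W0 r1).
rewrite !inE eqxx orbT => /(_ isT) climb.
apply: le_trans (lee_wpmul2l _ climb); last by rewrite lee_fin.
rewrite -!EFinM lee_fin.
have -> : rho ^+ (r1 + r) * expR (- (profile_cost n lam + e * n%:R + 2 * (hi - lo) * U)) =
    c * (rho ^+ r1 * expR (- (L * U))).
  have -> : expR (- (profile_cost n lam + e * n%:R + 2 * (hi - lo) * U)) =
      expR (- (S n + L * U)) * expR (- (L * U)).
    by rewrite -expRD SE; congr expR; rewrite /L; ring.
  by rewrite exprD /c; ring.
by rewrite ler_wpM2l// ler_wpM2l// exprn_ge0.
Qed.

Lemma surv_profile_ge (k1 k2 : R) : 0 <= k2 ->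
  exists2 D : R, 0 < D & exists2 N0 : R, 0 < N0 &
  forall (n : nat) (N : R) thr lam m,
  N0 <= N -> n%:R = N ^+ 3 -> profile k1 k2 n thr lam m ->
  ((expR (- profile_cost n lam - D * N))%:E <=
   surv Y thr n 0 (fun y => (y == m)%:R%:E) 0)%E.
Proof.
move=> k20.
have [zm [zp [g g0 [pm pp gap]]]] :=
  exists_atoms eta0 lo0 hi0 integ_lo integ_hi mean0 var_neq0.
have chz : charged Y [:: zm; zp].
  by move=> z; rewrite !inE => /orP[] /eqP ->.
have [r0 [rho [B [rho0 rho1 B0 HB Hs]]]] :=
  exact_displacements irr aper (absz (zp - zm)%R) chz.
have [C C0 [w0 w00 Hb]] :=
  tilt_bump_ge eta0 lo0 hi0 integ_lo integ_hi mean0 var_neq0.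
have [_ zmB] := HB zm (mem_head _ _).
have [_ zpB] : (rho%:E <= distribution P Y [set zp])%E /\ `|zp%:~R| <= B.
  by apply: HB; rewrite !inE eqxx orbT.
pose L := hi - lo; have L0 : 0 <= L by rewrite /L subr_ge0 (le_trans lo0).
have r0B : 0 <= r0%:R * B by rewrite mulr_ge0// ltW.
pose K := (6 * B + r0%:R * B + 2) / g + r0%:R.
have K0 : 0 <= K by rewrite addr_ge0// divr_ge0 ?(ltW g0)// !addr_ge0// mulr_ge0// ltW.
pose E := 8 * C / g ^+ 2 + 6 * B * k2.
have E0 : 0 <= E.
  rewrite addr_ge0//; last by rewrite !mulr_ge0// ltW.
  by rewrite divr_ge0 ?sqr_ge0// mulr_ge0// ltW.
pose p := - ln rho.
have p0 : 0 <= p by rewrite /p oppr_ge0 ln_le0.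
have rhoE k : rho ^+ k = expR (- (p * k%:R)).
  by rewrite /p mulNr opprK -{1}(lnK (rho0 : rho \is Num.pos)) -expRM_natr.
have [N1 N11 HN1] := strip_constants g0 B0 C0 k20 w00 r0B.
(* In turn: the loss [E / N ^+ 2] over [N ^+ 3] steps, two junction terms [L * U] with
   [U = 6 * B * N], and at most [(K + 3) * N] prescribed steps at a price [p] each; the 1 makes [D]
   positive. *)
pose D := E + 12 * B * L + p * (K + 3) + 1.
have BL : 0 <= B * L by rewrite mulr_ge0// ltW.
have pK : 0 <= p * (K + 3) by rewrite mulr_ge0// addr_ge0.
exists D; first by rewrite /D; lra.
exists (N1 + (K + 3)) => [|n N thr lam m NN nE prof]; first by lra.
have [NN1 KN N_ge1] : [/\ N1 <= N, K + 3 <= N & 1 <= N] by split; lra.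
have N_gt0 : 0 < N by exact: lt_le_trans N_ge1.
have [thr0 lamJ thrS _ _] := prof.
have NN3 : (K + 3) * N <= n%:R.
  rewrite nE exprS expr2 mulrC ler_pM2l//.
  by apply: (le_trans KN); rewrite ler_peMr// ltW.
pose r1 := (Num.truncn N).+1; pose r := (Num.truncn (K * N)).+1.
have r1b : N <= r1%:R <= 2 * N.
  have /truncn_itv/andP[h1 h2] : 0 <= N by rewrite ltW.
  by rewrite (ltW h2)/= /r1 -natr1; lra.
have /andP[rl ru] : K * N <= r%:R <= K * N + 1.
  have /truncn_itv/andP[h1 h2] : 0 <= K * N by rewrite mulr_ge0// ltW.
  by rewrite (ltW h2)/= /r -natr1; lra.
have rr : r1%:R + r%:R <= (K + 3) * N by have /andP[_ ?] := r1b; lra.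
have r1rn : (r1 + r <= n)%N by rewrite -(ler_nat R) natrD (le_trans rr).
have nE' : n = (r1 + (n - (r1 + r) + r))%N by rewrite addnCA subnK.
have ddb k : (k < n)%N -> zm%:~R + g <= tilt_mean Y (lam k.+1) <= zp%:~R - g.
  by move=> kn; exact: gap (lamJ k kn).
have r1n : (r1 <= n)%N by apply: leq_trans r1rn; rewrite leq_addr.
have /andP[y0l y0u] := climb_height g0 thr0 r1n thrS ddb zmB zpB r1b.
have [r0r Krg] := descent_length g0 (ltW B0) N_ge1 rl.
set y0 := _ - thr r1 in y0l y0u.
have [w_gt0 w0w bw Cw He] := HN1 N y0 NN1 y0l.
rewrite -nE in He.
have e0 : 0 <= E / N ^+ 2 by rewrite divr_ge0 ?sqr_ge0.
have wy0 : y0 / 2 + 2 * (r0%:R * B) <= y0 by lra.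
have y0U : y0 + y0 / 2 <= 6 * B * N by lra.
have := surv_three_stages prof k20 e0 nE' isT r0r g0 (ltW rho0) gap HB Hs
  w_gt0 Cw (fun l y lJ => Hb l _ y lJ w0w) wy0 y0U Krg He.
apply: le_trans; rewrite lee_fin rhoE -expRD ler_expR natrD.
have -> : E / N ^+ 2 * n%:R = E * N by rewrite nE; field; rewrite gt_eqF.
have := ler_wpM2l p0 rr; rewrite -/L /D; lra.
Qed.

End profiles.

(** * The domain of the moment generating function; cube roots *)

Section moment_generating_function.
Context d (T : measurableType d) (R : realType) (P : probability T R).
Variable Y : {RV P >-> int}.

Lemma mgf_integ t : (mgf Y t < +oo)%E -> integ Y (fun z => expR (t * z%:~R)).
Proof.
rewrite /mgf /mmt_gen_fun unlock => ty; apply: integ_ge0_lty.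
  by move=> z; exact: expR_ge0.
rewrite (_ : (\int[P]_w _)%E = (\int[P]_w (expR (t * (Y w)%:~R))%:E)%E) in ty => //.
by apply: eq_integral => w _ /=; rewrite mulrC.
Qed.

Lemma integ_exp_between s u t : s <= u <= t ->
  integ Y (fun z => expR (s * z%:~R)) -> integ Y (fun z => expR (t * z%:~R)) ->
  integ Y (fun z => expR (u * z%:~R)).
Proof.
move=> /andP[su ut] si ti; apply: integ_le (integD si ti) => z.
rewrite ger0_norm ?expR_ge0//; have [z0|z0] := leP 0 (z%:~R : R).
  by rewrite ler_wpDl ?expR_ge0// ler_expR ler_wpM2r.
by rewrite ler_wpDr ?expR_ge0// ler_expR ler_wnM2r// ltW.
Qed.

Lemma a_star_lt (x : R) : (a_star Y < x%:E)%E ->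
  exists2 t, t < x & integ Y (fun z => expR (t * z%:~R)).
Proof.
by move=> /ereal_inf_lt[_ [t tf <-] tx]; exists t => //; exact: mgf_integ.
Qed.

Lemma b_star_gt (x : R) : (x%:E < b_star Y)%E ->
  exists2 t, x < t & integ Y (fun z => expR (t * z%:~R)).
Proof.
by move=> /ereal_sup_gt[_ [t tf <-] tx]; exists t => //; exact: mgf_integ.
Qed.

Lemma integ_in_star (t : R) : (a_star Y < t%:E < b_star Y)%E ->
  integ Y (fun z => expR (t * z%:~R)).
Proof.
move=> /andP[/a_star_lt[s st si] /b_star_gt[u tu ui]].
by apply: integ_exp_between si ui; rewrite !ltW.
Qed.

(** The window must contain 0 as well as [[a, b]]. When [a > 0] or [b <= 0], the moment of order
    [delta] supplies an integrable exponent on the other side of 0. *)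
Lemma tilting_window (delta a b : R) : 0 < delta -> a < b ->
  ('E_P[fun w => expR (delta * `|(Y w)%:~R|)%R] < +oo)%E ->
  (a_star Y < a%:E)%E -> (b%:E < b_star Y)%E ->
  exists lo hi eta : R,
    [/\ 0 < eta, lo <= 0, 0 <= hi, lo < a & b < hi] /\
    integ Y (fun z => expR ((lo - eta) * z%:~R)) /\
    integ Y (fun z => expR ((hi + eta) * z%:~R)).
Proof.
move=> d0 ab dfin /a_star_lt[t0 t0a i0] /b_star_gt[t1 bt1 i1].
have di : integ Y (fun z => expR (delta * `|z%:~R|)).
  apply: integ_ge0_lty; first by move=> z; exact: expR_ge0.
  by rewrite unlock in dfin.
have dom (s : R) : `|s| <= delta -> integ Y (fun z => expR (s * z%:~R)).
  move=> sd; apply: integ_le di => z; rewrite ger0_norm ?expR_ge0// ler_expR.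
  by apply: le_trans (ler_norm _) _; rewrite normrM ler_wpM2r.
have [s0 [s0lt s0i]] : exists s, s < Num.min a 0 /\ integ Y (fun z => expR (s * z%:~R)).
  have [a0|a0] := leP a 0; first by exists t0.
  by exists (- delta); split; [rewrite oppr_lt0|apply: dom; rewrite normrN gtr0_norm].
have [s1 [s1gt s1i]] : exists s, Num.max b 0 < s /\ integ Y (fun z => expR (s * z%:~R)).
  have [b0|b0] := leP b 0; last by exists t1.
  by exists delta; split => //; apply: dom; rewrite gtr0_norm.
set ma := Num.min a 0 in s0lt; set mb := Num.max b 0 in s1gt.
have [maa ma0] : ma <= a /\ ma <= 0 by rewrite !ge_min !lexx orbT.
have [mbb mb0] : b <= mb /\ 0 <= mb by rewrite !le_max !lexx orbT.
(* Half of the room: one [eta] moves the ends strictly beyond [a] and [b], a second one is the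
   margin. *)
pose eta := Num.min (ma - s0) (s1 - mb) / 2.
have eta0 : 0 < eta by rewrite divr_gt0// lt_min !subr_gt0 s0lt.
have e1 : 2 * eta <= ma - s0 by rewrite mulrC divfK// ge_min lexx.
have e2 : 2 * eta <= s1 - mb by rewrite mulrC divfK// ge_min lexx orbT.
move: eta eta0 e1 e2 => eta eta0 e1 e2.
exists (ma - eta), (mb + eta), eta; split; first by split=> //; lra.
by split; apply: integ_exp_between s0i s1i; apply/andP; split; lra.
Qed.

End moment_generating_function.

Lemma cube_root (R : realType) (n : nat) : (0 < n)%N ->
  n%:R = (n%:R `^ (3%:R^-1)) ^+ 3 :> R.
Proof.
by move=> n0; rewrite -powR_mulrn ?powR_ge0// -powRrM mulVf// powRr1.
Qed.

Lemma cube_root_ge (R : realType) (B : R) : exists n0 : nat, (1 <= n0)%N /\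
  forall n, (n0 <= n)%N -> B <= n%:R `^ (3%:R^-1).
Proof.
pose C := Num.max B 1; exists (Num.truncn (C ^+ 3)).+1; split=> // n nn.
have C1 : 1 <= C by rewrite le_max lexx orbT.
have C3 : 0 <= C ^+ 3 by rewrite exprn_ge0// (le_trans ler01).
have /truncn_itv/andP[_ h] := C3.
have n0 : (0 < n)%N by exact: leq_trans nn.
have CN : C ^+ 3 <= (n%:R `^ (3%:R^-1)) ^+ 3.
  by rewrite -cube_root// (le_trans (ltW h))// ler_nat.
apply: (@le_trans _ _ C); first by rewrite le_max lexx.
rewrite leNgt; apply/negP => NC.
suff : (n%:R `^ (3%:R^-1)) ^+ 3 < C ^+ 3 by rewrite ltNge CN.
by rewrite ltrXn2r// nnegrE ?powR_ge0// (le_trans ler01).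
Qed.

(** [future] starts at time 1; at time 0 the constraint reads [0 <= 0]. *)
Lemma future_scaled d (T : measurableType d) (R : realType) (P : probability T R)
    (X : nat -> {RV P >-> int}) (h : R -> R) (n : nat) (m : int) : h 0 = 0 ->
  [set w | (forall k : nat, (k <= n)%N -> scaled h n k <= (walk X k w)%:~R) /\
           walk X n w = m] = future X (scaled h n) n m 0.
Proof.
move=> h0; apply/seteqP; split=> w [above wm]; split=> //.
  by move=> k /andP[_ kn]; exact: above.
move=> k kn; case: (posnP k) => [->|k0]; last by apply: above; rewrite k0.
by rewrite /scaled mul0r h0 mulr0 /walk big_nil.
Qed.

(** * The tilts along the curve form a profile *)

Section tilts_along_the_profile.
Context d (T : measurableType d) (R : realType) (P : probability T R).
Variable Y : {RV P >-> int}.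
Variables lo hi eta a b : R.
Hypothesis eta0 : 0 < eta.
Hypotheses (lo0 : lo <= 0) (hi0 : 0 <= hi) (loa : lo < a) (bhi : b < hi).
Hypothesis integ_lo : integ Y (fun z => expR ((lo - eta) * z%:~R)).
Hypothesis integ_hi : integ Y (fun z => expR ((hi + eta) * z%:~R)).
Hypothesis mean0 : EX Y (fun z => z%:~R) = 0.
Hypothesis var_neq0 : EX Y (fun z => z%:~R ^+ 2) != 0.
Hypotheses (star_a : (a_star Y < a%:E)%E) (star_b : (b%:E < b_star Y)%E).
Variable h : R -> R.
Hypothesis h_C2 : C2_on `[0, 1] h.
Hypothesis h2_lt0 : forall x : R, x \in `[0, 1] ->
  derive_in `[0, 1] (derive_in `[0, 1] h) x < 0.
Hypothesis h_slopes : derive_in `[0, 1] h @` `[0, 1] `<=`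
  derive1 (log_mgf Y) @` `[a, b].
Hypothesis h0 : h 0 = 0.
Notation slope := (derive_in `[0, 1] h).

(** [[a, b]] lies in the interior of the window, where [log_mgf] has derivative [tilt_mean]; the
    inclusion of slopes then yields a tilt at each point. *)
Lemma exists_slope_tilt : exists ell : R -> R, forall s, 0 <= s <= 1 ->
  a <= ell s <= b /\ tilt_mean Y (ell s) = slope s.
Proof.
have /choice[ell Hell] : forall s, exists l, 0 <= s <= 1 ->
    a <= l <= b /\ tilt_mean Y l = slope s.
  move=> s; case: (boolP (0 <= s <= 1)) => s01; last by exists 0.
  have [|l lab lE] := @h_slopes (slope s).
    by exists s => //; rewrite /= in_itv.
  move: lab; rewrite /= in_itv/= => /andP[al lb]; exists l => _; rewrite al lb.
  split=> //; rewrite -lE (derive1_log_mgf eta0 lo0 hi0 integ_lo integ_hi mean0)//.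
  by rewrite (lt_le_trans loa)//= (le_lt_trans lb).
by exists ell.
Qed.

Variable ell : R -> R.
Hypothesis ellP : forall s, 0 <= s <= 1 ->
  a <= ell s <= b /\ tilt_mean Y (ell s) = slope s.

Lemma ell_J s : 0 <= s <= 1 -> lo <= ell s <= hi.
Proof.
move=> /ellP[/andP[h1 h2] _].
by rewrite (le_trans (ltW loa))//= (le_trans h2)// ltW.
Qed.

Lemma rate_slope s : 0 <= s <= 1 -> rate Y (slope s) = (tilt_rate Y (ell s))%:E.
Proof.
move=> s01; have [/andP[h1 h2] <-] := ellP s01.
apply: (rate_tilt_mean eta0 lo0 hi0 integ_lo integ_hi mean0) => //.
- exact: ell_J.
- by rewrite (lt_le_trans star_a) ?lee_fin//= (le_lt_trans _ star_b)// lee_fin.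
- by move=> mu; exact: integ_in_star.
Qed.

(** The subgradients of the rate function lie in the window, which contains 0, so they are at most
    [hi - lo] in size; and [h'] is Lipschitz. *)
Lemma tilt_rate_lipschitz : exists2 L : R, 0 <= L &
  forall s t, 0 <= s <= 1 -> 0 <= t <= 1 ->
    `|tilt_rate Y (ell s) - tilt_rate Y (ell t)| <= L * `|s - t|.
Proof.
have [c [C [c0 C0 HC]]] := slope_decreasing h_C2 h2_lt0.
have L0 : 0 <= hi - lo by rewrite subr_ge0 (le_trans lo0).
exists ((hi - lo) * C); first by rewrite mulr_ge0// ltW.
have slope_lip s t : 0 <= s <= 1 -> 0 <= t <= 1 ->
    `|slope s - slope t| <= C * `|s - t|.
  wlog st : s t / s <= t.
    move=> H sJ tJ; have [/H|/ltW ts] := leP s t; first exact.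
    by rewrite distrC (distrC s t); exact: H.
  move=> /andP[s0 s1] /andP[t0 t1]; have /andP[h1 h2] := HC s t s0 st t1.
  have st0 : 0 <= t - s by rewrite subr_ge0.
  rewrite ger0_norm; last by apply: le_trans h1; rewrite mulr_ge0// ltW.
  by rewrite distrC (ger0_norm st0).
have one s t : 0 <= s <= 1 -> 0 <= t <= 1 ->
    tilt_rate Y (ell s) - tilt_rate Y (ell t) <= (hi - lo) * C * `|s - t|.
  move=> sJ tJ.
  apply: le_trans (tilt_rate_sub eta0 lo0 hi0 integ_lo integ_hi mean0 (ell_J sJ) (ell_J tJ)) _.
  rewrite (ellP sJ).2 (ellP tJ).2; apply: le_trans (ler_norm _) _.
  rewrite normrM -mulrA ler_pM//; last exact: slope_lip.
  have /andP[e1 e2] := ell_J sJ; have := lo0; have := hi0 => p0 p1.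
  by rewrite ler_norml; apply/andP; split; lra.
move=> s t sJ tJ; rewrite ler_norml one// andbT lerNl opprB distrC.
exact: one.
Qed.

Lemma scaledS (n k : nat) (s : R) : (0 < n)%N ->
  h (k.+1%:R / n%:R) - h (k%:R / n%:R) = slope s * (k.+1%:R / n%:R - k%:R / n%:R) ->
  scaled h n k.+1 = scaled h n k + slope s.
Proof.
move=> n0 hE; rewrite /scaled -(subrK (h (k%:R / n%:R)) (h (k.+1%:R / n%:R))) hE.
rewrite -mulrBl -natrB// subSnn mulrDr addrC; congr (_ + _).
by field; rewrite pnatr_eq0 -lt0n.
Qed.

(** Increments of the scaled curve are slopes at mean value points [t k], so the tilts [ell (t k)]
    have exactly the required means. [second_difference] puts consecutive slopes between [c / n] and
    [C / n] apart; [HQ] and [Hq] pass this to the tilts. *)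
Lemma profile_of_scaled : exists k1 k2 : R, [/\ 0 < k1, 0 <= k2 &
  forall n, (0 < n)%N -> exists (t : nat -> R) (l0 : R),
    (forall k, (k < n)%N -> k%:R / n%:R <= t k <= k.+1%:R / n%:R) /\
    profile Y lo hi k1 k2 n (scaled h n)
      (fun k => if k is i.+1 then ell (t i) else l0) (Num.ceil (scaled h n n))].
Proof.
have [c [C [c0 C0 HC]]] := slope_decreasing h_C2 h2_lt0.
have [q q0 Hq] :=
  tilt_mean_increasing eta0 lo0 hi0 integ_lo integ_hi mean0 var_neq0.
have [Q Q0 HQ] := tilt_mean_lipschitz eta0 lo0 hi0 integ_lo integ_hi mean0.
(* [c / Q] and [C / q] bound the decay of the genuine tilts; the added [c / Q] accommodates [lam 0],
   whose decay is set to exactly [k1 / n]. *)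
exists (c / Q), (C / q + c / Q); split.
- exact: divr_gt0.
- by rewrite addr_ge0// divr_ge0// ltW.
move=> n n0; have nR : 0 < n%:R :> R by rewrite ltr0n.
have [t Ht] : exists t : nat -> R, forall k, (k < n)%N ->
    k%:R / n%:R < t k < k.+1%:R / n%:R /\
    h (k.+1%:R / n%:R) - h (k%:R / n%:R) =
      slope (t k) * (k.+1%:R / n%:R - k%:R / n%:R).
  have /choice[t Ht] : forall k, exists s, (k < n)%N ->
      k%:R / n%:R < s < k.+1%:R / n%:R /\
      h (k.+1%:R / n%:R) - h (k%:R / n%:R) =
        slope s * (k.+1%:R / n%:R - k%:R / n%:R).
    move=> k; case: (ltnP k n) => kn; last by exists 0.
    have [||| s sk sE] := slope_chord h_C2 (s := k%:R / n%:R) (t := k.+1%:R / n%:R).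
    - by rewrite divr_ge0// ltW.
    - by rewrite ltr_pM2r ?invr_gt0// ltr_nat.
    - by rewrite ler_pdivrMr// mul1r ler_nat.
    - by exists s.
  by exists t.
have t01 k : (k < n)%N -> 0 <= t k <= 1.
  move=> kn; have [/andP[h1 h2] _] := Ht k kn.
  have k0 : 0 <= k%:R / n%:R :> R by rewrite divr_ge0// ltW.
  have k1 : k.+1%:R / n%:R <= 1 :> R by rewrite ler_pdivrMr// mul1r ler_nat.
  by apply/andP; split; lra.
exists t, (ell (t 0%N) + c / Q / n%:R); split.
  by move=> k kn; have [/andP[h1 h2] _] := Ht k kn; rewrite !ltW.
split.
- by rewrite /scaled mul0r h0 mulr0.
- by move=> k kn; apply/ell_J/t01.
- move=> k kn; rewrite (scaledS n0 (Ht k kn).2).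
  by rewrite (ellP (t01 k kn)).2.
- have cQn : 0 <= c / Q / n%:R by rewrite !divr_ge0// ltW.
  have Cqn : 0 <= C / q / n%:R by rewrite !divr_ge0// ltW.
  case=> [_|k kn].
    by rewrite [X in _ <= X - _ <= _]addrC addrK lexx/= mulrDl lerDr.
  have kn' := ltnW kn.
  have d1 := scaledS n0 (Ht k kn').2; have d2 := scaledS n0 (Ht k.+1 kn).2.
  have e0 : 0 < n%:R^-1 :> R by rewrite invr_gt0.
  have sE : k.+1%:R / n%:R = k%:R / n%:R + n%:R^-1 :> R.
    by rewrite -natr1 mulrDl mul1r.
  have sE2 : k.+2%:R / n%:R = k%:R / n%:R + 2 * n%:R^-1 :> R.
    by rewrite -addn2 natrD mulrDl.
  have := @second_difference _ h h_C2 n%:R^-1 (k%:R / n%:R) c C HC e0.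
  have k0 : 0 <= k%:R / n%:R :> R by rewrite divr_ge0// ltW.
  have k2n : k%:R / n%:R + 2 * n%:R^-1 <= 1 :> R.
    by rewrite -sE2 ler_pdivrMr// mul1r ler_nat.
  rewrite -sE -sE2 => /(_ k0); rewrite sE2 => /(_ k2n); rewrite -sE2.
  have sdE : 2 * h (k.+1%:R / n%:R) - h (k%:R / n%:R) - h (k.+2%:R / n%:R) =
      (slope (t k) - slope (t k.+1)) / n%:R.
    move: d1 d2; rewrite /scaled => d1 d2.
    have -> : slope (t k) = n%:R * h (k.+1%:R / n%:R) - n%:R * h (k%:R / n%:R).
      by rewrite d1; ring.
    have -> : slope (t k.+1) = n%:R * h (k.+2%:R / n%:R) - n%:R * h (k.+1%:R / n%:R).
      by rewrite d2; ring.
    by field; rewrite gt_eqF.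
  rewrite sdE -[slope (t k)](ellP (t01 k kn')).2 -[slope (t k.+1)](ellP (t01 _ kn)).2.
  set l := ell (t k); set l' := ell (t k.+1).
  have lJ : lo <= l <= hi := ell_J (t01 k kn').
  have lJ' : lo <= l' <= hi := ell_J (t01 _ kn).
  rewrite expr2 !mulrA !ler_pM2r// => /andP[m1 m2].
  have cn : 0 < c / n%:R by rewrite divr_gt0.
  have ll : l' <= l.
    rewrite leNgt; apply/negP => /ltW ll'.
    have := Hq l l' lJ lJ' ll'.
    have : 0 <= q * (l' - l) by rewrite mulr_ge0 ?(ltW q0)// subr_ge0.
    lra.
  have u1 := Hq l' l lJ' lJ ll; have u2 := HQ l' l lJ' lJ ll.
  apply/andP; split.
    have -> : c / Q / n%:R = c / n%:R / Q by ring.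
    by rewrite ler_pdivrMr// [leRHS]mulrC; apply: le_trans u2.
  rewrite mulrDl; have : l - l' <= C / q / n%:R; last by lra.
  have -> : C / q / n%:R = C / n%:R / q by ring.
  by rewrite ler_pdivlMr// mulrC; apply: le_trans m2.
- have := ceil_ge (scaled h n n); have := ceilB1_lt (scaled h n n).
  by rewrite intrB => ? ?; apply/andP; split; lra.
Qed.

End tilts_along_the_profile.

(** * Comparison of the discrete cost with the integral of the rate *)

Theorem theorem1p1 (d : measure_display) (T : measurableType d) (R : realType)
    (P : probability T R) (X : nat -> {RV P >-> int})
    (sigma delta a b : R) (h : R -> R) :
  iid X ->
  irreducible_chain (walk_transition (X 0%N)) ->
  aperiodic_chain (walk_transition (X 0%N)) ->
  0 < sigma -> 0 < delta ->
  ('E_P[fun w => (X 0%N w)%:~R] = 0)%E ->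
  ('E_P[fun w => ((X 0%N w)%:~R ^+ 2)%R] = (sigma ^+ 2)%:E)%E ->
  ('E_P[fun w => expR (delta * `|(X 0%N w)%:~R|)%R] < +oo)%E ->
  (a_star (X 0%N) < a%:E)%E -> a < b -> (b%:E < b_star (X 0%N))%E ->
  C2_on `[0, 1] h ->
  (forall x : R, x \in `[0, 1] -> 0 <= h x) ->
  concave_function `[0, 1] h ->
  (forall x : R, x \in `[0, 1] -> derive_in `[0, 1] (derive_in `[0, 1] h) x < 0) ->
  derive_in `[0, 1] h @` `[0, 1] `<=` derive1 (log_mgf (X 0%N)) @` `[a, b] ->
  h 0 = 0 ->
  exists (c_plus c_minus : R) (n0 : nat),
    [/\ 0 < c_minus, c_minus <= c_plus, (1 <= n0)%N &
     forall n : nat, (n0 <= n)%N ->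
       let p := (expeR (n%:R%:E * \int[lebesgue_measure]_(s in `[0%R, 1%R])
                            rate (X 0%N) (derive_in `[0%R, 1%R] h s)) *
                 P [set w | (forall k : nat, (k <= n)%N ->
                               (scaled h n k <= (walk X k w)%:~R)%R) /\
                            walk X n w = Num.ceil (scaled h n n)])%E in
       ((expR (- c_plus * n%:R `^ (3%:R^-1)))%:E <= p)%E /\
       (p <= (expR (- c_minus * n%:R `^ (3%:R^-1)))%:E)%E].
Proof.
move=> iidX irr aper sigma0 delta0 mean var emom star_a ab star_b hC2 _ _ h2 hsl h0.
set Y := X 0%N in irr aper mean var emom star_a star_b hsl *.
have [lo [hi [eta [[eta0 lo0 hi0 loa bhi] [ilo ihi]]]]] :=
  tilting_window delta0 ab emom star_a star_b.
have mean0 : EX Y (fun z => z%:~R) = 0.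
  by move: mean; rewrite unlock /EX /Rintegral => ->.
have var_neq0 : EX Y (fun z => z%:~R ^+ 2) != 0.
  move: var; rewrite unlock /EX /Rintegral => ->.
  by rewrite /= expf_neq0// gt_eqF.
have [ell ellP] := exists_slope_tilt eta0 lo0 hi0 loa bhi ilo ihi mean0 hsl.
have [L L0 HL] := tilt_rate_lipschitz eta0 lo0 hi0 loa bhi ilo ihi mean0 hC2 h2 ellP.
have [k1 [k2 [k10 k20 Hprof]]] :=
  profile_of_scaled eta0 lo0 hi0 loa bhi ilo ihi mean0 var_neq0 hC2 h2 h0 ellP.
have [q q0 [N1 N10 Hup]] :=
  surv_profile_le eta0 lo0 hi0 ilo ihi mean0 var_neq0 k2 k10.
have [D D0 [N2 N20 Hlow]] :=
  surv_profile_ge eta0 lo0 hi0 ilo ihi mean0 var_neq0 irr aper k1 k20.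
pose f s := tilt_rate Y (ell s).
have intE : (\int[lebesgue_measure]_(s in `[0%R, 1%R])
    rate Y (derive_in `[0%R, 1%R] h s) =
    (\int[lebesgue_measure]_(s in `[0%R, 1%R]) f s)%:E)%E.
  rewrite /Rintegral fineK; last first.
    by apply: integrable_fin_num => //; exact: lipschitz_integrable HL.
  apply: eq_integral => s; rewrite inE /= in_itv/= => s01.
  exact: (rate_slope eta0 lo0 hi0 loa bhi ilo ihi mean0 star_a star_b ellP).
pose A := hi - lo + L.
have A0 : 0 <= A by rewrite addr_ge0// subr_ge0 (le_trans lo0).
(* Half of the gain [q * N] absorbs the bounded errors: [hi - lo] from the upper bound and [L] from
   the Riemann sum. *)
have [n0 [n01 Hn0]] := cube_root_ge (1 + N1 + N2 + 2 * A / q).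
(* The Riemann error [L] is at most [L * N], hence [D + L]; the maximum secures
   [c_minus <= c_plus]. *)
exists (Num.max (D + L) (q / 2)), (q / 2), n0; split=> //.
- exact: divr_gt0.
- by rewrite le_max lexx orbT.
move=> n nn; have n_gt0 : (0 < n)%N by exact: leq_trans nn.
rewrite future_scaled// prob_future// intE -EFinM/=.
have NN := Hn0 n nn; have cubeE := @cube_root R n n_gt0.
set N := n%:R `^ (3%:R^-1) in NN cubeE *.
have Aq0 : 0 <= 2 * A / q by rewrite divr_ge0 ?(ltW q0)// mulr_ge0.
have [NN1 NN2 N_ge1] : [/\ N1 <= N, N2 <= N & 1 <= N] by split; lra.
have ANq : 2 * A <= q * N.
  by rewrite [leRHS]mulrC -ler_pdivrMr//; lra.
have [t [l0 [Ht prof]]] := Hprof n n_gt0.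
set lam := (fun k => _) in prof; set m := Num.ceil _ in prof *.
have up := Hup n N _ _ _ NN1 cubeE prof; have low := Hlow n N _ _ _ NN2 cubeE prof.
have := riemann_sum_close HL n_gt0 Ht; rewrite -/f.
have -> : \sum_(0 <= k < n) f (t k) = profile_cost Y n lam by [].
rewrite ler_norml => /andP[c1 c2].
set I := n%:R * _ in c1 c2 *; set cost := profile_cost Y n lam in up low c1 c2.
have e0 : (0 <= (expR I)%:E)%E by rewrite lee_fin expR_ge0.
split.
  apply: le_trans (lee_wpmul2l e0 low); rewrite -EFinM lee_fin -expRD ler_expR.
  have mx : D + L <= Num.max (D + L) (q / 2) by rewrite le_max lexx.
  have N0 : 0 <= N by lra.
  have := ler_wpM2r N0 mx; have := ler_peMr L0 N_ge1; lra.
apply: le_trans (lee_wpmul2l e0 up) _; rewrite -EFinM lee_fin -expRD ler_expR.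
by rewrite /A in ANq; lra.
Qed.
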